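(* Let $\mathbb{F}\in\{\mathbb{R},\mathbb{C},\mathbb{H}\}$ and $m\in\{1,\ldots,n\}$. For a convex body $K$ in $\mathbb{F}^n$ with non-empty interior set $$\Phi_m^{\mathbb{F}}(K)=\int_{\mathrm{Gr}_m(n,\mathbb{F})}|P_EK|^{-n}\,dE,\qquad \widetilde\Phi_m^{\mathbb{F}}(K)=\int_{\mathrm{Gr}_m(n,\mathbb{F})}|K\cap E|^{n}\,dE.$$ Then for every convex body $K$ in $\mathbb{F}^n$ with non-empty interior and every $g\in\mathrm{SL}(n,\mathbb{F})$, $$\Phi_m^{\mathbb{F}}(gK)=\Phi_m^{\mathbb{F}}(K)\quad\text{and}\quad\widetilde\Phi_m^{\mathbb{F}}(gK)=\widetilde\Phi_m^{\mathbb{F}}(K).$$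
   Context: $\mathbb{F}^n$ is a right vector space over $\mathbb{F}$ with its standard euclidean inner product $\langle v,w\rangle=\operatorname{Re}\sum_i\overline{v_i}w_i$. $\mathrm{Gr}_m(n,\mathbb{F})$ is the Grassmannian of $m$-dimensional $\mathbb{F}$-linear subspaces of $\mathbb{F}^n$, and $dE$ is integration with respect to its unique Haar probability measure (invariant under $\mathrm{O}(n)$, $\mathrm{U}(n)$, $\mathrm{Sp}(n)$ respectively). $P_E\colon\mathbb{F}^n\to E$ is orthogonal projection; $|P_EK|$ and $|K\cap E|$ are euclidean volumes in $E$. A convex body is a non-empty compact convex set. $\mathrm{SL}(n,\mathbb{F})=\{A\in\mathrm{GL}(n,\mathbb{F}):\det A=1\}$, where $\det$ is the usual determinant for $\mathbb{R},\mathbb{C}$ and the Dieudonné determinant for $\mathbb{H}$: for a division ring $k$, $\det\colon \mathrm{Mat}(n,k)\to k^\times/[k^\times,k^\times]\cup\{0\}$ is the unique map such that (a) multiplying one row from the left by $\mu$ multiplies $\det$ by the class $[\mu]$ ($[0]=0$), (b) adding a left multiple of one row to another row does not change $\det$, (c) $\det$ of the unit matrix is $1$. ($[\mathbb{H}^\times,\mathbb{H}^\times]$ is the group of unit quaternions.) *)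

(* Defs.v *)
From HB Require Import structures.
From mathcomp Require Import all_boot all_order all_algebra ring lra.
From mathcomp Require Import complex.
From mathcomp Require Import all_classical all_reals all_analysis.

Set Implicit Arguments.
Unset Strict Implicit.
Unset Printing Implicit Defensive.

Import Order.TTheory GRing.Theory Num.Theory.
Import numFieldNormedType.Exports.
Local Open Scope classical_set_scope.
Local Open Scope ring_scope.

(* Quat a b c d is a + b i + c j + d k *)
Record quat (R : Type) := Quat { qre : R; qi : R; qj : R; qk : R }.

Definition quat_tuple (R : Type) (x : quat R) := (qre x, qi x, qj x, qk x).
Definition tuple_quat (R : Type) (t : R * R * R * R) :=
  let: (a, b, c, d) := t in Quat a b c d.
Lemma quat_tupleK (R : Type) : cancel (@quat_tuple R) (@tuple_quat R).
Proof. by case. Qed.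

HB.instance Definition _ (R : eqType) := Equality.copy (quat R)
  (can_type (@quat_tupleK R)).
HB.instance Definition _ (R : choiceType) := Choice.copy (quat R)
  (can_type (@quat_tupleK R)).

Section QuaternionRing.
Variable R : realFieldType.
Implicit Types x y z : quat R.

Definition qzero : quat R := Quat 0 0 0 0.
Definition qone : quat R := Quat 1 0 0 0.
Definition qopp x := Quat (- qre x) (- qi x) (- qj x) (- qk x).
Definition qadd x y :=
  Quat (qre x + qre y) (qi x + qi y) (qj x + qj y) (qk x + qk y).
Definition qmul x y := Quat
  (qre x * qre y - qi x * qi y - qj x * qj y - qk x * qk y)
  (qre x * qi y + qi x * qre y + qj x * qk y - qk x * qj y)
  (qre x * qj y - qi x * qk y + qj x * qre y + qk x * qi y)
  (qre x * qk y + qi x * qj y - qj x * qi y + qk x * qre y).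
Definition qconj x := Quat (qre x) (- qi x) (- qj x) (- qk x).
Definition qnorm2 x := qre x ^+ 2 + qi x ^+ 2 + qj x ^+ 2 + qk x ^+ 2.
Definition qinv x :=
  Quat (qre x / qnorm2 x) (- qi x / qnorm2 x) (- qj x / qnorm2 x)
       (- qk x / qnorm2 x).

Lemma qaddA : associative qadd.
Proof. by move=> x y z; rewrite /qadd /= !addrA. Qed.
Lemma qaddC : commutative qadd.
Proof. by move=> x y; congr Quat; rewrite addrC. Qed.
Lemma qadd0 : left_id qzero qadd.
Proof. by case=> *; rewrite /qadd /= !add0r. Qed.
Lemma qaddN : left_inverse qzero qopp qadd.
Proof. by case=> *; rewrite /qadd /= !addNr. Qed.

HB.instance Definition _ :=
  GRing.isZmodule.Build (quat R) qaddA qaddC qadd0 qaddN.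

Lemma qmulA : associative qmul.
Proof. by move=> x y z; congr Quat => /=; ring. Qed.
Lemma qmul1 : left_id qone qmul.
Proof. by case=> *; congr Quat => /=; ring. Qed.
Lemma qmulr1 : right_id qone qmul.
Proof. by case=> *; congr Quat => /=; ring. Qed.
Lemma qmulDl : left_distributive qmul qadd.
Proof. by move=> x y z; congr Quat => /=; ring. Qed.
Lemma qmulDr : right_distributive qmul qadd.
Proof. by move=> x y z; congr Quat => /=; ring. Qed.
Lemma qone_neq0 : qone != 0.
Proof. by apply/eqP => -[] /eqP; rewrite oner_eq0. Qed.

HB.instance Definition _ := GRing.Zmodule_isNzRing.Build (quat R)
  qmulA qmul1 qmulr1 qmulDl qmulDr qone_neq0.

Lemma qnorm2_neq0 x : x != 0 -> qnorm2 x != 0.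
Proof.
apply: contra_neq; case: x => a b c d; rewrite /qnorm2 /= => h.
have ha := sqr_ge0 a; have hb := sqr_ge0 b.
have hc := sqr_ge0 c; have hd := sqr_ge0 d.
by congr Quat; apply/eqP; rewrite -sqrf_eq0; apply/eqP; lra.
Qed.

Lemma qmulVr : {in [pred x : quat R | x != 0], left_inverse 1 qinv *%R}.
Proof.
move=> x; rewrite inE => /qnorm2_neq0.
by case: x => a b c d; rewrite /qinv /qnorm2 /= => h; congr Quat => /=; field.
Qed.

Lemma qmulrV : {in [pred x : quat R | x != 0], right_inverse 1 qinv *%R}.
Proof.
move=> x; rewrite inE => /qnorm2_neq0.
by case: x => a b c d; rewrite /qinv /qnorm2 /= => h; congr Quat => /=; field.
Qed.

Lemma qunitP x y : y * x = 1 /\ x * y = 1 -> x \in [pred x : quat R | x != 0].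
Proof.
case=> yx _; rewrite inE; apply/eqP => x0; move: yx; rewrite x0 mulr0.
by apply/eqP; rewrite eq_sym oner_eq0.
Qed.

Lemma qinv0 : {in [predC [pred x : quat R | x != 0]], qinv =1 id}.
Proof.
by move=> x; rewrite !inE negbK => /eqP ->; rewrite /qinv /= !oppr0 !mul0r.
Qed.

HB.instance Definition _ := GRing.NzRing_hasMulInverse.Build (quat R)
  qmulVr qmulrV qunitP qinv0.

End QuaternionRing.

(* [coord] identifies a scalar field with R^[rdim] by means of a basis which is
   orthonormal for the inner product (v, w) |-> [re] ([cj] v * w). *)
Record scalars (R : realType) := Scalars {
  scal :> unitRingType;
  cj : scal -> scal;
  re : scal -> R;
  rdim : nat;
  coord : scal -> 'rV[R]_rdim }.

Inductive field_kind := FR | FC | FH.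

Definition scalars_of (R : realType) (k : field_kind) : scalars R :=
  match k with
  | FR => @Scalars R R id id 1 (fun x => \row_(_ < 1) x)
  | FC => @Scalars R (complex R) (@conjc R) (@complex.Re R) 2
            (fun z => \row_(i < 2) nth 0 [:: complex.Re z; complex.Im z] i)
  | FH => @Scalars R (quat R) (@qconj R) (@qre R) 4
            (fun q => \row_(i < 4) nth 0 [:: qre q; qi q; qj q; qk q] i)
  end.

Section Dieudonne.
Variables (k : unitRingType) (n : nat).

Inductive commutator_subgroup : k -> Prop :=
| comm_one : commutator_subgroup 1
| comm_gen x y : x \is a GRing.unit -> y \is a GRing.unit ->
    commutator_subgroup (x * y * x^-1 * y^-1)
| comm_mul x y : commutator_subgroup x -> commutator_subgroup y ->
    commutator_subgroup (x * y)
| comm_inv x : commutator_subgroup x -> commutator_subgroup x^-1.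

(* Elements of k^x/[k^x,k^x] are represented by the corresponding cosets, as
   subsets of k; the adjoined zero is the class [set 0] of 0. *)
Definition dclass (a : k) : set k := [set a * c | c in commutator_subgroup].

Definition is_dieudonne_det (D : 'M[k]_n -> set k) :=
  [/\ forall A, exists a, D A = dclass a,
      forall (A : 'M[k]_n) (i : 'I_n) (mu : k),
        D (\matrix_(r, c) (if r == i then mu * A r c else A r c))
        = [set x * y | x in dclass mu & y in D A],
      forall (A : 'M[k]_n) (i j : 'I_n) (mu : k), i != j ->
        D (\matrix_(r, c) (if r == i then A i c + mu * A j c else A r c)) = D A
    & D 1%:M = dclass 1].

Definition invertible (A : 'M[k]_n) :=
  exists B : 'M[k]_n, A *m B = 1%:M /\ B *m A = 1%:M.

End Dieudonne.

Definition det_eq1 (R : realType) (k : field_kind) (n : nat) :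
    'M[scalars_of R k]_n -> Prop :=
  match k with
  | FR => fun g : 'M[R]_n => \det g = 1
  | FC => fun g : 'M[complex R]_n => \det g = 1
  | FH => fun g : 'M[quat R]_n =>
      exists2 D, is_dieudonne_det D & D g = dclass 1
  end.

Definition SL (R : realType) (k : field_kind) (n : nat) :
    set 'M[scalars_of R k]_n :=
  [set g | invertible g /\ det_eq1 g].

Fixpoint lebesgue_tuple (R : realType) (N : nat) :
    set (N.-tuple (measurableTypeR R)) -> \bar R :=
  match N with
  | 0 => fun A => \d_ ([tuple] : 0.-tuple (measurableTypeR R)) A
  | N'.+1 => fun A =>
      (@lebesgue_measure R \x @lebesgue_tuple R N')%E
        [set p : measurableTypeR R * N'.-tuple (measurableTypeR R) |
          A (cons_tuple p.1 p.2)]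
  end.

Definition lebesgue_rV (R : realType) (N : nat) (A : set 'rV[R]_N) : \bar R :=
  lebesgue_tuple [set t | A (\row_i tnth t i)].

Section Geometry.
Variables (R : realType) (F : scalars R).

(* Column vectors form a right vector space over F; the right linear
   combinations of the columns of [b] are the products [b *m x]. *)

Definition realify (p q : nat) (A : 'M[F]_(p, q)) : 'rV[R]_(p * q * rdim F) :=
  mxvec (\matrix_(i < p * q) coord (mxvec A 0 i)).

Definition inner (n : nat) (v w : 'cV[F]_n) : R :=
  re (\sum_i cj (v i 0) * w i 0).

Definition adjoint (p q : nat) (A : 'M[F]_(p, q)) : 'M[F]_(q, p) :=
  (map_mx (@cj R F) A)^T.

(* O(n), U(n), Sp(n) *)
Definition isometry_group (n : nat) : set 'M[F]_n :=
  [set u | adjoint u *m u = 1%:M /\ u *m adjoint u = 1%:M].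

Definition lebesgueF (m : nat) (A : set 'cV[F]_m) : \bar R :=
  lebesgue_rV (@realify m 1 @` A).

Definition convex_body (n : nat) (K : set 'cV[F]_n) :=
  [/\ K !=set0, compact (@realify n 1 @` K)
    & convex_set (@realify n 1 @` K)].

Definition has_interior (n : nat) (K : set 'cV[F]_n) :=
  interior (@realify n 1 @` K) !=set0.

Definition is_basis (n m : nat) (b : 'M[F]_(n, m)) (E : set 'cV[F]_n) :=
  (forall x : 'cV[F]_m, b *m x = 0 -> x = 0)
  /\ E = range (fun x : 'cV[F]_m => b *m x).

(* The bound m <= n only serves to make the type inhabited. *)
Record Gr (n m : nat) (mn : (m <= n)%N) := MkGr {
  space :> set 'cV[F]_n;
  spaceP : exists b : 'M[F]_(n, m), is_basis b space }.

Section Grassmannian.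
Variables (n m : nat) (mn : (m <= n)%N).

Lemma is_basis_pid : exists b : 'M[F]_(n, m),
  is_basis b (range (fun x : 'cV[F]_m => (pid_mx m : 'M[F]_(n, m)) *m x)).
Proof.
exists (pid_mx m); split=> // x /(congr1 (mulmx (pid_mx m : 'M[F]_(m, n)))).
by rewrite mulmx0 mulmxA mul_pid_mx minnn (minn_idPr mn) pid_mx_1 mul1mx.
Qed.

HB.instance Definition _ := gen_eqMixin (Gr mn).
HB.instance Definition _ := gen_choiceMixin (Gr mn).
HB.instance Definition _ := isPointed.Build (Gr mn) (MkGr mn is_basis_pid).

(* The quotient topology for the map sending a basis to its span. *)
Definition Gr_open : set (set (Gr mn)) :=
  [set U | open (@realify n m @`
     [set b : 'M[F]_(n, m) | exists2 E : Gr mn, U E & is_basis b E])].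

Definition borelGr := g_sigma_algebraType Gr_open.

(* Invariant under E |-> uE for u in O(n), U(n), Sp(n), which among the
   probability measures characterizes the Haar measure. *)
Definition is_Haar (mu : probability borelGr R) :=
  forall (u : 'M[F]_n) (S : set borelGr), isometry_group u -> measurable S ->
    mu [set E : borelGr | exists2 E' : borelGr, S E' &
          space E = [set u *m x | x in space E']] = mu S.

Definition oproj (E : set 'cV[F]_n) (x : 'cV[F]_n) : 'cV[F]_n :=
  xget 0 [set y | E y /\ forall e, E e -> inner e (x - y) = 0].

(* If the columns of b form an orthonormal F-basis of E, then x |-> b *m x is a
   linear isometry from F^m onto E; the choice of b is immaterial. *)
Definition volume (E : Gr mn) (A : set 'cV[F]_n) : \bar R :=
  let b : 'M[F]_(n, m) := xget 0 [set b : 'M[F]_(n, m) |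
    adjoint b *m b = 1%:M /\ space E = range (fun x : 'cV[F]_m => b *m x)] in
  lebesgueF [set x : 'cV[F]_m | A (b *m x)].

Definition Phi (mu : probability borelGr R) (K : set 'cV[F]_n) : \bar R :=
  (\int[mu]_E ((fine (volume E (oproj (space E) @` K))) ^- n)%:E)%E.

Definition Phi_tilde (mu : probability borelGr R) (K : set 'cV[F]_n) :
    \bar R :=
  (\int[mu]_E ((fine (volume E (K `&` space E))) ^+ n)%:E)%E.

End Grassmannian.
End Geometry.

(* Main.v *)
Require Import Defs.
From HB Require Import structures.
From mathcomp Require Import all_boot all_order all_algebra.
From mathcomp Require Import complex.
From mathcomp Require Import all_classical all_reals all_analysis.
From mathcomp Require Import measurable_realfun.
From mathcomp Require Import ring lra.

(** Write F for the scalars. The modulus |r| of a square matrix r is the absolute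
    value of the real determinant of x |-> r x ([cmod]). For an n x m matrix X with
    independent columns, a frame, let vol(X) be the factor by which x |-> X x expands
    volumes, so that vol(X)^2 = |X^* X|. If the columns of f are an orthonormal basis
    of E, then J_h(E) = vol(h f) is the factor by which h : E -> hE expands volumes.

    The elements of SL(n, F) have modulus 1 ([SL_cmod]). Row additions have modulus 1
    and preserve the determinant, and they reduce a matrix to a diagonal one with
    entries 1, ..., 1, a. For real and complex scalars a is the determinant; for
    quaternions it is a product of commutators, which has norm 1.

    The main point is a change of variables on the Grassmannian: if h has modulus 1
    and psi >= 0, then

      int psi(hE) J_h(E)^-n dE = int psi(E) dE    ([haar_density], [haar_density_all]).

    Granting it, both invariances are computations in one subspace. The section of hK
    with hE is the image under h of the section of K with E, so its volume is
    J_h(E) times that of the latter ([volume_section]); with h = g the powers of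
    J_h(E) cancel. The map P_E g is the composition of the projection to g^* E and of
    the adjoint of g^* : E -> g^* E, so that |P_E gK| = J_h(E) |P_(hE) K| with h = g^*
    ([volume_projection]), and this time the powers of J_h(E) match.

    To prove the change of variables, the invariant measure dE is identified with the
    law of the span of a random frame X in the unit ball ([haar_law]). This law is
    invariant, and invariant probability measures coincide ([haar_unique]): averaging
    an invariant measure over a random isometry, obtained by orthonormalizing the
    columns of a random matrix, does not change it, while the result of the average
    does not depend on the initial measure.

    In terms of frames, the change of variables says that the integral of
    psi(span X) phi(hX) with respect to vol(X)^-n dX does not depend on h, where phi(Y)
    is vol(Y)^n on the unit ball and 0 outside ([frame_avg_indep]). The measure
    vol(X)^-n dX is invariant under GL_m. Along the frames X r of one subspace, the
    integral of phi(hX r) over r in GL_m depends neither on X nor on h, since GL_m is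
    unimodular and all frames are of the form u Y r with a fixed Y and an isometry u.

    The analytic tool behind all of this is the linear change of variables for the
    Lebesgue measure on tuples ([lebesgue_tuple_mxact]), which is reduced to the
    one-dimensional case by the same row reduction as above. *)

Set Implicit Arguments.
Unset Strict Implicit.
Unset Printing Implicit Defensive.

Import Order.TTheory GRing.Theory Num.Theory.
Import numFieldNormedType.Exports.
Import Defs.
Local Open Scope classical_set_scope.
Local Open Scope ring_scope.

(** * Row reduction over a division ring *)
Section RowReduction.
Variables (k : unitRingType) (n : nat).
Hypothesis divring : forall x : k, x != 0 -> x \is a GRing.unit.
Implicit Types (g : 'M[k]_n.+1) (i j : 'I_n.+1) (a : k).

Definition row_add i j a g : 'M[k]_n.+1 :=
  \matrix_(r, c) (if r == i then g i c + a * g j c else g r c).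

Definition last_diag a : 'M[k]_n.+1 :=
  \matrix_(r, c) (if r == c then if r == ord_max then a else 1 else 0).

Definition mx_inj p q (A : 'M[k]_(p, q)) :=
  forall x : 'cV[k]_q, A *m x = 0 -> x = 0.

Lemma row_addK i j a g : i != j -> row_add i j (- a) (row_add i j a g) = g.
Proof.
move=> ij; apply/matrixP => r c; rewrite !mxE eqxx [j == i]eq_sym (negPf ij).
by case: eqP => [->|]//; rewrite mulNr addrK.
Qed.

Lemma row_addE i j a g : row_add i j a g = row_add i j a 1%:M *m g.
Proof.
apply/matrixP => r c; rewrite !mxE; case: (r =P i) => [->|ri].
  under eq_bigr do rewrite !mxE eqxx mulrDl.
  rewrite big_split /= (bigD1 i)//= big1; last first.
    by move=> l li; rewrite eq_sym (negPf li) mul0r.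
  rewrite (bigD1 j)//= big1; last first.
    by move=> l li; rewrite eq_sym (negPf li) mulr0 mul0r.
  by rewrite !eqxx !addr0 mul1r mulr1.
rewrite (bigD1 r)//= big1 ?addr0; last first.
  by move=> l li; rewrite !mxE (introF eqP ri) eq_sym (negPf li) mul0r.
by rewrite !mxE (introF eqP ri) eqxx mul1r.
Qed.

Lemma row_add_inj i j a g : i != j -> mx_inj g -> mx_inj (row_add i j a g).
Proof.
move=> ij gi x; rewrite row_addE -mulmxA.
move=> /(congr1 (mulmx (row_add i j (- a) 1%:M))).
by rewrite mulmx0 !mulmxA -row_addE row_addK// mul1mx => /gi.
Qed.

Definition reduced p g := forall (r c : 'I_n.+1), (c < p)%N -> g r c = (r == c)%:R.

(** Otherwise column p would be a combination of the columns before it, and v would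
    be the corresponding vector in the kernel. *)
Lemma reduced_pivot g (p : 'I_n.+1) : mx_inj g -> reduced p g ->
  exists2 r : 'I_n.+1, (p <= r)%N & g r p != 0.
Proof.
move=> gi gp; apply/exists_inP; apply: contraT; rewrite negb_exists_in.
move=> /forall_inP g0.
pose v : 'cV[k]_n.+1 :=
  \col_i if i == p then 1 else if (i < p)%N then - g i p else 0.
have : v p 0 = 0.
  rewrite (gi v) ?mxE//; apply/matrixP => r z; rewrite !mxE.
  rewrite (bigD1 p)//= !mxE eqxx mulr1.
  have [rp|pr] := ltnP r p; last first.
    have /eqP -> := negbNE (g0 _ pr); rewrite add0r big1// => i ip.
    rewrite !mxE (negPf ip); case: ifP => [ltip|]; last by rewrite mulr0.
    by rewrite gp// -val_eqE gtn_eqF ?mul0r//= (leq_trans ltip pr).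
  have rNp : r != p by rewrite -val_eqE ltn_eqF.
  rewrite (bigD1 r)//= !mxE rp (negPf rNp) (gp r r)// eqxx mul1r big1 ?addr0 ?subrr//.
  move=> i /andP[ip ir]; rewrite !mxE (negPf ip).
  case: ifP => [ltip|]; last by rewrite mulr0.
  by rewrite gp// eq_sym (negPf ir) mul0r.
by rewrite mxE eqxx => /eqP; rewrite oner_eq0.
Qed.

Variable P : 'M[k]_n.+1 -> Prop.
Hypothesis P_row_add : forall g i j a, i != j -> P g -> P (row_add i j a g).

Lemma row_add_back g i j a : i != j -> P (row_add i j a g) -> P g.
Proof. by move=> ij /(P_row_add (- a) ij); rewrite row_addK. Qed.

Lemma clear_column (p : 'I_n.+1) g :
  mx_inj g -> reduced p g -> g p p != 0 ->
  (forall g', mx_inj g' -> reduced p g' -> g' p p = g p p ->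
     (forall r, r != p -> g' r p = 0) -> P g') -> P g.
Proof.
move=> gi gp gpp H.
(* s lists rows that contain the entries of column p still to be cleared. *)
suff: forall (s : seq 'I_n.+1) g', mx_inj g' -> reduced p g' -> g' p p = g p p ->
    (forall r, r \notin s -> r != p -> g' r p = 0) -> P g'.
  by move=> /(_ (enum 'I_n.+1) g); apply=> // r; rewrite mem_enum.
elim=> [|r0 s IH] g' g'i g'p g'pp g'0; first by apply: H => // r; exact: g'0.
have [r0p|r0p] := eqVneq r0 p.
  apply: IH => // r rs rp; apply: g'0 => //.
  by rewrite inE negb_or rs r0p rp.
apply: (@row_add_back _ r0 p (- (g' r0 p / g p p)) r0p); apply: IH.
- exact: row_add_inj.
- move=> r c cp; rewrite mxE; case: eqP => [->|_]; last exact: g'p.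
  by rewrite (g'p r0 c)// (g'p p c)// [p == c]eq_sym -[c == p]val_eqE ltn_eqF// mulr0 addr0.
- by rewrite !mxE eq_sym (negPf r0p).
- move=> r rs rp; rewrite mxE; case: eqP => [_|/eqP r0r]; last first.
    by apply: g'0 => //; rewrite inE negb_or r0r.
  by rewrite g'pp mulNr divrK ?divring// subrr.
Qed.

(** Gaussian elimination without row exchanges or row scalings: every pivot
    but the last one can be made equal to 1 by adding to its row a multiple of
    a lower row, so that all the noncommutativity ends up in a single entry. *)
Lemma gauss_ind : (forall a, a != 0 -> P (last_diag a)) ->
  forall g, mx_inj g -> P g.
Proof.
move=> Pdiag.
suff: forall d p, (p + d)%N = n -> forall g, mx_inj g -> reduced p g -> P g.
  by move=> /(_ n 0%N erefl) H g gi; apply: H.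
elim=> [|d IH] p pd g gi gp.
  have pE : p = (ord_max : 'I_n.+1) :> nat by rewrite -pd addn0.
  rewrite pE in gp.
  have gmm : g ord_max ord_max != 0.
    have [r rm] := reduced_pivot gi gp.
    suff -> : r = ord_max by [].
    by apply/val_inj/eqP; rewrite eqn_leq rm -ltnS ltn_ord.
  apply: (clear_column gi gp gmm) => g' g'i g'p g'mm g'0.
  suff -> : g' = last_diag (g ord_max ord_max) by exact: Pdiag.
  apply/matrixP => r c; rewrite mxE; have [->|cm] := eqVneq c ord_max.
    by case: eqP => [->|/eqP rm]//; rewrite g'0.
  rewrite g'p; last by rewrite ltn_neqAle -ltnS ltn_ord andbT.
  by case: eqP => [->|]//; rewrite (negPf cm).
have pn : (p < n.+1)%N by rewrite ltnS -pd leq_addr.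
have p1n : (p.+1 < n.+1)%N by rewrite ltnS -pd addnS ltnS leq_addr.
pose p0 := Ordinal pn; pose p1 := Ordinal p1n.
have gp0 : reduced p0 g by [].
have key : forall g, mx_inj g -> reduced p0 g -> g p0 p0 = 1 -> P g.
  move=> f fi fp fpp.
  apply: (clear_column fi fp); rewrite ?fpp ?oner_eq0// => g' g'i g'p g'1 g'0.
  apply: (IH p.+1) => //; first by rewrite -pd addnS.
  move=> r c; rewrite ltnS leq_eqVlt => /orP[/eqP cp|]; last exact: g'p.
  have -> : c = p0 by exact: val_inj.
  by case: eqP => [->|/eqP rp]//; rewrite g'0.
(* A nonzero entry below the pivot allows the pivot to be turned into 1. *)
have low : forall g (r : 'I_n.+1), mx_inj g -> reduced p0 g -> (p0 < r)%N ->
    g r p0 != 0 -> P g.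
  move=> f r fi fp pr fr0.
  have p0r : p0 != r by rewrite -val_eqE ltn_eqF.
  apply: (@row_add_back _ p0 r ((1 - f p0 p0) / f r p0) p0r); apply: key.
  - exact: row_add_inj.
  - move=> r' c cp; rewrite mxE; case: eqP => [->|_]; last exact: fp.
    rewrite (fp p0 c)// (fp r c)// [r == c]eq_sym -[c == r]val_eqE.
    by rewrite (ltn_eqF (ltn_trans (cp : (c < p0)%N) pr)) mulr0 addr0.
  - by rewrite mxE eqxx divrK ?divring// addrC subrK.
have [r pr gr0] := reduced_pivot gi gp0.
have [p0r|rp0] := ltnP p0 r; first exact: (low g r).
have rE : r = p0 by apply/val_inj/eqP; rewrite eqn_leq pr rp0.
rewrite {r pr rp0}rE in gr0.
(* If the pivot may be the only nonzero entry, its row is added to the next one. *)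
have [g10|g10] := eqVneq (g p1 p0) 0; last by apply: (low g p1) => //=.
have p10 : p1 != p0 by rewrite -val_eqE gtn_eqF /=.
apply: (@row_add_back _ p1 p0 1 p10); apply: (low _ p1) => //.
- exact: row_add_inj.
- move=> r c cp; rewrite mxE; case: eqP => [->|_]; last exact: gp.
  rewrite (gp p1 c)// (gp p0 c)// mul1r [p0 == c]eq_sym -[c == p0]val_eqE ltn_eqF//.
  by rewrite addr0.
- by rewrite mxE eqxx g10 add0r mul1r.
Qed.

End RowReduction.

Lemma mx_inj_invertible (k : unitRingType) n (g : 'M[k]_n) :
  (forall x : k, x != 0 -> x \is a GRing.unit) -> mx_inj g ->
  exists h, h *m g = 1%:M /\ g *m h = 1%:M.
Proof.
case: n g => [|n] g divring; first by exists 1%:M; split; apply/matrixP => -[].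
move: g; apply: gauss_ind => //.
  move=> g i j a ij [h [hg gh]].
  exists (h *m row_add i j (- a) 1%:M); rewrite -mulmxA -row_addE row_addK//.
  split => //; rewrite [row_add i j a g]row_addE -mulmxA (mulmxA g) gh mul1mx -row_addE.
  by rewrite -{1}[a]opprK row_addK.
move=> a a0; exists (last_diag n a^-1).
have H (b c : k) : b * c = 1 -> last_diag n b *m last_diag n c = 1%:M.
  move=> bc; apply/matrixP => r s; rewrite !mxE (bigD1 r)//= big1 ?addr0.
    rewrite !mxE eqxx; have [->|rs] := eqVneq r s; last by rewrite mulr0.
    by case: eqP; rewrite ?mul1r.
  by move=> i ir; rewrite !mxE eq_sym (negPf ir) mul0r.
by split; apply: H; rewrite (mulVr, mulrV) ?divring.
Qed.

Lemma det_row_add (k : comUnitRingType) n i j a (g : 'M[k]_n.+1) : i != j ->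
  \det (row_add i j a g) = \det g.
Proof.
move=> ij; pose g' := \matrix_(r, c) (if r == i then g j c else g r c).
rewrite (determinant_multilinear (i0 := i) (b := 1) (c := a) (B := g) (C := g')).
- rewrite (determinant_alternate (A := g') ij) ?mulr0 ?addr0 ?mul1r// => c.
  by rewrite !mxE eqxx eq_sym (negPf ij).
- by apply/rowP => c; rewrite !mxE eqxx mul1r.
- by apply/matrixP => r c; rewrite !mxE eq_sym (negPf (neq_lift _ _)).
- by apply/matrixP => r c; rewrite !mxE eq_sym (negPf (neq_lift _ _)).
Qed.

Lemma det_last_diag (k : comUnitRingType) n (a : k) : \det (last_diag n a) = a.
Proof.
rewrite (_ : last_diag n a = diag_mx (\row_i if i == ord_max then a else 1)).
  rewrite det_diag (bigD1 ord_max)//= mxE eqxx big1 ?mulr1// => i im.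
  by rewrite mxE (negPf im).
by apply/matrixP => r c; rewrite !mxE; have [->|rc] := eqVneq r c; rewrite ?mulr1n ?mulr0n.
Qed.

Lemma last_diag1 (k : unitRingType) p : last_diag p (1 : k) = 1%:M.
Proof. by apply/matrixP => i j; rewrite !mxE if_same; case: (i == j). Qed.

(** * Lebesgue measure on tuples *)
Lemma measurable_preimage d1 d2 (T1 : measurableType d1) (T2 : measurableType d2)
    (f : T1 -> T2) (A : set T2) :
  measurable_fun setT f -> measurable A -> measurable (f @^-1` A).
Proof. by move=> mf mA; rewrite -[X in measurable X]setTI; exact: mf. Qed.

Lemma integral_image d1 d2 (T1 : measurableType d1) (T2 : measurableType d2)
    (R : realType) (m1 : {measure set T1 -> \bar R})
    (m2 : {measure set T2 -> \bar R}) (phi : T1 -> T2) (c : R) :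
  measurable_fun setT phi -> 0 <= c ->
  (forall A, measurable A -> m1 (phi @^-1` A) = (c%:E * m2 A)%E) ->
  forall f : T2 -> \bar R, measurable_fun [set: T2] f -> (forall x, 0 <= f x)%E ->
  (\int[m1]_x f (phi x) = c%:E * \int[m2]_x f x)%E.
Proof.
move=> mphi c0 H f mf f0.
transitivity (\int[pushforward m1 phi]_y f y)%E.
  by rewrite ge0_integral_pushforward.
transitivity (\int[mscale (NngNum c0) m2]_y f y)%E.
  by apply: eq_measure_integral => A mA _; exact: H.
by rewrite ge0_integral_mscale.
Qed.

Lemma tonelli d1 d2 (T1 : measurableType d1) (T2 : measurableType d2)
    (R : realType) (m1 : {sigma_finite_measure set T1 -> \bar R})
    (m2 : {sigma_finite_measure set T2 -> \bar R}) (f : T1 -> T2 -> \bar R) :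
  measurable_fun [set: T1 * T2] (fun p => f p.1 p.2) ->
  (forall x y, 0 <= f x y)%E ->
  (\int[m1]_x \int[m2]_y f x y = \int[m2]_y \int[m1]_x f x y)%E.
Proof.
move=> mf f0.
by apply: (@fubini_tonelli _ _ _ _ _ _ _ (fun p => f p.1 p.2)) => // p; exact: f0.
Qed.

Section LebesgueTuple.
Variable R : realType.
Local Notation RT := (measurableTypeR R).
Local Notation T := (fun N => N.-tuple RT).
Implicit Types N : nat.

Definition consp N (p : RT * N.-tuple RT) : N.+1.-tuple RT := cons_tuple p.1 p.2.

Lemma measurable_consp N : measurable_fun setT (@consp N).
Proof. exact: measurable_cons. Qed.

Section NextMeasure.
Variables (N : nat) (m : {sigma_finite_measure set (N.-tuple RT) -> \bar R}).

Definition next_measure (A : set (N.+1.-tuple RT)) : \bar R :=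
  (lebesgue_measure \x m)%E (@consp N @^-1` A).

Let next0 : next_measure set0 = 0%E.
Proof. by rewrite /next_measure preimage_set0 measure0. Qed.

Let next_ge0 A : (0 <= next_measure A)%E.
Proof. by apply: integral_ge0 => x _; exact: measure_ge0. Qed.

Let next_additive : semi_sigma_additive next_measure.
Proof.
move=> F mF tF mUF; rewrite /next_measure preimage_bigcup.
apply: measure_semi_sigma_additive.
- by move=> n; apply: measurable_preimage => //; exact: measurable_consp.
- apply/trivIsetP => /= i j _ _ ij; rewrite -preimage_setI.
  by move/trivIsetP : tF => /(_ _ _ _ _ ij) ->//; rewrite preimage_set0.
- rewrite -preimage_bigcup; apply: measurable_preimage => //.
  exact: measurable_consp.
Qed.

HB.instance Definition _ := isMeasure.Build _ _ _ next_measure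
  next0 next_ge0 next_additive.

Definition unconsp (t : N.+1.-tuple RT) : RT * N.-tuple RT :=
  (thead t, [tuple of behead t]).

Lemma measurable_unconsp : measurable_fun setT unconsp.
Proof.
apply: measurable_fun_pair; last exact: measurable_behead.
exact: (measurable_tnth ord0).
Qed.

Lemma unconspK : cancel (@consp N) unconsp.
Proof.
by move=> [x t]; rewrite /unconsp /consp theadE; congr pair; exact/val_inj.
Qed.

Let next_sigma_finite : sigma_finite setT next_measure.
Proof.
have /sigma_finiteP[F [FT ndF Foo]] := sigma_finiteT (@lebesgue_measure R).
have /sigma_finiteP[G [GT ndG Goo]] := sigma_finiteT m.
exists (fun i => unconsp @^-1` (F i `*` G i)).
  rewrite -preimage_bigcup -[LHS](preimage_setT unconsp); congr (_ @^-1` _).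
  apply/seteqP; split=> // -[x y] _.
  have [i _ Fx] : (\bigcup_i F i) x by rewrite -FT.
  have [j _ Gy] : (\bigcup_i G i) y by rewrite -GT.
  exists (maxn i j) => //; split.
    by move: x Fx; exact/subsetPset/ndF/leq_maxl.
  by move: y Gy; exact/subsetPset/ndG/leq_maxr.
move=> i; have [mF Fi] := Foo i; have [mG Gi] := Goo i; split.
  apply: measurable_preimage; first exact: measurable_unconsp.
  exact: measurableX.
rewrite /next_measure -comp_preimage (_ : _ \o _ = id); last first.
  by apply/funext => p; exact: unconspK.
by rewrite product_measure1E// lte_mul_pinfty// ge0_fin_numE.
Qed.

HB.instance Definition _ := Measure_isSigmaFinite.Build _ _ _ next_measure
  next_sigma_finite.

End NextMeasure.

(** The recursive definition forms product measures out of plain set functions. To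
    see that they are measures, each step is matched with [next_measure]. *)
Lemma lebesgue_tuple_sigma_finite N :
  exists m : {sigma_finite_measure set (N.-tuple RT) -> \bar R},
    @lebesgue_tuple R N = m :> (set _ -> \bar R).
Proof.
elim: N => [|N [m mE]]; first by exists (\d_([tuple] : 0.-tuple RT)).
by exists (next_measure m); rewrite /= mE.
Qed.

Section LebesgueTupleMeasure.
Variable N : nat.

Let lt0 : @lebesgue_tuple R N set0 = 0%E.
Proof. by have [m ->] := lebesgue_tuple_sigma_finite N; rewrite measure0. Qed.

Let lt_ge0 A : (0 <= @lebesgue_tuple R N A)%E.
Proof. by have [m ->] := lebesgue_tuple_sigma_finite N. Qed.

Let lt_additive : semi_sigma_additive (@lebesgue_tuple R N).
Proof.
have [m ->] := lebesgue_tuple_sigma_finite N.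
exact: measure_semi_sigma_additive.
Qed.

HB.instance Definition _ := isMeasure.Build _ _ _ (@lebesgue_tuple R N)
  lt0 lt_ge0 lt_additive.

Let lt_sigma_finite : sigma_finite setT (@lebesgue_tuple R N).
Proof. by have [m ->] := lebesgue_tuple_sigma_finite N; exact: sigma_finiteT. Qed.

HB.instance Definition _ := Measure_isSigmaFinite.Build _ _ _
  (@lebesgue_tuple R N) lt_sigma_finite.

End LebesgueTupleMeasure.

Local Notation lam N := (@lebesgue_tuple R N).

Lemma integral_consp N (f : N.+1.-tuple RT -> \bar R) :
  measurable_fun setT f -> (forall t, 0 <= f t)%E ->
  (\int[lam N.+1]_t f t =
   \int[lebesgue_measure]_x \int[lam N]_t f (consp (x, t)))%E.
Proof.
move=> mf f0.
have mfc : measurable_fun setT (f \o @consp N).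
  by apply: measurableT_comp => //; exact: measurable_consp.
rewrite -(fubini_tonelli1 (f \o @consp N) mfc)//; last by move=> p; exact: f0.
rewrite (@integral_image _ _ _ _ _ _ (lam N.+1) (@consp N) 1) ?mul1e//.
- exact: measurable_consp.
- by move=> A mA; rewrite mul1e.
Qed.

Definition insert_at N (i : 'I_N.+1) (x : RT) (t : N.-tuple RT) :
    N.+1.-tuple RT :=
  [tuple if unlift i j is Some l then tnth t l else x | j < N.+1].

Lemma measurable_insert_at N (i : 'I_N.+1) :
  measurable_fun setT (fun p : RT * N.-tuple RT => insert_at i p.1 p.2).
Proof.
apply/measurable_fun_tnthP => j.
have [l ->|->] := unliftP i j.
  rewrite (_ : _ \o _ = (fun t => tnth t l) \o snd).
    by apply: measurableT_comp => //; exact: measurable_tnth.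
  by apply/funext => p /=; rewrite tnth_mktuple liftK.
rewrite (_ : _ \o _ = fst)//.
by apply/funext => p /=; rewrite tnth_mktuple unlift_none.
Qed.

Lemma insert_at0 N (x : RT) (t : N.-tuple RT) : insert_at ord0 x t = consp (x, t).
Proof.
apply: eq_from_tnth => j; rewrite tnth_mktuple.
by case: unliftP => [l ->|->]; rewrite ?tnthS ?tnth0.
Qed.

Lemma insert_atS N (i : 'I_N.+1) (x y : RT) (t : N.-tuple RT) :
  insert_at (lift ord0 i) x (consp (y, t)) = consp (y, insert_at i x t).
Proof.
apply: eq_from_tnth => j; rewrite tnth_mktuple.
have [j' ->|->] := unliftP ord0 j; last first.
  rewrite tnth0; case: unliftP => [l lE|/(congr1 val)//].
  suff -> : l = ord0 by rewrite tnth0.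
  by apply/val_inj; move/(congr1 val): lE; case: l => -[|l] //= _; rewrite /bump addnS.
rewrite [RHS]tnthS tnth_mktuple.
have [l ->|->] := unliftP i j'; last by rewrite !unlift_none.
have -> : lift ord0 (lift i l) = lift (lift ord0 i) (lift ord0 l).
  by apply/val_inj; rewrite /= /bump !leq0n !add1n ltnS addnS.
by rewrite !liftK tnthS.
Qed.

(** Lebesgue measure on tuples is defined by singling out the first coordinate; a
    shear modifies some other coordinate, over which one has to integrate first. *)
Lemma integral_insert_at N (i : 'I_N.+1) (f : N.+1.-tuple RT -> \bar R) :
  measurable_fun setT f -> (forall t, 0 <= f t)%E ->
  (\int[lam N.+1]_t f t =
   \int[lam N]_t \int[lebesgue_measure]_x f (insert_at i x t))%E.
Proof.
elim: N i f => [|N IH] i f mf f0.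
  rewrite integral_consp// tonelli//; last first.
    exact: (measurableT_comp mf (@measurable_consp 0)).
  apply: eq_integral => t _; apply: eq_integral => x _ /=.
  by rewrite (ord1 i) insert_at0.
have [i' ->|->] := unliftP ord0 i; last first.
  rewrite integral_consp// tonelli//; last first.
    exact: (measurableT_comp mf (@measurable_consp N.+1)).
  by apply: eq_integral => t _; apply: eq_integral => x _; rewrite insert_at0.
rewrite integral_consp// [RHS]integral_consp; first last.
- by move=> t; exact: integral_ge0.
- apply: (measurable_fun_fubini_tonelli_F
    (fun p : N.+1.-tuple RT * RT => f (insert_at (lift ord0 i') p.2 p.1))) => //.
  have mi := measurable_insert_at (lift ord0 i').
  apply: (measurableT_comp mf).
  exact: (measurableT_comp mi (measurable_fun_pair measurable_snd measurable_fst)).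
apply: eq_integral => y _; rewrite (IH i')//; last first.
  apply: (measurableT_comp mf (g := fun t => consp (y, t))).
  apply: (measurableT_comp (@measurable_consp N.+1) (g := pair y)).
  exact: pair1_measurable.
apply: eq_integral => t _; apply: eq_integral => x _.
by rewrite insert_atS.
Qed.

End LebesgueTuple.

(** * Linear changes of variables *)
Section LinearChange.
Variable R : realType.
Local Notation RT := (measurableTypeR R).
Local Notation lam N := (@lebesgue_tuple R N).
Implicit Types N : nat.

Definition affine (c s : R) (x : RT) : RT := c * x + s.

Lemma measurable_affine c s : measurable_fun setT (affine c s).
Proof.
by apply: measurable_funD => //; apply: measurable_funM.
Qed.

Lemma lebesgue_affine (c s : R) (A : set RT) : c != 0 -> measurable A ->
  (lebesgue_measure (affine c s @^-1` A) = `|c|^-1%:E * lebesgue_measure A)%E.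
Proof.
move=> c0 mA; have cn0 : 0 <= `|c| by [].
pose nu := mscale (NngNum cn0) (pushforward (@lebesgue_measure R) (affine c s)).
pose nu' := nu (measurable_affine c s).
suff -> : lebesgue_measure A = nu' A.
  by rewrite /nu' /nu /mscale /= muleA -EFinM mulVf ?normr_eq0// mul1e.
apply: (@lebesgue_measure_unique R nu') => // _ [[a b] ab <-].
rewrite [RHS](_ : _ = (`|c|%:E * lebesgue_measure
  (affine c s @^-1` `]a, b]%classic))%E); last by [].
have [c_lt0|c_gt0|/eqP] := ltgtP c 0; last by rewrite (negPf c0).
- rewrite (_ : _ @^-1` _ = `[(b - s) / c, (a - s) / c[%classic); last first.
    apply/seteqP; split => x; rewrite /= /affine !in_itv/= => /andP[].
      rewrite ler_ndivrMr// ltr_ndivlMr//; lra.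
    rewrite ler_ndivrMr// ltr_ndivlMr//; lra.
  rewrite !lebesgue_measure_itv/= !lte_fin ltr_nM2r ?invr_lt0// ltrD2r.
  case: ifP => _; last by rewrite mule0.
  by rewrite -!EFinB -EFinM ltr0_norm//; congr EFin; field.
- rewrite (_ : _ @^-1` _ = `](a - s) / c, (b - s) / c]%classic); last first.
    apply/seteqP; split => x; rewrite /= /affine !in_itv/= => /andP[].
      rewrite ler_pdivlMr// ltr_pdivrMr//; lra.
    rewrite ler_pdivlMr// ltr_pdivrMr//; lra.
  rewrite !lebesgue_measure_itv/= !lte_fin ltr_pM2r ?invr_gt0// ltrD2r.
  case: ifP => _; last by rewrite mule0.
  by rewrite -!EFinB -EFinM gtr0_norm//; congr EFin; field.
Qed.

Lemma measurable_insert_slice N (i : 'I_N.+1) t :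
  measurable_fun [set: RT] (fun x : RT => insert_at i x t).
Proof. exact: (measurableT_comp (measurable_insert_at i) (pair2_measurable t)). Qed.

Lemma lebesgue_tuple_slice N (i : 'I_N.+1) (B : set (N.+1.-tuple RT)) :
  measurable B ->
  (lam N.+1 B = \int[lam N]_t
    lebesgue_measure ((fun x : RT => insert_at i x t) @^-1` B))%E.
Proof.
move=> mB; rewrite -[in LHS](setIT B) -integral_indic//.
rewrite (integral_insert_at i); last 2 first.
- by apply/measurable_EFinP; exact: measurable_indic.
- by move=> t; rewrite lee_fin.
apply: eq_integral => t _; rewrite -[in RHS](setIT (_ @^-1` _)) -integral_indic//.
apply: measurable_preimage => //; exact: measurable_insert_slice.
Qed.

(** On each line parallel to the i-th axis phi is an affine map of slope c, so that
    the one-dimensional formula can be integrated over these lines. *)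
Lemma lebesgue_tuple_shear N (i : 'I_N.+1) (c : R) (s : N.-tuple RT -> R)
    (phi : N.+1.-tuple RT -> N.+1.-tuple RT) (A : set (N.+1.-tuple RT)) :
  c != 0 -> measurable_fun setT phi ->
  (forall x t, phi (insert_at i x t) = insert_at i (affine c (s t) x) t) ->
  measurable A ->
  (lam N.+1 (phi @^-1` A) = `|c|^-1%:E * lam N.+1 A)%E.
Proof.
move=> c0 mphi phiE mA.
have mA' : measurable (phi @^-1` A) by exact: measurable_preimage.
rewrite !(lebesgue_tuple_slice i)//.
have ms t : measurable ((fun x : RT => insert_at i x t) @^-1` A).
  by apply: measurable_preimage => //; exact: measurable_insert_slice.
under eq_integral => t _.
  rewrite (_ : _ @^-1` _ = affine c (s t) @^-1`
    ((fun x : RT => insert_at i x t) @^-1` A)); last first.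
    by apply/seteqP; split => x /=; rewrite phiE.
  rewrite lebesgue_affine//; over.
rewrite ge0_integralZl//; last first.
  have m1 := measurable_preimage (measurable_insert_at i) mA.
  rewrite (_ : (fun _ => _) = lebesgue_measure \o ysection
    ((fun p : RT * N.-tuple RT => insert_at i p.1 p.2) @^-1` A)).
    exact: measurable_fun_ysection.
  by apply/funext => t /=; congr lebesgue_measure; apply/seteqP; split => x;
    rewrite /ysection /= inE.
Qed.

Definition rV_of_tuple N (t : N.-tuple RT) : 'rV[R]_N := \row_i tnth t i.
Definition tuple_of_rV N (v : 'rV[R]_N) : N.-tuple RT := [tuple v 0 i | i < N].

Lemma tuple_of_rVK N : cancel (@tuple_of_rV N) (@rV_of_tuple N).
Proof. by move=> v; apply/rowP => i; rewrite mxE tnth_mktuple. Qed.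

Definition mxact N (L : 'M[R]_N) (t : N.-tuple RT) : N.-tuple RT :=
  tuple_of_rV (rV_of_tuple t *m L).

Lemma tnth_mxact N (L : 'M[R]_N) t i :
  tnth (mxact L t) i = \sum_j tnth t j * L j i.
Proof. by rewrite tnth_mktuple mxE; apply: eq_bigr => j _; rewrite mxE. Qed.

Lemma mxactM N (L M : 'M[R]_N) t : mxact (L *m M) t = mxact M (mxact L t).
Proof. by rewrite /mxact tuple_of_rVK mulmxA. Qed.

Lemma measurable_mxact N (L : 'M[R]_N) : measurable_fun setT (mxact L).
Proof.
apply/measurable_fun_tnthP => i.
rewrite (_ : _ \o _ = (fun t => \sum_j (tnth t j : R) * L j i)); last first.
  by apply/funext => t /=; rewrite tnth_mxact.
apply: measurable_sum => j; apply: measurable_funM => //.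
exact: measurable_tnth.
Qed.

Lemma det_neq0_inj n (g : 'M[R]_n) : \det g != 0 -> mx_inj g.
Proof.
move=> g0 x gx; have gu : g \in unitmx by rewrite unitmxE unitfE.
by rewrite -[x](mulKmx gu) gx mulmx0.
Qed.

(** Both sides are multiplicative in L, and row reduction writes L as a product of
    shears and of a rescaling of the last coordinate. It is applied to the
    transpose of L because tuples are acted upon from the right. *)
Lemma lebesgue_tuple_mxact N (L : 'M[R]_N) A : \det L != 0 -> measurable A ->
  (lam N (mxact L @^-1` A) = `|\det L|^-1%:E * lam N A)%E.
Proof.
case: N L A => [|N] L A.
  rewrite det_mx00 normr1 invr1 mul1e => _ _; congr (lebesgue_tuple _).
  apply/seteqP; split => t /=; suff -> : mxact L t = t by [];
    by apply: eq_from_tnth => -[].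
rewrite -[L]trmxK; move: L^T A => {L} L A; rewrite det_tr => L0 mA.
move: (L) (det_neq0_inj L0) (L0) A mA; apply: gauss_ind => {L L0}.
- by move=> x; rewrite unitfE.
- move=> L i j a ij IH; rewrite det_row_add// row_addE trmx_mul => L0 A mA.
  rewrite (_ : _ @^-1` _ =
    mxact L^T @^-1` (mxact (row_add i j a 1%:M)^T @^-1` A)); last first.
    by apply/seteqP; split => t; rewrite /= mxactM.
  rewrite IH//; last by apply: measurable_preimage => //; exact: measurable_mxact.
  congr (_ * _)%E.
  pose s (t : N.-tuple RT) : R := a * tnth (insert_at i 0 t) j.
  rewrite (@lebesgue_tuple_shear _ i 1 s)// ?normr1 ?invr1 ?mul1e//.
    exact: measurable_mxact.
  move=> x t; apply: eq_from_tnth => l; rewrite tnth_mxact.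
  under eq_bigr do rewrite !mxE mulrC.
  have [->|li] := eqVneq l i.
    under eq_bigr do rewrite mulrDl.
    rewrite big_split/= (bigD1 i)//= big1 => [|r ri]; last first.
      by rewrite eq_sym (negPf ri) mul0r.
    rewrite (bigD1 j)//= big1 => [|r ri]; last first.
      by rewrite eq_sym (negPf ri) mulr0 mul0r.
    rewrite !eqxx !addr0 mul1r mulr1 !tnth_mktuple unlift_none /affine mul1r.
    rewrite /s tnth_mktuple; case: unliftP => [r _|/eqP]//.
    by rewrite eq_sym (negPf ij).
  rewrite (bigD1 l)//= big1 => [|r ri]; last by rewrite eq_sym (negPf ri) mul0r.
  rewrite eqxx mul1r addr0 !tnth_mktuple; case: unliftP => [r _|/eqP]//.
  by rewrite (negPf li).
- move=> a a0 _ A mA; rewrite det_last_diag.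
  rewrite (@lebesgue_tuple_shear _ ord_max a (fun=> 0))//.
    exact: measurable_mxact.
  move=> x t; apply: eq_from_tnth => l; rewrite tnth_mxact.
  rewrite (bigD1 l)//= big1 => [|r ri]; last first.
    by rewrite !mxE eq_sym (negPf ri) mulr0.
  rewrite !mxE eqxx addr0 !tnth_mktuple; have [->|lm] := eqVneq l ord_max.
    by rewrite unlift_none /affine addr0 mulrC.
  by rewrite mulr1; case: unliftP => [r _|/eqP]//; rewrite (negPf lm).
Qed.

Lemma integral_mxact N (L : 'M[R]_N) (f : N.-tuple RT -> \bar R) :
  \det L != 0 -> measurable_fun setT f -> (forall t, 0 <= f t)%E ->
  (\int[lam N]_t f (mxact L t) = `|\det L|^-1%:E * \int[lam N]_t f t)%E.
Proof.
move=> L0 mf f0; apply: (integral_image (measurable_mxact L)) => //.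
by move=> A mA; exact: lebesgue_tuple_mxact.
Qed.

End LinearChange.

(** * Scalars and real coordinates of matrices *)
Definition cdot (R : realType) d (v w : 'rV[R]_d) : R := \sum_l v 0 l * w 0 l.

(** All that is used of the real numbers, the complex numbers and the quaternions:
    they are division algebras whose centre contains the reals, with a conjugation
    for which [coord] is an isometry onto Euclidean space. *)
Record scalars_theory (R : realType) (F : scalars R) := ScalarsTheory {
  ofR : R -> F;
  uncoord : 'rV[R]_(rdim F) -> F;
  scal_unit : forall x : F, x != 0 -> x \is a GRing.unit;
  coordK : cancel (@coord R F) uncoord;
  uncoordK : cancel uncoord (@coord R F);
  coordD : forall x y : F, coord (x + y) = coord x + coord y;
  coord_ofR : forall t (x : F), coord (ofR t * x) = t *: coord x;
  ofR_comm : forall t (x : F), ofR t * x = x * ofR t;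
  cjD : forall x y : F, cj (x + y) = cj x + cj y;
  cjM : forall x y : F, cj (x * y) = cj y * cj x;
  cjK : forall x : F, cj (cj x) = x;
  cj_ofR : forall t, cj (ofR t) = ofR t :> F;
  re_cjM : forall x y : F, re (cj x * y) = cdot (coord x) (coord y);
  cj_mul : forall x : F, cj x * x = ofR (cdot (coord x) (coord x)) }.

Section Theory.
Variables (R : realType) (F : scalars R) (T : scalars_theory F).
Local Notation ofR := (ofR T).

Lemma coord_inj : injective (@coord R F).
Proof. exact: can_inj (coordK T). Qed.

Lemma coord0 : coord (0 : F) = 0.
Proof. by apply: (addrI (coord 0)); rewrite -(coordD T) !addr0. Qed.

Lemma coord_sum I (r : seq I) (P : pred I) (G : I -> F) :
  coord (\sum_(i <- r | P i) G i) = \sum_(i <- r | P i) coord (G i).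
Proof. exact: (big_morph (@coord R F) (coordD T) coord0). Qed.

Lemma ofR1 : ofR 1 = 1.
Proof.
by rewrite -[LHS]mulr1; apply: coord_inj; rewrite coord_ofR scale1r.
Qed.

Lemma ofRM s t : ofR (s * t) = ofR s * ofR t.
Proof.
rewrite -[LHS]mulr1 -[ofR t]mulr1; apply: coord_inj.
by rewrite !coord_ofR scalerA.
Qed.

Lemma ofRD s t : ofR (s + t) = ofR s + ofR t.
Proof.
rewrite -[LHS]mulr1 -[ofR t]mulr1 -[ofR s]mulr1; apply: coord_inj.
by rewrite coordD// !coord_ofR scalerDl.
Qed.

Lemma ofR0 : ofR 0 = 0.
Proof. by apply: (addrI (ofR 0)); rewrite -ofRD !addr0. Qed.

Lemma cj1 : cj (1 : F) = 1.
Proof.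
by rewrite -[LHS](mulr1) -{2}(cjK T 1) -(cjM T) mulr1 cjK.
Qed.

Lemma cj0 : cj (0 : F) = 0.
Proof. by apply: (addrI (cj 0)); rewrite -(cjD T) !addr0. Qed.

Lemma cj_sum I (r : seq I) (P : pred I) (G : I -> F) :
  cj (\sum_(i <- r | P i) G i) = \sum_(i <- r | P i) cj (G i).
Proof. exact: (big_morph (@cj R F) (cjD T) cj0). Qed.

Lemma reE (x : F) : re x = cdot (coord 1) (coord x).
Proof. by rewrite -(re_cjM T) cj1 mul1r. Qed.

Lemma re_sum I (r : seq I) (P : pred I) (G : I -> F) :
  re (\sum_(i <- r | P i) G i) = \sum_(i <- r | P i) re (G i).
Proof.
rewrite reE coord_sum /cdot.
under eq_bigr do rewrite summxE mulr_sumr.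
by rewrite exchange_big; apply: eq_bigr => i _; rewrite reE.
Qed.

Definition sqn (x : F) : R := cdot (coord x) (coord x).

Lemma sqn_ge0 x : 0 <= sqn x.
Proof. by apply: sumr_ge0 => i _; rewrite -expr2 sqr_ge0. Qed.

Lemma sqn_eq0 x : (sqn x == 0) = (x == 0).
Proof.
apply/eqP/eqP => [|->]; last by rewrite /sqn coord0 /cdot big1// => i _; rewrite mxE mul0r.
move=> /eqP; rewrite psumr_eq0; last by move=> i _; rewrite -expr2 sqr_ge0.
move=> /allP h; apply: coord_inj; rewrite coord0; apply/rowP => i.
have := h i; rewrite mem_index_enum => /(_ isT).
by rewrite -expr2 sqrf_eq0 => /eqP ->; rewrite mxE.
Qed.

Lemma mul_cj (x : F) : x * cj x = ofR (sqn x).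
Proof.
have [->|x0] := eqVneq x 0.
  have -> : sqn 0 = 0 by apply/eqP; rewrite sqn_eq0.
  by rewrite mul0r ofR0.
have := cj_mul T x; rewrite -/(sqn x) => h.
have xu := scal_unit T x0.
by apply: (mulIr xu); rewrite -mulrA h ofR_comm.
Qed.

(** ** Realification of matrices *)

Lemma adjointM p q r (A : 'M[F]_(p, q)) (B : 'M[F]_(q, r)) :
  adjoint (A *m B) = adjoint B *m adjoint A.
Proof.
apply/matrixP => i j; rewrite !mxE cj_sum; apply: eq_bigr => l _.
by rewrite !mxE (cjM T).
Qed.

Lemma adjointK p q (A : 'M[F]_(p, q)) : adjoint (adjoint A) = A.
Proof. by apply/matrixP => i j; rewrite !mxE (cjK T). Qed.

Lemma adjointD p q (A B : 'M[F]_(p, q)) : adjoint (A + B) = adjoint A + adjoint B.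
Proof. by apply/matrixP => i j; rewrite !mxE (cjD T). Qed.

Lemma adjointZ p q t (A : 'M[F]_(p, q)) : adjoint (ofR t *: A) = ofR t *: adjoint A.
Proof. by apply/matrixP => i j; rewrite !mxE (cjM T) cj_ofR ofR_comm. Qed.

(** The position of the l-th real coordinate of the entry (i, j). *)
Definition rindex p q (i : 'I_p) (j : 'I_q) (l : 'I_(rdim F)) :
  'I_(p * q * rdim F) := mxvec_index (mxvec_index i j) l.

Lemma realifyE p q (A : 'M[F]_(p, q)) i j l :
  realify A 0 (rindex i j l) = coord (A i j) 0 l.
Proof. by rewrite mxvecE mxE mxvecE. Qed.

Definition unrealify p q (v : 'rV[R]_(p * q * rdim F)) : 'M[F]_(p, q) :=
  \matrix_(i, j) uncoord T (\row_l v 0 (rindex i j l)).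

Lemma realifyK p q : cancel (@realify R F p q) (@unrealify p q).
Proof.
move=> A; apply/matrixP => i j; rewrite mxE -[RHS](coordK T); congr uncoord.
by apply/rowP => l; rewrite mxE realifyE.
Qed.

Lemma unrealifyK p q : cancel (@unrealify p q) (@realify R F p q).
Proof.
move=> v; apply/rowP => k; case/mxvec_indexP: k => ij l.
case/mxvec_indexP: ij => i j.
by rewrite realifyE mxE (uncoordK T) mxE.
Qed.

Lemma realify_inj p q : injective (@realify R F p q).
Proof. exact: can_inj (@realifyK p q). Qed.

Lemma realifyD p q (A B : 'M[F]_(p, q)) : realify (A + B) = realify A + realify B.
Proof.
apply/rowP => k; case/mxvec_indexP: k => ij l; case/mxvec_indexP: ij => i j.
by rewrite [RHS]mxE !realifyE mxE (coordD T) mxE.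
Qed.

Lemma realifyZ p q t (A : 'M[F]_(p, q)) : realify (ofR t *: A) = t *: realify A.
Proof.
apply/rowP => k; case/mxvec_indexP: k => ij l; case/mxvec_indexP: ij => i j.
by rewrite [RHS]mxE !realifyE mxE coord_ofR mxE.
Qed.

Lemma unrealifyD p q (v w : 'rV[R]_(p * q * rdim F)) :
  unrealify (v + w) = unrealify v + unrealify w :> 'M[F]_(p, q).
Proof. by apply: realify_inj; rewrite realifyD !unrealifyK. Qed.

Lemma unrealifyZ p q t (v : 'rV[R]_(p * q * rdim F)) :
  unrealify (t *: v) = ofR t *: unrealify v :> 'M[F]_(p, q).
Proof. by apply: realify_inj; rewrite realifyZ !unrealifyK. Qed.

Lemma realify0 p q : realify (0 : 'M[F]_(p, q)) = 0.
Proof. by apply: (addrI (realify 0)); rewrite -realifyD !addr0. Qed.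

(** ** Real-linear maps and their matrices *)

Section RealLinear.
Variables p q p' q' : nat.

Definition rlinear (f : 'M[F]_(p, q) -> 'M[F]_(p', q')) :=
  (forall A B, f (A + B) = f A + f B) /\
  (forall t A, f (ofR t *: A) = ofR t *: f A).

Definition rmat (f : 'M[F]_(p, q) -> 'M[F]_(p', q')) :
    'M[R]_(p * q * rdim F, p' * q' * rdim F) :=
  \matrix_(i, j) realify (f (unrealify (delta_mx 0 i))) 0 j.

Lemma rmatE f : rlinear f -> forall A, realify (f A) = realify A *m rmat f.
Proof.
move=> [fD fZ] A; pose h v := realify (f (unrealify v)).
have h0 : h 0 = 0.
  apply: (addrI (h 0)); rewrite addr0 /h -realifyD -fD -unrealifyD.
  by rewrite addr0.
have hD v w : h (v + w) = h v + h w by rewrite /h unrealifyD fD realifyD.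
rewrite -[LHS]/(realify (f A)) -{1}(realifyK A) -/(h _).
rewrite {1}[realify A]row_sum_delta (big_morph h hD h0).
apply/rowP => j; rewrite summxE mxE; apply: eq_bigr => i _.
by rewrite /h unrealifyZ fZ realifyZ !mxE.
Qed.

End RealLinear.

Lemma rmat_comp p q p' q' p'' q'' (f : 'M[F]_(p, q) -> 'M[F]_(p', q'))
    (h : 'M[F]_(p', q') -> 'M[F]_(p'', q'')) :
  rlinear h -> rmat (h \o f) = rmat f *m rmat h.
Proof.
move=> hl; apply/matrixP => i j; rewrite [LHS]mxE /= (rmatE hl) !mxE.
by apply: eq_bigr => l _; rewrite [in RHS]mxE.
Qed.

End Theory.

(** * Moduli of square matrices *)
Lemma prod_mxvec (R : comNzRingType) p q (A : 'M[R]_(p, q)) :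
  \prod_k mxvec A 0 k = \prod_i \prod_j A i j.
Proof.
rewrite pair_bigA /= (reindex _ (curry_mxvec_bij p q)) /=.
by apply: eq_bigr => -[i j] _; rewrite mxvecE.
Qed.

Lemma sum_mxvec (V : nmodType) p q (g : 'I_(p * q) -> V) :
  \sum_k g k = \sum_i \sum_j g (mxvec_index i j).
Proof.
rewrite pair_bigA /= (reindex _ (curry_mxvec_bij p q)) /=.
by apply: eq_bigr => -[i j].
Qed.

(** A change of basis between two index sets of the same size, where N and N' may
    be different expressions. *)
Lemma det_conj (R : comNzRingType) N N' (A : 'M[R]_(N, N')) (B : 'M[R]_(N', N))
    (M : 'M[R]_N') :
  N = N' -> A *m B = 1%:M -> \det (A *m M *m B) = \det M.
Proof.
move=> NN'; case: N' / NN' in A B M *; move=> AB.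
by rewrite !det_mulmx mulrAC -det_mulmx AB det1 mul1r.
Qed.

Section Moduli.
Variables (R : realType) (F : scalars R) (T : scalars_theory F).
Local Notation ofR := (ofR T).
Local Notation rmat := (rmat T).
Local Notation d := (rdim F).

(** ** The real inner product *)

Definition dot p q (A B : 'M[F]_(p, q)) : R := cdot (realify A) (realify B).

Lemma sum_realify p q (g : 'I_(p * q * d) -> R) :
  \sum_k g k = \sum_i \sum_j \sum_l g (rindex (F := F) i j l).
Proof.
by rewrite !sum_mxvec.
Qed.

Lemma dotE p q (A B : 'M[F]_(p, q)) : dot A B = re (\tr (adjoint A *m B)).
Proof.
rewrite /dot /cdot sum_realify exchange_big /= (re_sum T).
apply: eq_bigr => j _; rewrite !mxE (re_sum T); apply: eq_bigr => i _.
by rewrite !mxE (re_cjM T); apply: eq_bigr => l _; rewrite !realifyE.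
Qed.

Lemma dotC p q (A B : 'M[F]_(p, q)) : dot A B = dot B A.
Proof. by apply: eq_bigr => i _; rewrite mulrC. Qed.

Lemma dot_adjoint p q r (a : 'M[F]_(p, q)) (A : 'M[F]_(q, r)) B :
  dot (a *m A) B = dot A (adjoint a *m B).
Proof. by rewrite !dotE (adjointM T) mulmxA. Qed.

Lemma dot_eq0 p q (A : 'M[F]_(p, q)) : (dot A A == 0) = (A == 0).
Proof.
apply/eqP/eqP => [|->]; last first.
  by rewrite /dot (realify0 T) /cdot big1// => i _; rewrite mxE mul0r.
move=> /eqP; rewrite psumr_eq0; last by move=> i _; rewrite -expr2 sqr_ge0.
move=> /allP h; apply: (realify_inj T); rewrite (realify0 T).
apply/rowP => i; have := h i; rewrite mem_index_enum => /(_ isT).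
by rewrite -expr2 sqrf_eq0 => /eqP ->; rewrite mxE.
Qed.

(** If X^* X y = 0, then |X y|^2 = <X^* X y, y> = 0. *)
Lemma gram_inj p q (X : 'M[F]_(p, q)) :
  mx_inj X -> mx_inj (adjoint X *m X).
Proof.
move=> Xi x gx; apply: Xi; apply/eqP; rewrite -dot_eq0 dot_adjoint mulmxA gx.
by apply/eqP/big1 => i _; rewrite (realify0 T) mxE mulr0.
Qed.

(** ** The modulus of multiplications *)

Lemma rlinear_mull p q r (a : 'M[F]_(p, q)) :
  rlinear T (mulmx a : 'M[F]_(q, r) -> _).
Proof.
split=> [A B|t A]; first by rewrite mulmxDr.
apply/matrixP => i j; rewrite !mxE mulr_sumr; apply: eq_bigr => l _.
by rewrite mxE !mulrA ofR_comm.
Qed.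

Lemma rlinear_mulr p q r (b : 'M[F]_(q, r)) :
  rlinear T (fun A : 'M[F]_(p, q) => A *m b).
Proof.
split=> [A B|t A]; first by rewrite mulmxDl.
apply/matrixP => i j; rewrite !mxE mulr_sumr; apply: eq_bigr => l _.
by rewrite mxE !mulrA.
Qed.

Lemma rlinear_adjoint p q : rlinear T (@adjoint R F p q).
Proof.
by split=> [A B|t A]; [exact: (adjointD T)|exact: (adjointZ T)].
Qed.

Lemma rmat_id p q : rmat (@id 'M[F]_(p, q)) = 1%:M.
Proof.
by apply/matrixP => i j; rewrite mxE (unrealifyK T) !mxE eqxx eq_sym.
Qed.

(** The factor by which multiplication by a expands Lebesgue measure on p x q
    matrices: a common substitute, for all three kinds of scalars, for the absolute
    value of a determinant. *)
Definition lmod p (q : nat) (a : 'M[F]_p) : R :=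
  `|\det (rmat (mulmx a : 'M[F]_(p, q) -> _))|.

Definition rmod (p : nat) q (b : 'M[F]_q) : R :=
  `|\det (rmat (fun A : 'M[F]_(p, q) => A *m b))|.

Lemma lmodM p q (a b : 'M[F]_p) : lmod q (a *m b) = lmod q a * lmod q b.
Proof.
rewrite /lmod (_ : mulmx (a *m b) = mulmx a \o mulmx b :> ('M[F]_(p, q) -> _)).
  rewrite rmat_comp; last exact: rlinear_mull.
  by rewrite det_mulmx normrM mulrC.
by apply/funext => A /=; rewrite mulmxA.
Qed.

Lemma lmod1 p q : lmod q (1%:M : 'M[F]_p) = 1.
Proof.
rewrite /lmod (_ : mulmx _ = id) ?rmat_id ?det1 ?normr1//.
by apply/funext => A; rewrite mul1mx.
Qed.

Lemma lmod_ge0 p q (a : 'M[F]_p) : 0 <= lmod q a.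
Proof. exact: normr_ge0. Qed.

(** The coordinates being orthonormal, a and its adjoint are adjoint to each other
    for the standard inner product of the coordinate vectors. *)
Lemma rmat_adjoint p q (a : 'M[F]_p) :
  rmat (mulmx (adjoint a) : 'M[F]_(p, q) -> _) =
  (rmat (mulmx a : 'M[F]_(p, q) -> _))^T.
Proof.
have dotdelta (A : 'M[F]_(p, q)) k :
    realify A 0 k = dot A (unrealify T (delta_mx 0 k)).
  rewrite /dot (unrealifyK T) /cdot (bigD1 k)//= big1 ?addr0.
    by rewrite mxE !eqxx mulr1.
  by move=> l lk; rewrite mxE (negPf lk) andbF mulr0.
apply/matrixP => i j; rewrite !mxE !dotdelta dot_adjoint (adjointK T).
by rewrite dotC.
Qed.

Lemma lmod_adjoint p q (a : 'M[F]_p) : lmod q (adjoint a) = lmod q a.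
Proof. by rewrite /lmod rmat_adjoint det_tr. Qed.

Lemma lmod_unitary p q (u : 'M[F]_p) : adjoint u *m u = 1%:M -> lmod q u = 1.
Proof.
move=> uu; apply/eqP; rewrite -(@eqrXn2 _ 2%N)// ?lmod_ge0//.
by rewrite expr2 -{1}lmod_adjoint -lmodM uu lmod1 expr1n.
Qed.

(** Right multiplication by b is conjugate, under the adjoint, to left
    multiplication by the adjoint of b. *)
Lemma rmod_lmod p q (b : 'M[F]_q) : rmod p b = lmod p b.
Proof.
rewrite -(lmod_adjoint p b) /rmod /lmod.
rewrite (_ : (fun A => _) = @adjoint R F q p \o
    (mulmx (adjoint b) \o @adjoint R F p q)); last first.
  by apply/funext => A /=; rewrite (adjointM T) !(adjointK T).
rewrite rmat_comp; last exact: rlinear_adjoint.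
rewrite rmat_comp; last exact: rlinear_mull.
rewrite det_conj//; first by rewrite (mulnC p).
rewrite -rmat_comp; last exact: rlinear_adjoint.
rewrite (_ : _ \o _ = id) ?rmat_id//.
by apply/funext => A /=; rewrite (adjointK T).
Qed.

(** An elementary matrix E satisfies E S E = S for the reflection S in one
    coordinate, so that the square of its modulus is 1. *)
Lemma lmod_row_add p q (i j : 'I_p.+1) (x : F) : i != j ->
  lmod q (row_add i j x 1%:M) = 1.
Proof.
move=> ij; set E := row_add i j x 1%:M.
pose S : 'M[F]_p.+1 := \matrix_(r, c) ((r == c)%:R * (-1) ^+ (r == i)).
have SE (A : 'M[F]_p.+1) : S *m A = \matrix_(r, c) ((-1) ^+ (r == i) * A r c).
  apply/matrixP => r c; rewrite !mxE (bigD1 r)//= big1 ?addr0.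
    by rewrite mxE eqxx mul1r.
  by move=> l lr; rewrite mxE eq_sym (negPf lr) !mul0r.
have SS : S *m S = 1%:M.
  rewrite SE; apply/matrixP => r c; rewrite !mxE.
  have [->|_] := eqVneq r c; last by rewrite mul0r mulr0.
  by case: (c == i); rewrite ?expr1 ?expr0 ?mulr1// mul1r mulrNN mulr1.
have ESE : E *m (S *m E) = S.
  rewrite SE -row_addE; apply/matrixP => r c; rewrite !mxE.
  rewrite !eqxx [j == i]eq_sym (negPf ij) expr1 expr0 !mul1r.
  have [->|ri] := eqVneq r i; last by rewrite expr0 mulr1 mul1r.
  by rewrite mulN1r expr1 mulrN1 opprD addrNK.
have := congr1 (lmod q) ESE; rewrite !lmodM.
have S1 : lmod q S = 1.
  apply/eqP; rewrite -(@eqrXn2 _ 2%N)// ?lmod_ge0//.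
  by rewrite expr2 -lmodM SS lmod1 expr1n.
rewrite S1 mul1r -expr2 => E1; apply/eqP.
by rewrite -(@eqrXn2 _ 2%N)// ?lmod_ge0// E1 expr1n.
Qed.

Lemma lmod_last_diag_ofR p q t :
  lmod q (last_diag p (ofR t)) = `|t| ^+ (q * d).
Proof.
rewrite /lmod.
pose W : 'M[R]_(p.+1, q) := \matrix_(i, j) if i == ord_max then t else 1.
pose V : 'M[R]_(p.+1 * q, d) := \matrix_(k, l) mxvec W 0 k.
rewrite (_ : rmat _ = diag_mx (mxvec V)); last first.
  apply/matrixP => a b; rewrite mxE.
  case/mxvec_indexP: b => ij l; case/mxvec_indexP: ij => i j.
  rewrite -/(rindex _ _ _) realifyE mxE (bigD1 i)//= big1 => [|r ri]; last first.
    by rewrite mxE eq_sym (negPf ri) mul0r.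
  rewrite addr0 [last_diag _ _ _ _]mxE eqxx.
  have -> : (if i == ord_max then ofR t else 1) = ofR (W i j).
    by rewrite mxE; case: ifP => // _; rewrite (ofR1 T).
  rewrite coord_ofR [LHS]mxE !mxE (uncoordK T) !mxE /=.
  rewrite [a == _]eq_sym; have [<-|_] := eqVneq (rindex i j l) a; last by rewrite mulr0 mulr0n.
  by rewrite mulr1 mulr1n mxvecE mxE mxvecE mxE.
rewrite det_diag prod_mxvec.
under eq_bigr do (under eq_bigr do rewrite mxE; rewrite prodr_const card_ord).
rewrite prodrXl prod_mxvec normrX exprM; congr (_ ^+ _).
rewrite (bigD1 ord_max)//= [X in _ * X]big1 ?mulr1.
  by under eq_bigr do rewrite mxE eqxx; rewrite prodr_const card_ord normrX.
by move=> i im; rewrite big1// => j _; rewrite mxE (negPf im).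
Qed.

Lemma adjoint_last_diag p x : adjoint (last_diag p x) = last_diag p (cj x : F).
Proof.
apply/matrixP => i j; rewrite !mxE [j == i]eq_sym; have [->|_] := eqVneq i j.
  by case: eqP; rewrite ?(cj1 T).
by rewrite (cj0 T).
Qed.

Lemma last_diagM p (x y : F) : last_diag p x *m last_diag p y = last_diag p (x * y).
Proof.
apply/matrixP => r s; rewrite !mxE (bigD1 r)//= big1 ?addr0.
  rewrite !mxE eqxx; case: (r == s); last by rewrite mulr0.
  by case: eqP; rewrite ?mulr1.
by move=> i ir; rewrite !mxE eq_sym (negPf ir) mul0r.
Qed.

(** The modulus of a scalar x is found from x x^* = |x|^2, which is a real number
    and acts diagonally on the real coordinates. *)
Lemma lmod_last_diag p q x : lmod q (last_diag p x) ^+ 2 = sqn x ^+ (q * d).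
Proof.
rewrite expr2 -{2}lmod_adjoint -lmodM adjoint_last_diag last_diagM.
by rewrite (mul_cj T) lmod_last_diag_ofR ger0_norm// sqn_ge0.
Qed.

(** One column is enough: see [lmod_cmod]. *)
Definition cmod p (a : 'M[F]_p) := lmod 1 a.

(** The q columns are acted upon independently. Both sides being multiplicative,
    it is enough to compare them after row reduction. *)
Lemma lmod_cmod p q (a : 'M[F]_p) : mx_inj a -> lmod q a = cmod a ^+ q.
Proof.
case: p a => [|p] a.
  by move=> _; rewrite (_ : a = 1%:M) ?/cmod ?lmod1 ?expr1n//; apply/matrixP => -[].
move: a; apply: gauss_ind; first exact: scal_unit.
- move=> g i j x ij IH.
  by rewrite row_addE /cmod !lmodM !lmod_row_add// !mul1r.
- move=> x x0; apply/eqP; rewrite -(@eqrXn2 _ 2%N)//; last 2 first.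
  + exact: lmod_ge0.
  + by rewrite exprn_ge0// lmod_ge0.
  by rewrite -exprM mulnC exprM !lmod_last_diag mul1n -exprM mulnC.
Qed.

Lemma cmod_gt0 p (a : 'M[F]_p) : mx_inj a -> 0 < cmod a.
Proof.
move=> /(mx_inj_invertible (scal_unit T))[b [ba _]].
rewrite lt0r lmod_ge0 andbT; apply/eqP => a0.
have := lmod1 p 1; rewrite -ba lmodM -/(cmod a) a0 mulr0 => /eqP.
by rewrite eq_sym oner_eq0.
Qed.

Lemma cmod_neq0_inj p (a : 'M[F]_p) : cmod a != 0 -> mx_inj a.
Proof.
rewrite normr_eq0 => D x ax; apply: (realify_inj T); rewrite (realify0 T).
have u : rmat (mulmx a : 'M[F]_(p, 1) -> _) \in unitmx by rewrite unitmxE unitfE.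
apply: (can_inj (mulmxK u)); rewrite mul0mx -(rmatE (rlinear_mull _ a)) ax.
exact: realify0.
Qed.

(** Row reduction changes neither the modulus nor any other function D of matrices
    that is invariant under row additions. For a determinant D, this relates D to
    the modulus through the one remaining entry a. *)
Lemma cmod_reduce p (g : 'M[F]_p.+1) : mx_inj g ->
  exists2 a, cmod g = cmod (last_diag p a) &
    forall (S : Type) (D : 'M[F]_p.+1 -> S),
      (forall g i j x, i != j -> D (row_add i j x g) = D g) ->
      D g = D (last_diag p a).
Proof.
move: g; apply: gauss_ind; first exact: scal_unit; last by move=> a a0; exists a.
move=> g i j x ij [a ga Dg]; exists a.
  by rewrite row_addE /cmod lmodM lmod_row_add// mul1r.
by move=> S D Dinv; rewrite Dinv// Dg.
Qed.

End Moduli.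

(** * The real, complex and quaternionic scalars *)
Section Instances.
Variable R : realType.

Lemma real_scalars_theory : scalars_theory (scalars_of R FR).
Proof.
apply: (@ScalarsTheory R (scalars_of R FR) id (fun v => v 0 0)) => //=.
- by move=> x; rewrite unitfE.
- by move=> x; rewrite mxE.
- by move=> v; apply/rowP => i; rewrite mxE (ord1 i).
- by move=> x y; apply/rowP => i; rewrite !mxE.
- by move=> t x; apply/rowP => i; rewrite !mxE.
- by move=> t x; rewrite mulrC.
- by move=> x y; rewrite mulrC.
- by move=> x y; rewrite /cdot big_ord1 !mxE.
- by move=> x; rewrite /cdot big_ord1 !mxE.
Qed.

Lemma complex_scalars_theory : scalars_theory (scalars_of R FC).
Proof.
apply: (@ScalarsTheory R (scalars_of R FC) (fun t => Complex t 0)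
  (fun v => Complex (v 0 0) (v 0 (lift ord0 ord0)))) => /=.
- by move=> x; rewrite unitfE.
- by move=> [a b]; rewrite !mxE.
- move=> v; apply/rowP => i; rewrite mxE.
  by case: (unliftP ord0 i) => [j|] ->//; rewrite (ord1 j).
- move=> [a b] [a' b']; apply/rowP => i; rewrite !mxE.
  by case: (unliftP ord0 i) => [j|] ->//; rewrite (ord1 j).
- move=> t [a b]; apply/rowP => i; rewrite !mxE.
  by case: (unliftP ord0 i) => [j|] ->; rewrite ?(ord1 j) /=; ring.
- by move=> t x; rewrite mulrC.
- move=> [a b] [a' b']; apply/eqP; rewrite eq_complex /=.
  by apply/andP; split; apply/eqP; ring.
- move=> [a b] [a' b']; apply/eqP; rewrite eq_complex /=.
  by apply/andP; split; apply/eqP; ring.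
- by move=> [a b]; rewrite /= opprK.
- by move=> t; rewrite /= oppr0.
- by move=> [a b] [a' b']; rewrite /cdot !big_ord_recl big_ord0 !mxE /=; ring.
- move=> [a b]; rewrite /cdot !big_ord_recl big_ord0 !mxE /=.
  by apply/eqP; rewrite eq_complex /=; apply/andP; split; apply/eqP; ring.
Qed.

Lemma quat_scalars_theory : scalars_theory (scalars_of R FH).
Proof.
apply: (@ScalarsTheory R (scalars_of R FH) (fun t => Quat t 0 0 0)
  (fun v => Quat (v 0 (inord 0)) (v 0 (inord 1)) (v 0 (inord 2)) (v 0 (inord 3)))) => /=.
- by [].
- by move=> [a b c d]; rewrite !mxE !inordK.
- move=> v; apply/rowP => i; rewrite mxE.
  by case: i => -[|[|[|[|//]]]] ilt /=; congr (v 0 _); apply/val_inj; rewrite /= inordK.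
- move=> [a b c d] [a' b' c' d']; apply/rowP => i; rewrite !mxE.
  by case: i => -[|[|[|[|//]]]] ilt.
- move=> t [a b c d]; apply/rowP => i; rewrite !mxE.
  by case: i => -[|[|[|[|//]]]] ilt /=; ring.
- by move=> t [a b c d]; congr Quat => /=; ring.
- by move=> [a b c d] [a' b' c' d']; congr Quat => /=; ring.
- by move=> [a b c d] [a' b' c' d']; congr Quat => /=; ring.
- by move=> [a b c d]; rewrite /qconj /= !opprK.
- by move=> t; rewrite /qconj /= !oppr0.
- by move=> [a b c d] [a' b' c' d']; rewrite /cdot !big_ord_recl big_ord0 !mxE /=; ring.
- move=> [a b c d]; rewrite /cdot !big_ord_recl big_ord0 !mxE /=.
  by congr Quat => /=; ring.
Qed.

Definition scalars_ofP (k : field_kind) : scalars_theory (scalars_of R k) :=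
  match k with
  | FR => real_scalars_theory
  | FC => complex_scalars_theory
  | FH => quat_scalars_theory
  end.

Lemma invertible_inj (k : unitRingType) n (g : 'M[k]_n) : invertible g -> mx_inj g.
Proof. by move=> [h [_ hg]] x gx; rewrite -[x]mul1mx -hg -mulmxA gx mulmx0. Qed.

(** The norm of the quaternions is multiplicative with values in a commutative
    group. *)
Lemma commutator_unit (x : quat R) :
  commutator_subgroup x -> qnorm2 x = 1.
Proof.
have nM (y z : quat R) : qnorm2 (y * z) = qnorm2 y * qnorm2 z.
  by case: y z => a b c d [a' b' c' d']; rewrite /qnorm2 /=; ring.
have n1 : qnorm2 (1 : quat R) = 1.
  by rewrite /qnorm2 /= !expr0n /= expr1n !addr0.
have nV (y : quat R) : y \is a GRing.unit -> qnorm2 y * qnorm2 y^-1 = 1.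
  by move=> yu; rewrite -nM mulrV.
elim => {x} [//|x y xu yu|x y _ x1 _ y1|x _ x1].
- by rewrite !nM -[LHS]mulrA mulrACA !nV// mulr1.
- by rewrite nM x1 y1 mulr1.
- have xu : x \is a GRing.unit.
    apply: (scal_unit quat_scalars_theory); apply/eqP => x0; move: x1.
    by rewrite x0 /qnorm2 /= !expr0n /= !addr0 => /eqP; rewrite eq_sym oner_eq0.
  by have := nV _ xu; rewrite x1 mul1r.
Qed.

(** After row reduction the matrix is diagonal with entries 1, ..., 1, a, and has
    the same determinant as before. So a = 1 for real and complex scalars, and a is a
    product of commutators, hence of norm 1, for the quaternions. *)
Lemma SL_cmod k p (g : 'M[scalars_of R k]_p.+1) : SL g ->
  mx_inj g /\ cmod (scalars_ofP k) g = 1.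
Proof.
move=> [/invertible_inj gi g1]; split => //.
have [a -> Dg] := cmod_reduce (scalars_ofP k) gi.
suff det1 (K : comUnitRingType) (h : 'M[K]_p.+1) b :
    (forall (S : Type) (D : 'M[K]_p.+1 -> S),
      (forall g i j x, i != j -> D (row_add i j x g) = D g) ->
      D h = D (last_diag p b)) -> \det h = 1 -> last_diag p b = 1%:M.
  case: k g gi g1 a Dg => g gi g1 a Dg.
  - by rewrite (det1 R g a Dg g1) [LHS]lmod1.
  - by rewrite (det1 (complex R : comUnitRingType) g a Dg g1) [LHS]lmod1.
  - have [D [Dcl Dscale Dadd D1] Dg1] := g1.
    apply: lmod_unitary; rewrite (adjoint_last_diag (scalars_ofP FH)).
    rewrite (@last_diagM R (scalars_of R FH)) (cj_mul (scalars_ofP FH)).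
    suff /commutator_unit a1 : commutator_subgroup (a : quat R).
      rewrite -(last_diag1 _ p) -(ofR1 (scalars_ofP FH)); congr (last_diag p (ofR _ _)).
      by rewrite /cdot !big_ord_recl big_ord0 !mxE /= -a1 /qnorm2; ring.
    have DgE : D g = D (last_diag p a) by apply: Dg => *; exact: Dadd.
    have Da : D (last_diag p a) (a : quat R).
      have -> : last_diag p a = \matrix_(r, c)
          (if r == ord_max then a * (1%:M : 'M[quat R]_p.+1) r c else 1%:M r c).
        apply/matrixP => r c; rewrite !mxE.
        by case: (r == c); case: ifP => _ /=; rewrite ?mulr1 ?mulr0.
      rewrite Dscale D1; exists a.
        by exists 1; [exact: comm_one|rewrite mulr1].
      by exists 1; [exists 1; [exact: comm_one|rewrite mulr1]|rewrite mulr1].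
    move: Da; rewrite -DgE Dg1 => -[c cc].
    by rewrite mul1r => <-.
move=> Dh h1; suff -> : b = 1 by exact: last_diag1.
rewrite -(det_last_diag p b) -(Dh _ (@determinant _ _))// => *.
exact: det_row_add.
Qed.

End Instances.

(** * Continuity and measurability of matrix expressions *)

(** Matrix expressions are built from polynomials and a few continuous functions of
    one variable. One closure argument about such classes of functions serves both
    for continuity and for measurability. *)
Record function_class (R : realType) (X : Type) (C : (X -> R) -> Prop) : Prop :=
  FunctionClass {
    class_cst : forall a, C (fun=> a);
    classD : forall f g, C f -> C g -> C (fun x => f x + g x);
    classM : forall f g, C f -> C g -> C (fun x => f x * g x);
    class_comp : forall (g : R -> R) f, continuous g -> C f -> C (fun x => g (f x)) }.

Lemma continuous_class (R : realType) (X : topologicalType) :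
  @function_class R X (fun f => continuous f).
Proof.
split=> [a|f g cf cg|f g cf cg|g f cg cf] x.
- exact: cst_continuous.
- by apply: continuousD; [exact: cf|exact: cg].
- by apply: continuousM; [exact: cf|exact: cg].
- by apply: continuous_comp; [exact: cf|exact: cg].
Qed.

Lemma measurable_class (R : realType) d (X : measurableType d) :
  @function_class R X (fun f => measurable_fun setT f).
Proof.
split=> [a|f g|f g|g f cg mf].
- exact: measurable_cst.
- exact: measurable_funD.
- exact: measurable_funM.
- by apply: measurableT_comp => //; exact: continuous_measurable_fun.
Qed.

Section ClassClosure.
Variables (R : realType) (F : scalars R) (T : scalars_theory F).
Variables (X : Type) (C : (X -> R) -> Prop) (HC : function_class C).
Local Notation ofR := (ofR T).

Lemma class_sum (I : Type) (r : seq I) (P : pred I) (f : I -> X -> R) :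
  (forall i, C (f i)) -> C (fun x => \sum_(i <- r | P i) f i x).
Proof.
move=> Cf; elim: r => [|i r IH].
  rewrite (_ : (fun _ => _) = (fun=> 0)); first exact: class_cst.
  by apply/funext => x; rewrite big_nil.
case Pi : (P i); last first.
  by rewrite (_ : (fun _ => _) = (fun x => \sum_(i <- r | P i) f i x))//;
    apply/funext => x; rewrite big_cons Pi.
rewrite (_ : (fun _ => _) = (fun x => f i x + \sum_(i <- r | P i) f i x)).
  exact: classD.
by apply/funext => x; rewrite big_cons Pi.
Qed.

Lemma class_prod (I : Type) (r : seq I) (f : I -> X -> R) :
  (forall i, C (f i)) -> C (fun x => \prod_(i <- r) f i x).
Proof.
move=> Cf; elim: r => [|i r IH].
  rewrite (_ : (fun _ => _) = (fun=> 1)); first exact: class_cst.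
  by apply/funext => x; rewrite big_nil.
rewrite (_ : (fun _ => _) = (fun x => f i x * \prod_(i <- r) f i x)).
  exact: classM.
by apply/funext => x; rewrite big_cons.
Qed.

Lemma class_det N (f : X -> 'M[R]_N) :
  (forall i j, C (fun x => f x i j)) -> C (fun x => \det (f x)).
Proof.
move=> Cf; apply: class_sum => s; apply: classM => //; first exact: class_cst.
by apply: class_prod => i; exact: Cf.
Qed.

Definition mclass p q (f : X -> 'M[F]_(p, q)) :=
  forall k, C (fun x => realify (f x) 0 k).

Lemma mclass_cst p q (A : 'M[F]_(p, q)) : mclass (fun=> A).
Proof. by move=> k; exact: class_cst. Qed.

Lemma mclass_rlinear p q p' q' (h : 'M[F]_(p, q) -> 'M[F]_(p', q'))
    (f : X -> 'M[F]_(p, q)) : rlinear T h -> mclass f -> mclass (h \o f).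
Proof.
move=> hl Cf k /=.
under [fun _ => _]funext do rewrite (rmatE hl) mxE.
by apply: class_sum => l; apply: classM => //; exact: class_cst.
Qed.

Lemma mclassD p q (f g : X -> 'M[F]_(p, q)) :
  mclass f -> mclass g -> mclass (fun x => f x + g x).
Proof.
move=> Cf Cg k; under [fun _ => _]funext do rewrite (realifyD T) mxE.
exact: classD.
Qed.

Lemma mclassZ p q (c : X -> R) (f : X -> 'M[F]_(p, q)) :
  C c -> mclass f -> mclass (fun x => ofR (c x) *: f x).
Proof.
move=> Cc Cf k; under [fun _ => _]funext do rewrite realifyZ mxE.
exact: classM.
Qed.

Lemma mclass_sum p q (I : Type) (r : seq I) (f : I -> X -> 'M[F]_(p, q)) :
  (forall i, mclass (f i)) -> mclass (fun x => \sum_(i <- r) f i x).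
Proof.
move=> Cf; elim: r => [|i r IH].
  rewrite (_ : (fun _ => _) = (fun=> 0)); first exact: mclass_cst.
  by apply/funext => x; rewrite big_nil.
rewrite (_ : (fun _ => _) = (fun x => f i x + \sum_(i <- r) f i x)).
  exact: mclassD.
by apply/funext => x; rewrite big_cons.
Qed.

Lemma realify_sum_delta p q (A : 'M[F]_(p, q)) :
  A = \sum_k ofR (realify A 0 k) *: unrealify T (delta_mx 0 k).
Proof.
apply: (realify_inj T).
rewrite (big_morph _ (realifyD T (p := p) (q := q)) (realify0 T p q)).
rewrite [LHS]row_sum_delta; apply: eq_bigr => k _.
by rewrite realifyZ (unrealifyK T).
Qed.

Lemma mclassM p q r (f : X -> 'M[F]_(p, q)) (g : X -> 'M[F]_(q, r)) :
  mclass f -> mclass g -> mclass (fun x => f x *m g x).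
Proof.
move=> Cf Cg; rewrite (_ : (fun _ => _) = (fun x => \sum_k
    ofR (realify (f x) 0 k) *: (unrealify T (delta_mx 0 k) *m g x))); last first.
  apply/funext => x; rewrite {1}(realify_sum_delta (f x)) mulmx_suml.
  by apply: eq_bigr => k _; apply/matrixP => i j; rewrite !mxE mulr_sumr;
    apply: eq_bigr => l _; rewrite mxE mulrA.
apply: mclass_sum => k; apply: mclassZ; first exact: Cf.
exact: (mclass_rlinear (rlinear_mull T _ _) Cg).
Qed.

Lemma mclass_adjoint p q (f : X -> 'M[F]_(p, q)) :
  mclass f -> mclass (fun x => adjoint (f x)).
Proof. exact: (mclass_rlinear (rlinear_adjoint T p q)). Qed.

Lemma class_dot p q (f g : X -> 'M[F]_(p, q)) :
  mclass f -> mclass g -> C (fun x => dot (f x) (g x)).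
Proof. by move=> Cf Cg; apply: class_sum => k; exact: classM. Qed.

Lemma class_lmod p q (f : X -> 'M[F]_p) :
  mclass f -> C (fun x => lmod T q (f x)).
Proof.
move=> Cf; apply: (class_comp HC (g := Num.norm)); first exact: norm_continuous.
apply: class_det => i j; under [fun _ => _]funext do rewrite mxE.
by apply: mclassM => //; exact: mclass_cst.
Qed.

End ClassClosure.

(** * Borel sets of the space of real row vectors *)
Section RationalBalls.
Variable R : realType.
Local Notation RT := (measurableTypeR R).
Local Notation lam N := (@lebesgue_tuple R N).
Implicit Types N : nat.

Definition rball N (c : 'rV[rat]_N) (k : nat) : set 'rV[R]_N :=
  ball (\row_i (ratr (c 0 i) : R)) k.+1%:R^-1.

Lemma rV_ballP N (v w : 'rV[R]_N) (e : R) : 0 < e ->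
  ball v e w <-> forall i, `|v 0 i - w 0 i| < e.
Proof.
move=> e0; split=> [[_ vw] i|vw]; first exact: vw.
by split=> // i j; rewrite (ord1 i); exact: vw.
Qed.

Lemma rball_open N (c : 'rV[rat]_N) k : open (rball c k).
Proof. exact: ball_open. Qed.

Lemma rball_basis N (U : set 'rV[R]_N) v : open U -> U v ->
  exists p : 'rV[rat]_N * nat, rball p.1 p.2 v /\ rball p.1 p.2 `<=` U.
Proof.
move=> Uo Uv; have /nbhs_ballP[e /= e0 veU] : nbhs v U by exact: open_nbhs_nbhs.
have [k ke] : exists k, 0 + k.+1%:R^-1 < e / 2.
  by apply: ltr_add_invr; rewrite divr_gt0.
rewrite add0r in ke; have k0 : 0 < k.+1%:R^-1 :> R by rewrite invr_gt0.
have /choice[c cE] : forall i, exists q : rat, `|ratr q - v 0 i| < k.+1%:R^-1.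
  move=> i; have [|q] := @rat_in_itvoo R (v 0 i - k.+1%:R^-1) (v 0 i + k.+1%:R^-1).
    by rewrite ltrBlDr -addrA ltrDl addr_gt0.
  by rewrite in_itv/= => /andP[q1 q2]; exists q; rewrite ltr_norml ltrBlDl q2 andbT ltrBrDl.
exists (\row_i c i, k); split => /=.
  by apply/rV_ballP => // i; rewrite !mxE.
move=> w /rV_ballP cw; apply: veU; apply/rV_ballP => // i.
have := cw k0 i; have := cE i; rewrite !mxE => h1 h2.
have -> : v 0 i - w 0 i = (ratr (c i) - w 0 i) - (ratr (c i) - v 0 i) by ring.
rewrite (le_lt_trans (ler_normB _ _))// (lt_le_trans (ltrD h2 h1))//.
by rewrite [leRHS]splitr lerD// ltW.
Qed.

Lemma measurable_tuple_ball N (v : 'rV[R]_N) e :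
  measurable (@rV_of_tuple R N @^-1` ball v e).
Proof.
have [e0|e0] := leP e 0.
  rewrite (_ : _ @^-1` _ = set0); first exact: measurable0.
  by apply/seteqP; split => // t [] /=; rewrite ltNge e0.
rewrite (_ : _ @^-1` _ =
    \bigcap_(i in setT) ((fun t : N.-tuple RT => tnth t i) @^-1` ball (v 0 i) e)).
  apply: fin_bigcap_measurable => //.
  move=> i _; apply: measurable_preimage; first exact: measurable_tnth.
  exact: measurable_ball.
apply/seteqP; split => t /=.
  by move=> /(rV_ballP _ _ e0) h i _ /=; have := h i; rewrite mxE.
by move=> h; apply/(rV_ballP _ _ e0) => i; have := h i I; rewrite /= mxE.
Qed.

(** The product sigma-algebra of R^N contains the open sets, because R^N has a
    countable basis of boxes. *)
Lemma measurable_tuple_open N (U : set 'rV[R]_N) : open U ->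
  measurable (@rV_of_tuple R N @^-1` U).
Proof.
move=> Uo; rewrite (_ : U = \bigcup_(p : 'rV[rat]_N * nat)
    [set v | rball p.1 p.2 v /\ rball p.1 p.2 `<=` U]); last first.
  apply/seteqP; split => v; last by move=> [p _ [pv]]; exact.
  by move=> /(rball_basis Uo)[p pP]; exists p.
rewrite preimage_bigcup; apply: countable_bigcupT_measurable => [|p]; first exact: countableP.
have [pU|pU] := pselect (rball p.1 p.2 `<=` U).
  rewrite (_ : [set v | _] = rball p.1 p.2); first exact: measurable_tuple_ball.
  by apply/seteqP; split => v; [case|split].
rewrite (_ : [set v | _] = set0) ?preimage_set0//.
by apply/seteqP; split => // v [].
Qed.

Lemma measurable_tuple_closed N (U : set 'rV[R]_N) : closed U ->
  measurable (@rV_of_tuple R N @^-1` U).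
Proof.
move=> Uc; rewrite -[U]setCK preimage_setC; apply: measurableC.
exact: (@measurable_tuple_open N (~` U) (closed_openC Uc)).
Qed.

Lemma lebesgue_tuple_box N (c : 'rV[R]_N) (e : R) : 0 < e ->
  lam N (@rV_of_tuple R N @^-1` ball c e) = ((e *+ 2) ^+ N)%:E.
Proof.
move=> e0; elim: N c => [|N IH] c.
  rewrite expr0 /= diracE mem_set//=.
  by apply/rV_ballP => // -[].
pose c' : 'rV[R]_N := \row_i c 0 (lift ord0 i).
rewrite /= (_ : [set p | _] = ball (c 0 ord0) e `*` (@rV_of_tuple R N @^-1` ball c' e)).
  rewrite product_measure1E//; last 2 first.
  - exact: measurable_ball.
  - exact: measurable_tuple_ball.
  rewrite [X in (_ * X)%E]IH exprS EFinM; congr (_ * _)%E.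
  exact/lebesgue_measure_ball/ltW.
apply/seteqP; split => -[x t] /=.
  move=> /(rV_ballP _ _ e0) h; split => /=.
    by have := h ord0; rewrite mxE tnth0.
  apply/(rV_ballP _ _ e0) => i; have := h (lift ord0 i).
  by rewrite !mxE tnthS.
move=> [h0 /(rV_ballP _ _ e0) h]; apply/(rV_ballP _ _ e0) => i; rewrite mxE.
have [j ->|->] := unliftP ord0 i; last by rewrite tnth0.
by have := h j; rewrite !mxE tnthS.
Qed.

Lemma lebesgue_tuple_open_gt0 N (U : set 'rV[R]_N) : open U -> U !=set0 ->
  (0 < lam N (@rV_of_tuple R N @^-1` U))%E.
Proof.
move=> Uo [v Uv]; have /nbhs_ballP[e /= e0 veU] : nbhs v U by exact: open_nbhs_nbhs.
apply: (@lt_le_trans _ _ (lam N (@rV_of_tuple R N @^-1` ball v e))).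
  by rewrite lebesgue_tuple_box// lte_fin exprn_gt0// pmulrn_lgt0.
apply: le_measure; rewrite ?inE; [|exact: measurable_tuple_open|by move=> t /veU].
exact: measurable_tuple_ball.
Qed.

End RationalBalls.

(** * Orthonormalization *)
Section GramSchmidt.
Variables (R : realType) (F : scalars R) (T : scalars_theory F).
Local Notation ofR := (ofR T).
Implicit Types n m : nat.

(** The length to the power -1, written as a real power of its square: this
    function is Borel on the whole line, 0 included. *)
Definition inv_norm n (x : 'cV[F]_n) : R := dot x x `^ (- 2^-1).

Lemma dot_ge0 p q (A : 'M[F]_(p, q)) : 0 <= dot A A.
Proof. by apply: sumr_ge0 => i _; rewrite -expr2 sqr_ge0. Qed.

Lemma gram_cV n (x : 'cV[F]_n) : adjoint x *m x = (ofR (dot x x))%:M.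
Proof.
apply/matrixP => i j; rewrite !ord1 !mxE eqxx mulr1n /dot /cdot sum_realify.
rewrite (big_morph ofR (ofRD T) (ofR0 T)); apply: eq_bigr => l _.
rewrite big_ord1 !mxE (cj_mul T); congr ofR; apply: eq_bigr => k _.
by rewrite realifyE.
Qed.

Lemma mulmx_ofR p q r t (A : 'M[F]_(p, q)) (B : 'M[F]_(q, r)) :
  A *m (ofR t *: B) = ofR t *: (A *m B).
Proof. by rewrite (rlinear_mull T r A).2. Qed.

Lemma dot_unitary p q r (u : 'M[F]_(p, q)) (A : 'M[F]_(q, r)) B :
  adjoint u *m u = 1%:M -> dot (u *m A) (u *m B) = dot A B.
Proof. by move=> uu; rewrite (dot_adjoint T) mulmxA uu mul1mx. Qed.

Definition normalize n (x : 'cV[F]_n) : 'cV[F]_n := ofR (inv_norm x) *: x.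

Lemma inv_normE n (x : 'cV[F]_n) : inv_norm x = (Num.sqrt (dot x x))^-1.
Proof. by rewrite /inv_norm powRN powR12_sqrt// dot_ge0. Qed.

Lemma normalize_gram n (x : 'cV[F]_n) : x != 0 ->
  adjoint (normalize x) *m normalize x = 1%:M.
Proof.
move=> x0; rewrite /normalize (adjointZ T) -scalemxAl mulmx_ofR gram_cV.
rewrite !scale_scalar_mx -!(ofRM T) inv_normE.
rewrite (_ : _ * _ = 1) ?(ofR1 T)//.
have d0 : 0 < dot x x by rewrite lt0r dot_ge0 (dot_eq0 T) x0.
have s0 : Num.sqrt (dot x x) != 0 by rewrite gt_eqF// sqrtr_gt0.
have := sqr_sqrtr (ltW d0); move: s0; set s := Num.sqrt _ => s0 <-.
by field.
Qed.

(** The first column is normalized, and its component is removed from the other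
    ones before going on with these. *)
Fixpoint gram_schmidt n m : 'M[F]_(n, m) -> 'M[F]_(n, m) :=
  match m with
  | 0 => id
  | m'.+1 => fun X : 'M[F]_(n, 1 + m') =>
      let q := normalize (lsubmx X) in
      row_mx q (gram_schmidt (rsubmx X - q *m (adjoint q *m rsubmx X)))
  end.

Lemma gram_schmidtE n m (X : 'M[F]_(n, 1 + m)) :
  gram_schmidt (X : 'M[F]_(n, m.+1)) =
  row_mx (normalize (lsubmx X)) (gram_schmidt (rsubmx X -
    normalize (lsubmx X) *m (adjoint (normalize (lsubmx X)) *m rsubmx X))).
Proof. by []. Qed.

Lemma normalize_unitary n n' (u : 'M[F]_(n', n)) x :
  adjoint u *m u = 1%:M -> normalize (u *m x) = u *m normalize x.
Proof.
by move=> uu; rewrite /normalize mulmx_ofR /inv_norm dot_unitary.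
Qed.

(** The coefficients in the Gram-Schmidt process are inner products, which u
    preserves. *)
Lemma gram_schmidt_unitary n n' m (u : 'M[F]_(n', n)) (X : 'M[F]_(n, m)) :
  adjoint u *m u = 1%:M -> gram_schmidt (u *m X) = u *m gram_schmidt X.
Proof.
move=> uu; elim: m X => [|m IH]; first by move=> X; apply/matrixP => i [].
rewrite -[m.+1]/(1 + m)%N => X; rewrite !(gram_schmidtE (m := m)) mul_mx_row -IH.
have -> : lsubmx (u *m X : 'M[F]_(n', 1 + m)) = u *m lsubmx (X : 'M[F]_(n, 1 + m)).
  by rewrite mulmx_lsub.
have -> : rsubmx (u *m X : 'M[F]_(n', 1 + m)) = u *m rsubmx (X : 'M[F]_(n, 1 + m)).
  by rewrite mulmx_rsub.
rewrite normalize_unitary// (adjointM T) mulmxBr.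
by rewrite !mulmxA -(mulmxA _ (adjoint u)) uu mulmx1.
Qed.

Lemma adjoint_row_mx n m1 m2 (A : 'M[F]_(n, m1)) (B : 'M[F]_(n, m2)) :
  adjoint (row_mx A B) = col_mx (adjoint A) (adjoint B).
Proof. by rewrite /adjoint map_row_mx tr_row_mx. Qed.

(** Columns of X remain independent modulo the first one, so that the recursion
    never normalizes a zero vector. *)
Lemma gram_schmidtP n m (X : 'M[F]_(n, m)) : mx_inj X ->
  adjoint (gram_schmidt X) *m gram_schmidt X = 1%:M /\
  exists S, gram_schmidt X = X *m S.
Proof.
elim: m X => [|m IH].
  by move=> X Xi; split; [apply/matrixP => -[]|exists 1%:M; rewrite mulmx1].
rewrite -[m.+1]/(1 + m)%N => X Xi.
set x := lsubmx (X : 'M[F]_(n, 1 + m)); set Z := rsubmx (X : 'M[F]_(n, 1 + m)).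
have XE : X = row_mx x Z by rewrite hsubmxK.
have x0 : x != 0.
  apply/eqP => x0; have : X *m (col_mx 1%:M 0 : 'cV[F]_(1 + m)) = 0.
    by rewrite XE mul_row_col mulmx0 x0 mul0mx addr0.
  move=> /Xi /(congr1 (fun v : 'cV[F]_(1 + m) => usubmx v 0 0)).
  by rewrite col_mxKu !mxE eqxx => /eqP; rewrite oner_eq0.
have qq := normalize_gram x0; set q := normalize x in qq *.
have qx : q = ofR (inv_norm x) *: x by [].
set Z' := Z - q *m (adjoint q *m Z).
have Z'i : mx_inj Z'.
  move=> y; rewrite mulmxBl => /eqP; rewrite subr_eq0 => /eqP Zy.
  pose w : 'cV[F]_1 := ofR (inv_norm x) *: (adjoint q *m Z *m y).
  have : X *m (col_mx (- w) y : 'cV[F]_(1 + m)) = 0.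
    rewrite XE mul_row_col Zy mulmxN addrC; apply/eqP; rewrite subr_eq0; apply/eqP.
    by rewrite -(mulmxA q) /w mulmx_ofR {1}qx -scalemxAl.
  move=> /Xi /(congr1 (fun v : 'cV[F]_(1 + m) => dsubmx v)).
  by rewrite col_mxKd => ->; apply/matrixP => i j; rewrite !mxE.
have [GG [S GS]] := IH _ Z'i.
have qZ' : adjoint q *m Z' = 0.
  by rewrite mulmxBr !mulmxA qq mul1mx subrr.
have qG : adjoint q *m gram_schmidt Z' = 0 by rewrite GS mulmxA qZ' mul0mx.
rewrite (gram_schmidtE (m := m)) -/x -/Z -/q -/Z'; split.
  rewrite adjoint_row_mx mul_col_row qq GG qG.
  have -> : adjoint (gram_schmidt Z') *m q = 0.
    rewrite -[LHS](adjointK T) (adjointM T) (adjointK T) qG.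
    by apply/matrixP => i j; rewrite !mxE (cj0 T).
  by rewrite -scalar_mx_block.
exists (block_mx (ofR (inv_norm x))%:M
  (- (ofR (inv_norm x) *: (adjoint q *m Z *m S))) 0 S).
rewrite XE mul_row_block !mulmx0 addr0; congr row_mx.
  rewrite qx; apply/matrixP => i j; rewrite !mxE (bigD1 j)//= big1 => [|l lj].
    by rewrite !mxE eqxx mulr1n addr0 ofR_comm.
  by rewrite !mxE (negPf lj) mulr0n mulr0.
rewrite GS mulmxN mulmx_ofR scalemxAl -qx mulmxBl addrC.
by rewrite !mulmxA.
Qed.

Lemma measurable_gram_schmidt d (U : measurableType d) n m (f : U -> 'M[F]_(n, m)) :
  mclass (fun g : U -> R => measurable_fun setT g) f ->
  mclass (fun g : U -> R => measurable_fun setT g) (fun x => gram_schmidt (f x)).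
Proof.
have HC := measurable_class R U; elim: m f => [//|m IH] f mf.
have sub1 p q1 q2 : rlinear T (@lsubmx F p q1 q2).
  by split=> *; apply/matrixP => i j; rewrite !mxE.
have sub2 p q1 q2 : rlinear T (@rsubmx F p q1 q2).
  by split=> *; apply/matrixP => i j; rewrite !mxE.
have row1 p q1 q2 : rlinear T (fun A : 'M[F]_(p, q1) => row_mx A (0 : 'M[F]_(p, q2))).
  by split=> *; rewrite ?add_row_mx ?addr0// scale_row_mx scaler0.
have row2 p q1 q2 : rlinear T (fun A : 'M[F]_(p, q2) => row_mx (0 : 'M[F]_(p, q1)) A).
  by split=> *; rewrite ?add_row_mx ?addr0// scale_row_mx scaler0.
pose x u := normalize (lsubmx (f u : 'M[F]_(n, 1 + m))).
have mx : mclass (fun g : U -> R => measurable_fun setT g) x.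
  have ml := mclass_rlinear HC (sub1 n 1 m) mf.
  apply: (mclassZ T HC (c := fun u => inv_norm (lsubmx (f u : 'M[F]_(n, 1 + m))))
    (f := fun u => lsubmx (f u : 'M[F]_(n, 1 + m)))) => //.
  exact: (measurableT_comp (measurable_powR _) (class_dot HC ml ml)).
pose G u := gram_schmidt (rsubmx (f u : 'M[F]_(n, 1 + m)) -
    x u *m (adjoint (x u) *m rsubmx (f u : 'M[F]_(n, 1 + m)))).
have mr := mclass_rlinear HC (sub2 n 1%N m) mf.
have mG : mclass (fun g : U -> R => measurable_fun setT g) G.
  apply: IH.
  rewrite (_ : (fun _ => _) = (fun u => rsubmx (f u : 'M[F]_(n, 1 + m)) +
     (x u *m (- (adjoint (x u) *m rsubmx (f u : 'M[F]_(n, 1 + m))))))).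
    apply: (mclassD T HC) => //; apply: (mclassM T HC) => //.
    have mN p q : rlinear T (-%R : 'M[F]_(p, q) -> _).
      by split=> [A B|t A]; [rewrite opprD|rewrite scalerN].
    apply: (mclass_rlinear HC (mN _ _)).
    by apply: (mclassM T HC) => //; exact: (mclass_adjoint T HC).
  by apply/funext => u; rewrite mulmxN.
rewrite (_ : (fun _ => _) = (fun u => row_mx (x u) 0 + row_mx 0 (G u))).
  apply: (mclassD T HC).
    exact: (mclass_rlinear HC (row1 n 1%N m) mx).
  exact: (mclass_rlinear HC (row2 n 1%N m) mG).
by apply/funext => u; rewrite add_row_mx addr0 add0r.
Qed.

Lemma orthonormal_basis n m (b : 'M[F]_(n, m)) : mx_inj b ->
  exists q : 'M[F]_(n, m), adjoint q *m q = 1%:M /\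
    exists S S', [/\ q = b *m S, b = q *m S', S *m S' = 1%:M & S' *m S = 1%:M].
Proof.
move=> bi; have [qq [S qS]] := gram_schmidtP bi.
exists (gram_schmidt b); split => //.
have Si : mx_inj S.
  move=> x Sx; rewrite -[x]mul1mx -qq -mulmxA qS -mulmxA.
  by rewrite Sx !mulmx0.
have [S' [S'S SS']] := mx_inj_invertible (scal_unit T) Si.
by exists S, S'; split => //; rewrite qS -mulmxA SS' mulmx1.
Qed.

End GramSchmidt.

(** * Integrals over spaces of matrices *)
Section MatrixIntegrals.
Variables (R : realType) (F : scalars R) (T : scalars_theory F).
Local Notation ofR := (ofR T).
Local Notation d := (rdim F).
Local Notation RT := (measurableTypeR R).
Local Notation "'mxT' p q" := ((p * q * d).-tuple RT)
  (at level 10, p at level 9, q at level 9).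
Local Notation "'lamx' p q" := (@lebesgue_tuple R (p * q * d))
  (at level 10, p at level 9, q at level 9).

Definition mx_of p q (t : mxT p q) : 'M[F]_(p, q) := unrealify T (rV_of_tuple t).
Definition tuple_of_mx p q (A : 'M[F]_(p, q)) : mxT p q := tuple_of_rV (realify A).

Lemma tuple_of_mxK p q : cancel (@tuple_of_mx p q) (@mx_of p q).
Proof. by move=> A; rewrite /mx_of tuple_of_rVK realifyK. Qed.

Lemma realify_mx_of p q (t : mxT p q) : realify (mx_of t) = rV_of_tuple t.
Proof. exact: unrealifyK. Qed.

Definition mmeas d' (U : measurableType d') p q (f : U -> 'M[F]_(p, q)) :=
  mclass (fun g : U -> R => measurable_fun setT g) f.

Definition mcont (U : topologicalType) p q (f : U -> 'M[F]_(p, q)) :=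
  mclass (fun g : U -> R => continuous g) f.

Lemma mmeas_mx_of p q : mmeas (@mx_of p q).
Proof.
move=> k; rewrite (_ : (fun _ => _) = (fun t : mxT p q => tnth t k)).
  exact: measurable_tnth.
by apply/funext => t; rewrite realify_mx_of mxE.
Qed.

Lemma mcont_unrealify p q : mcont (@unrealify R F T p q).
Proof.
move=> k; rewrite (_ : (fun _ => _) = (fun v : 'rV[R]_(p * q * d) => v 0 k)).
  exact: coord_continuous.
by apply/funext => v; rewrite (unrealifyK T).
Qed.

Lemma mmeas_tuple d' (U : measurableType d') p q (f : U -> 'M[F]_(p, q)) :
  mmeas f -> measurable_fun setT (@tuple_of_mx p q \o f).
Proof.
move=> mf; apply/measurable_fun_tnthP => k.
rewrite (_ : _ \o _ = (fun u => realify (f u) 0 k)); first exact: mf.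
by apply/funext => u /=; rewrite tnth_mktuple.
Qed.

Lemma measurable_mmeas_open d' (U : measurableType d') p q (f : U -> 'M[F]_(p, q))
    (O : set 'rV[R]_(p * q * d)) :
  mmeas f -> open O -> measurable [set u | O (realify (f u))].
Proof.
move=> mf Oo; rewrite (_ : [set u | _] =
   (@tuple_of_mx p q \o f) @^-1` (@rV_of_tuple R _ @^-1` O)).
  apply: measurable_preimage; first exact: mmeas_tuple.
  exact: measurable_tuple_open.
by apply/seteqP; split => u; rewrite /= tuple_of_rVK.
Qed.

Lemma mcont_continuous (U : topologicalType) p q (f : U -> 'M[F]_(p, q)) :
  mcont f -> continuous (fun u => realify (f u)).
Proof.
move=> cf u A /nbhs_ballP[e /= e0 eA].
have : \forall x \near u, forall k, `|realify (f u) 0 k - realify (f x) 0 k| < e.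
  apply: filter_forall => k.
  by have /cvgrPdist_lt/(_ e e0) := cf k u.
by apply: filterS => x h; apply: eA; apply/rV_ballP.
Qed.

(** ** Linear changes of variables in spaces of matrices *)

Lemma integral_mull p q (a : 'M[F]_p) (f : 'M[F]_(p, q) -> \bar R) :
  mx_inj a -> measurable_fun setT (f \o @mx_of p q) ->
  (forall A, 0 <= f A)%E ->
  (\int[lamx p q]_t f (a *m mx_of t) =
   ((cmod T a ^+ q)^-1)%:E * \int[lamx p q]_t f (mx_of t))%E.
Proof.
move=> ai mf f0; pose L := rmat T (mulmx a : 'M[F]_(p, q) -> _).
have aq : `|\det L| = cmod T a ^+ q by rewrite -lmod_cmod.
have L0 : \det L != 0.
  by rewrite -normr_eq0 aq expf_neq0// gt_eqF// cmod_gt0.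
rewrite -aq -(integral_mxact L0 mf (fun t => f0 _)).
apply: eq_integral => t _; congr f; rewrite /mx_of /mxact tuple_of_rVK.
apply: (realify_inj T); rewrite (rmatE (rlinear_mull T _ _)).
by rewrite !(unrealifyK T).
Qed.

Lemma integral_mulr p q (b : 'M[F]_q) (f : 'M[F]_(p, q) -> \bar R) :
  mx_inj b -> measurable_fun setT (f \o @mx_of p q) ->
  (forall A, 0 <= f A)%E ->
  (\int[lamx p q]_t f (mx_of t *m b) =
   ((cmod T b ^+ p)^-1)%:E * \int[lamx p q]_t f (mx_of t))%E.
Proof.
move=> bi mf f0; pose L := rmat T (fun A : 'M[F]_(p, q) => A *m b).
have aq : `|\det L| = cmod T b ^+ p by rewrite -lmod_cmod// -rmod_lmod.
have L0 : \det L != 0.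
  by rewrite -normr_eq0 aq expf_neq0// gt_eqF// cmod_gt0.
rewrite -aq -(integral_mxact L0 mf (fun t => f0 _)).
apply: eq_integral => t _; congr f; rewrite /mx_of /mxact tuple_of_rVK.
apply: (realify_inj T); rewrite (rmatE (rlinear_mulr T _ _)).
by rewrite !(unrealifyK T).
Qed.

Lemma lebesgue_mull p q (a : 'M[F]_p) (A : set 'M[F]_(p, q)) :
  mx_inj a -> measurable (@mx_of p q @^-1` A) ->
  (lamx p q [set t | A (a *m mx_of t)] =
   ((cmod T a ^+ q)^-1)%:E * lamx p q (@mx_of p q @^-1` A))%E.
Proof.
move=> ai mA; pose L := rmat T (mulmx a : 'M[F]_(p, q) -> _).
have aq : `|\det L| = cmod T a ^+ q by rewrite -lmod_cmod.
rewrite -aq -lebesgue_tuple_mxact//; last first.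
  by rewrite -normr_eq0 aq expf_neq0// gt_eqF// cmod_gt0.
congr (lebesgue_tuple _); apply/seteqP; split => t /=;
  rewrite (_ : mx_of (mxact L t) = a *m mx_of t)//;
  rewrite /mx_of /mxact tuple_of_rVK;
  apply: (realify_inj T); rewrite (rmatE (rlinear_mull T _ _));
  by rewrite !(unrealifyK T).
Qed.

(** ** The volume of a frame *)

(** For a matrix X with m columns, this is the factor by which x |-> X x
    expands volumes in F^m. *)
Definition vol n m (X : 'M[F]_(n, m)) : R := Num.sqrt (cmod T (adjoint X *m X)).

Lemma vol_ge0 n m (X : 'M[F]_(n, m)) : 0 <= vol X.
Proof. exact: sqrtr_ge0. Qed.

Lemma vol_gt0 n m (X : 'M[F]_(n, m)) : 0 < vol X <-> mx_inj X.
Proof.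
rewrite sqrtr_gt0; split => [X0|Xi]; last exact/cmod_gt0/gram_inj.
have Gi : mx_inj (adjoint X *m X) by apply: (@cmod_neq0_inj _ _ T); rewrite gt_eqF.
by move=> x Xx; apply: Gi; rewrite -mulmxA Xx mulmx0.
Qed.

(** vol(X)^2 is the modulus of X^* X, and (X r)^* (X r) = r^* (X^* X) r. *)
Lemma volM n m (X : 'M[F]_(n, m)) (r : 'M[F]_m) : vol (X *m r) = vol X * cmod T r.
Proof.
rewrite /vol (adjointM T) mulmxA -(mulmxA (adjoint r)) /cmod !lmodM lmod_adjoint.
rewrite mulrAC -expr2 sqrtrM ?sqr_ge0// sqrtr_sqr ger0_norm ?lmod_ge0//.
by rewrite mulrC.
Qed.

Lemma vol_orthonormal n m (X : 'M[F]_(n, m)) : adjoint X *m X = 1%:M -> vol X = 1.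
Proof. by rewrite /vol => ->; rewrite /cmod lmod1 sqrtr1. Qed.

Lemma class_vol (U : Type) (C : (U -> R) -> Prop) (HC : function_class C) n m
    (f : U -> 'M[F]_(n, m)) : mclass C f -> C (fun u => vol (f u)).
Proof.
move=> Cf; apply: (class_comp HC (g := Num.sqrt)); first exact: sqrt_continuous.
by apply: (class_lmod T HC); apply: (mclassM T HC) => //; exact: (mclass_adjoint T HC).
Qed.

Lemma mmeas_vol d' (U : measurableType d') n m (f : U -> 'M[F]_(n, m)) :
  mmeas f -> measurable_fun setT (fun u => vol (f u)).
Proof. exact: class_vol (measurable_class R U) _ _ _. Qed.

Lemma mmeas_dot d' (U : measurableType d') n m (f : U -> 'M[F]_(n, m)) :
  mmeas f -> measurable_fun setT (fun u => dot (f u) (f u)).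
Proof. by move=> mf; exact: (class_dot (measurable_class R U)). Qed.

End MatrixIntegrals.

(** * The Grassmannian *)
Section Grassmann.
Variables (R : realType) (F : scalars R) (T : scalars_theory F).
Local Notation ofR := (ofR T).
Local Notation d := (rdim F).
Local Notation RT := (measurableTypeR R).
Variables (n m : nat) (mn : (m <= n)%N).
Local Notation G := (borelGr F mn).
Implicit Types (E : Gr F mn) (X b : 'M[F]_(n, m)).

Lemma Gr_eq E E' : space E = space E' -> E = E'.
Proof.
case: E E' => [s sP] [s' sP'] /= ss'; case: s' / ss' in sP' *.
by rewrite (Prop_irrelevance sP sP').
Qed.

Lemma mx_injM p q r (A : 'M[F]_(p, q)) (B : 'M[F]_(q, r)) :
  mx_inj A -> mx_inj B -> mx_inj (A *m B).
Proof. by move=> Ai Bi x; rewrite -mulmxA => /Ai/Bi. Qed.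

Lemma orthonormal_inj p q (b : 'M[F]_(p, q)) : adjoint b *m b = 1%:M -> mx_inj b.
Proof. by move=> bb x bx; rewrite -[x]mul1mx -bb -mulmxA bx mulmx0. Qed.

Lemma mx_inj_basis X : mx_inj X ->
  exists b : 'M[F]_(n, m), is_basis b (range (fun x : 'cV[F]_m => X *m x)).
Proof. by move=> Xi; exists X; split. Qed.

(** Arbitrary, namely [point], if the columns of X are dependent; this makes
    [colspan] a total function that can be integrated over all matrices. *)
Definition colspan X : Gr F mn :=
  if pselect (mx_inj X) is left Xi then MkGr mn (mx_inj_basis Xi) else point.

Lemma space_span X : mx_inj X -> space (colspan X) = range (fun x : 'cV[F]_m => X *m x).
Proof. by rewrite /colspan; case: pselect. Qed.

Lemma span_basis b E : is_basis b (space E) -> colspan b = E.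
Proof. by move=> [bi bE]; apply: Gr_eq; rewrite space_span// bE. Qed.

Lemma is_basis_span X : mx_inj X -> is_basis X (space (colspan X)).
Proof. by move=> Xi; split => //; rewrite space_span. Qed.

Lemma range_mulmx_unit X (r s : 'M[F]_m) : r *m s = 1%:M ->
  range (fun x : 'cV[F]_m => (X *m r) *m x) = range (fun x : 'cV[F]_m => X *m x).
Proof.
move=> rs; apply/seteqP; split => y [x _ <-] /=.
  by exists (r *m x) => //; rewrite mulmxA.
by exists (s *m x) => //; rewrite !mulmxA -(mulmxA X) rs mulmx1.
Qed.

Lemma spanMr X (r : 'M[F]_m) : mx_inj X -> mx_inj r -> colspan (X *m r) = colspan X.
Proof.
move=> Xi ri; have [s [_ rs]] := mx_inj_invertible (scal_unit T) ri.
apply: Gr_eq; rewrite !space_span//; first exact: range_mulmx_unit rs.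
exact: mx_injM.
Qed.

Lemma basis_change b b' (A : set 'cV[F]_n) : is_basis b A -> is_basis b' A ->
  exists r : 'M[F]_m, b' = b *m r /\ mx_inj r.
Proof.
move=> [bi bA] [b'i b'A].
have /choice[f fE] (j : 'I_m) : exists x : 'cV[F]_m, b *m x = col j b'.
  have : A (col j b').
    by rewrite b'A; exists (delta_mx j 0) => //; rewrite colE.
  by rewrite bA => -[x _ <-]; exists x.
pose r := \matrix_(i, j) f j i 0; have rE : b' = b *m r.
  apply/matrixP => i j; have := congr1 (fun v : 'cV[F]_n => v i 0) (fE j).
  by rewrite !mxE => <-; apply: eq_bigr => l _; rewrite mxE.
exists r; split => // x rx; apply: b'i.
by rewrite rE -mulmxA rx mulmx0.
Qed.

(** The orthonormal basis of E with respect to which [volume] is measured. *)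
Definition frame E : 'M[F]_(n, m) := xget 0 [set b : 'M[F]_(n, m) |
  adjoint b *m b = 1%:M /\ space E = range (fun x : 'cV[F]_m => b *m x)].

Lemma frameP E : adjoint (frame E) *m frame E = 1%:M /\ is_basis (frame E) (space E).
Proof.
have [b [bi bE]] := spaceP E.
have [q [qq [S [S' [qE bE' SS' S'S]]]]] := orthonormal_basis T bi.
suff : [set b : 'M[F]_(n, m) | adjoint b *m b = 1%:M /\
    space E = range (fun x : 'cV[F]_m => b *m x)] (frame E).
  by move=> [ff fE]; split => //; split => //; exact: orthonormal_inj.
apply: xgetPex; exists q; split => //.
by rewrite bE qE (range_mulmx_unit b SS').
Qed.

Lemma frame_inj E : mx_inj (frame E).
Proof. exact/orthonormal_inj/(frameP E).1. Qed.

Lemma span_frame E : colspan (frame E) = E.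
Proof. exact/span_basis/(frameP E).2. Qed.

Lemma frame_span X : mx_inj X -> exists r : 'M[F]_m, X = frame (colspan X) *m r /\ mx_inj r.
Proof.
by move=> Xi; exact: basis_change (frameP _).2 (is_basis_span Xi).
Qed.

(** The image of E under h if h is injective: see [space_act]. *)
Definition act (h : 'M[F]_n) E : Gr F mn := colspan (h *m frame E).

Lemma act_span (h : 'M[F]_n) X : mx_inj X -> mx_inj (h *m frame (colspan X)) ->
  act h (colspan X) = colspan (h *m X).
Proof.
move=> Xi hi; have [r [XE ri]] := frame_span Xi.
by rewrite {2}XE mulmxA spanMr.
Qed.

Lemma act_spanT (h : 'M[F]_n) X : mx_inj h -> mx_inj X ->
  act h (colspan X) = colspan (h *m X).
Proof. by move=> hi Xi; apply: act_span => //; apply: mx_injM => //; exact: frame_inj. Qed.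

Lemma actM (h h' : 'M[F]_n) E : mx_inj h -> mx_inj h' ->
  act h (act h' E) = act (h *m h') E.
Proof.
move=> hi h'i; rewrite -{1}(span_frame E) act_spanT//; last exact: frame_inj.
rewrite act_spanT//; last by apply: mx_injM => //; exact: frame_inj.
by rewrite mulmxA.
Qed.

Lemma act1 E : act 1%:M E = E.
Proof. by rewrite /act mul1mx span_frame. Qed.

Lemma space_act (h : 'M[F]_n) E : mx_inj h ->
  space (act h E) = [set h *m x | x in space E].
Proof.
move=> hi; rewrite space_span; last by apply: mx_injM => //; exact: frame_inj.
rewrite (frameP E).2.2; apply/seteqP; split => y.
  by move=> [x _ <-]; exists (frame E *m x); [exists x|rewrite mulmxA].
by move=> [_ [x _ <-] <-]; exists x => //; rewrite mulmxA.
Qed.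

(** ** Measurability *)

Definition frames_of (S : set (Gr F mn)) : set 'rV[R]_(n * m * d) :=
  [set v | mx_inj (unrealify T v : 'M[F]_(n, m)) /\ S (colspan (unrealify T v))].

Lemma Gr_openE (S : set (Gr F mn)) : @Gr_open R F n m mn S <-> open (frames_of S).
Proof.
suff -> : frames_of S = @realify R F n m @`
    [set b : 'M[F]_(n, m) | exists2 E : Gr F mn, S E & is_basis b E] by [].
apply/esym/seteqP; split => v.
  move=> [b [E SE bE] <-]; rewrite /frames_of /= realifyK.
  by rewrite (span_basis bE); split => //; case: bE.
move=> [vi Sv]; exists (unrealify T v); last by rewrite (unrealifyK T).
by exists (colspan (unrealify T v)) => //; exact: is_basis_span.
Qed.

(** Injective matrices are those with vol(X) > 0, and vol is continuous. *)
Lemma mx_inj_open p q : open [set v | mx_inj (unrealify T v : 'M[F]_(p, q))].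
Proof.
have := class_vol T (continuous_class R _) (@mcont_unrealify R F T p q).
rewrite (_ : [set v | _] =
    (fun v => vol T (unrealify T v : 'M[F]_(p, q))) @^-1` `]0, +oo[%classic).
  move=> /continuousP; apply; exact: interval_open.
by apply/seteqP; split => v /=; rewrite in_itv/= andbT => /(vol_gt0 T).
Qed.

Lemma measurable_mx_inj d' (U : measurableType d') p q (f : U -> 'M[F]_(p, q)) :
  mmeas f -> measurable [set u | mx_inj (f u)].
Proof.
move=> mf; have := measurable_mmeas_open mf (@mx_inj_open p q).
by congr measurable; apply/seteqP; split => u; rewrite /= realifyK.
Qed.

Lemma open_measurable_Gr (S : set (Gr F mn)) : open (frames_of S) ->
  measurable (S : set G).
Proof. by move=> So; apply: sub_sigma_algebra; apply/Gr_openE. Qed.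

Lemma measurable_to_Gr d' (U : measurableType d') (f : U -> G) :
  (forall S : set (Gr F mn), open (frames_of S) -> measurable (f @^-1` S)) ->
  measurable_fun setT f.
Proof.
move=> fm; apply: (@measurability _ _ U G setT f (@Gr_open R F n m mn)) => //.
by move=> _ [S /Gr_openE So <-]; rewrite setTI; exact: fm.
Qed.

Lemma measurable_span d' (U : measurableType d') (f : U -> 'M[F]_(n, m)) :
  mmeas f -> measurable_fun setT (fun u => colspan (f u) : G).
Proof.
move=> mf; apply: measurable_to_Gr => S So.
rewrite (_ : _ @^-1` _ = [set u | frames_of S (realify (f u))] `|`
   [set u | ~ mx_inj (f u) /\ S point]).
  apply: measurableU; first exact: measurable_mmeas_open.
  have [Sp|Sp] := pselect (S point).
    rewrite (_ : [set u | _] = ~` [set u | mx_inj (f u)]).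
      by apply: measurableC; exact: measurable_mx_inj.
    by apply/seteqP; split => u /=; [case|].
  rewrite (_ : [set u | _] = set0); first exact: measurable0.
  by apply/seteqP; split => u //= -[].
apply/seteqP; split => u /=; rewrite /frames_of /= realifyK /colspan; case: pselect => fi.
- by move=> Sf; left.
- by move=> Sf; right.
- by move=> [[]//|[]].
- by move=> [[]//|[]].
Qed.

(** The map from frames to subspaces is open: the saturation of an open set of
    frames is a union of its translates under right multiplications, which are
    homeomorphisms. *)
Lemma frames_of_image_open (O : set 'rV[R]_(n * m * d)) : open O ->
  open (frames_of [set E | exists2 b : 'M[F]_(n, m), O (realify b) & is_basis b (space E)]).
Proof.
move=> Oo.
rewrite (_ : frames_of _ = \bigcup_(r in [set r : 'M[F]_m | mx_inj r])
   ([set v | mx_inj (unrealify T v : 'M[F]_(n, m))] `&`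
    (fun v => realify (unrealify T v *m r : 'M[F]_(n, m))) @^-1` O)).
  apply: bigcup_open => r _; apply: openI; first exact: mx_inj_open.
  have /continuousP : continuous (fun v => realify (unrealify T v *m r : 'M[F]_(n, m))).
    apply: mcont_continuous; apply: (mclassM T (continuous_class R _)).
      exact: mcont_unrealify.
    by apply: mclass_cst; exact: continuous_class.
  exact.
apply/seteqP; split => v /=.
  move=> [vi [b Ob bE]].
  have [r [br ri]] := basis_change (is_basis_span vi) bE.
  by exists r => //; split => //=; rewrite -br.
move=> [r ri [vi Ov]]; split => //; exists (unrealify T v *m r) => //.
split; first exact: mx_injM.
rewrite space_span//.
have [s [_ rs]] := mx_inj_invertible (scal_unit T) ri.
by rewrite (range_mulmx_unit _ rs).
Qed.

(** The action of matrices on frames is continuous, so the preimage of an open set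
    under it is a countable union of products of boxes; the images of these boxes
    in the Grassmannian are open. Stated for matrices that may fail to be
    invertible, as only the product with the frame has to be injective. *)
Lemma measurable_act_joint d' (U : measurableType d') (f : U -> 'M[F]_n)
    (g : U -> G) (S : set (Gr F mn)) :
  mmeas f -> measurable_fun setT g -> open (frames_of S) ->
  measurable [set u | mx_inj (f u *m frame (g u)) /\ S (act (f u) (g u))].
Proof.
move=> mf mg So.
pose V := [set p : 'rV[R]_(n * n * d) * 'rV[R]_(n * m * d) |
  frames_of S (realify ((unrealify T p.1 : 'M[F]_n) *m (unrealify T p.2 : 'M[F]_(n, m))))].
have Vo : open V.
  have HC := continuous_class R ('rV[R]_(n * n * d) * 'rV[R]_(n * m * d))%type.
  have /continuousP : continuous (fun p : 'rV[R]_(n * n * d) * 'rV[R]_(n * m * d) =>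
     realify ((unrealify T p.1 : 'M[F]_n) *m (unrealify T p.2 : 'M[F]_(n, m)))).
    apply: mcont_continuous; apply: (mclassM T HC) => k p.
      apply: (@continuous_comp _ _ _ fst (fun v => realify (unrealify T v : 'M[F]_n) 0 k)).
        exact: cvg_fst.
      exact: mcont_unrealify.
    apply: (@continuous_comp _ _ _ snd
       (fun v => realify (unrealify T v : 'M[F]_(n, m)) 0 k)).
      exact: cvg_snd.
    exact: mcont_unrealify.
  exact.
pose I := (('rV[rat]_(n * n * d) * nat) * ('rV[rat]_(n * m * d) * nat))%type.
pose P (i : I) : set U := [set u | rball i.1.1 i.1.2 (realify (f u))] `&`
  g @^-1` [set E | exists2 b : 'M[F]_(n, m),
    rball i.2.1 i.2.2 (realify b) & is_basis b (space E)].
rewrite (_ : [set u | _] = \bigcup_(i : I)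
    [set u | (rball (R := R) i.1.1 i.1.2 `*` rball i.2.1 i.2.2 `<=` V) /\ P i u]).
  apply: countable_bigcupT_measurable => [|i]; first exact: countableP.
  have [iV|iV] := pselect (rball (R := R) i.1.1 i.1.2 `*` rball i.2.1 i.2.2 `<=` V);
    last first.
    rewrite (_ : [set u | _] = set0); first exact: measurable0.
    by apply/seteqP; split => u //= -[].
  rewrite (_ : [set u | _] = P i); last by apply/seteqP; split => u //= -[].
  apply: measurableI; first by apply: measurable_mmeas_open => //; exact: rball_open.
  apply: measurable_preimage => //; apply: open_measurable_Gr.
  by apply: frames_of_image_open; exact: rball_open.
apply/seteqP; split => u /=.
  move=> [fgi Sfg].
  have Vfg : V (realify (f u), realify (frame (g u))).
    by rewrite /V /frames_of /= !realifyK.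
  have [[A B] /= [fA gB] AB] := open_nbhs_nbhs (conj Vo Vfg).
  have [i [fi iA]] := rball_basis (@open_interior _ A) (fA : A° _).
  have [j [gj jB]] := rball_basis (@open_interior _ B) (gB : B° _).
  exists (i, j) => //; split.
    move=> [a b] [/= ia jb]; apply: AB; split => /=.
      by apply: interior_subset; exact: iA.
    by apply: interior_subset; exact: jB.
  split => //=; exists (frame (g u)) => //; exact: (frameP _).2.
move=> [i _ [iV [fi [b bj bE]]]].
have : V (realify (f u), realify b) by apply: iV.
rewrite /V /frames_of /= !realifyK => -[fbi Sfb].
have [r [bE' ri]] := basis_change bE (frameP (g u)).2.
rewrite /act bE' mulmxA spanMr//; split => //; exact: mx_injM.
Qed.

Lemma measurable_act (h : 'M[F]_n) : mx_inj h -> measurable_fun setT (act h : G -> G).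
Proof.
move=> hi; apply: measurable_to_Gr => S So.
have mh : mmeas (fun _ : G => h) by apply: mclass_cst; exact: measurable_class.
have := measurable_act_joint mh (@measurable_id _ G setT) So.
congr measurable; apply/seteqP; split => E /=; first by case.
by split => //; apply: mx_injM => //; exact: frame_inj.
Qed.

End Grassmann.

Section InjectiveBall.
Variables (R : realType) (F : scalars R) (T : scalars_theory F) (p q : nat).
Local Notation d := (rdim F).
Local Notation RT := (measurableTypeR R).
Local Notation lamx := (@lebesgue_tuple R (p * q * d)).

(** The unit ball of the space of matrices, for the Euclidean norm, without the
    matrices of dependent columns. It has finite positive measure, and it is
    invariant under isometries. *)
Definition inj_ball : set ((p * q * d).-tuple RT) :=
  [set t | mx_inj (mx_of T t : 'M[F]_(p, q)) /\
           dot (mx_of T t : 'M[F]_(p, q)) (mx_of T t) < 1].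

Lemma measurable_inj_ball : measurable inj_ball.
Proof.
apply: measurableI; first by apply: (measurable_mx_inj T); exact: mmeas_mx_of.
rewrite [X in measurable X](_ : _ = (fun t : (p * q * d).-tuple RT =>
  dot (mx_of T t : 'M[F]_(p, q)) (mx_of T t)) @^-1` `]-oo, 1[%classic).
  apply: measurable_preimage => //; apply: mmeas_dot.
  exact: mmeas_mx_of.
by apply/seteqP; split => t /=; rewrite in_itv.
Qed.

Lemma lebesgue_inj_ball_lty : (lamx inj_ball < +oo)%E.
Proof.
apply: (@le_lt_trans _ _ (lamx (@rV_of_tuple R _ @^-1` ball 0 1))); last first.
  by rewrite lebesgue_tuple_box// ltry.
apply: le_measure; rewrite ?inE.
- exact: measurable_inj_ball.
- exact: measurable_tuple_ball.
move=> t [_ t1] /=; apply/rV_ballP => // k; rewrite mxE sub0r normrN.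
rewrite -(@ltr_pXn2r _ 2)// ?nnegrE// expr1n real_normK ?num_real//.
apply: le_lt_trans t1; rewrite /dot /cdot (bigD1 k)//= realify_mx_of -expr2.
by rewrite lerDl sumr_ge0// => l _; rewrite -expr2 sqr_ge0.
Qed.

Lemma lebesgue_inj_ball_gt0 : (q <= p)%N -> (0 < lamx inj_ball)%E.
Proof.
move=> qp; pose O := [set v | mx_inj (unrealify T v : 'M[F]_(p, q)) /\ cdot v v < 1].
have Oo : open O.
  have HC := continuous_class R 'rV[R]_(p * q * d).
  rewrite (_ : O = [set v | mx_inj (unrealify T v : 'M[F]_(p, q))] `&`
    (fun v : 'rV[R]_(p * q * d) => cdot v v) @^-1` `]-oo, 1[%classic); last first.
    by apply/seteqP; split => v; rewrite /O /= in_itv.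
  apply: openI; first exact: mx_inj_open.
  have /continuousP : continuous (fun v : 'rV[R]_(p * q * d) => cdot v v).
    apply: (class_sum HC) => k.
    by apply: (classM HC); exact: coord_continuous.
  by apply; exact: interval_open.
have := @lebesgue_tuple_open_gt0 R _ O Oo.
have -> : @rV_of_tuple R _ @^-1` O = inj_ball.
  by apply/seteqP; split => t; rewrite /inj_ball /= /dot !realify_mx_of.
apply; pose X : 'M[F]_(p, q) := pid_mx q.
have Xi : mx_inj X.
  move=> x /(congr1 (mulmx (pid_mx q : 'M[F]_(q, p)))).
  by rewrite mulmx0 mulmxA mul_pid_mx minnn (minn_idPr qp) pid_mx_1 mul1mx.
(* A scaling that brings the frame X into the unit ball: |X| / (1 + |X|^2) < 1. *)
pose e : R := (1 + dot X X)^-1.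
have D0 : 0 <= dot X X by exact: dot_ge0.
have e0 : 0 < e by rewrite invr_gt0 ltr_wpDr.
exists (realify (ofR T e *: X)); split.
  rewrite realifyK => x; rewrite -scalemxAl => eXx; apply: Xi.
  have := congr1 (@realify R F p 1) eXx; rewrite realifyZ (realify0 T) => h.
  apply: (realify_inj T); rewrite (realify0 T).
  by rewrite -[LHS](scalerK (lt0r_neq0 e0)) h scaler0.
rewrite /= realifyZ.
have -> : cdot (e *: realify X) (e *: realify X) = e ^+ 2 * dot X X.
  rewrite /dot /cdot mulr_sumr; apply: eq_bigr => k _; rewrite !mxE; ring.
rewrite /e exprVn mulrC ltr_pdivrMr ?mul1r ?exprn_gt0//; last lra.
nra.
Qed.

End InjectiveBall.

(** * Uniqueness of the invariant measure *)
Section Transitivity.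
Variables (R : realType) (F : scalars R) (T : scalars_theory F).
Local Notation d := (rdim F).

Lemma rdim_gt0 : (0 < d)%N.
Proof.
case: (posnP d) => // d0; have : (1 : F) = 0.
  apply: (coord_inj T); apply/rowP => -[i i_lt].
  by exfalso; move: i_lt; rewrite d0.
by move/eqP; rewrite oner_eq0.
Qed.

(** Real dimensions suffice: realified, the system has p d equations in q d real
    unknowns, where d is the real dimension of the scalars. *)
Lemma wide_kernel p q (A : 'M[F]_(p, q)) : (p < q)%N ->
  exists2 y : 'cV[F]_q, y != 0 & A *m y = 0.
Proof.
move=> pq; pose M := rmat T (mulmx A : 'M[F]_(q, 1) -> 'M[F]_(p, 1)).
have : kermx M != 0.
  rewrite -mxrank_eq0 mxrank_ker -lt0n subn_gt0.
  by rewrite (leq_ltn_trans (rank_leq_col M))// !muln1 ltn_pmul2r// rdim_gt0.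
move=> /rowV0Pn[v /sub_kermxP vM v0]; exists (unrealify T v).
  by apply: contra_neq v0 => v0; rewrite -[v](unrealifyK T) v0 realify0.
by apply: (realify_inj T); rewrite (rmatE (rlinear_mull T _ _)) (unrealifyK T) vM realify0.
Qed.

Lemma unit_normal_vector n m (b : 'M[F]_(n, m)) : (m < n)%N ->
  exists y : 'cV[F]_n, adjoint y *m y = 1%:M /\ adjoint b *m y = 0.
Proof.
move=> mn; have [y y0 by0] := wide_kernel (adjoint b) mn.
exists (normalize T y); split; first exact: normalize_gram.
by rewrite /normalize mulmx_ofR by0 scaler0.
Qed.

Lemma adjoint_eq0 p q (A : 'M[F]_(p, q)) : adjoint A = 0 -> A = 0.
Proof.
move=> /(congr1 (@adjoint R F q p)); rewrite adjointK// => ->.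
by apply/matrixP => i j; rewrite !mxE (cj0 T).
Qed.

Lemma orthonormal_extension n m k (b : 'M[F]_(n, m)) :
  adjoint b *m b = 1%:M -> (m + k <= n)%N ->
  exists Z : 'M[F]_(n, k), adjoint Z *m Z = 1%:M /\ adjoint b *m Z = 0.
Proof.
move=> bb; elim: k => [|k IH] mkn.
  by exists 0; split; apply/matrixP => i [].
have [Z [ZZ bZ]] := IH (leq_trans (leq_add (leqnn m) (leqnSn k)) mkn).
rewrite addnS in mkn; have [y [yy]] := unit_normal_vector (row_mx b Z) mkn.
rewrite adjoint_row_mx mul_col_mx => /eqP; rewrite col_mx_eq0.
move=> /andP[/eqP by0 /eqP Zy0].
have yZ : adjoint y *m Z = 0.
  by apply: adjoint_eq0; rewrite (adjointM T) (adjointK T).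
rewrite -[k.+1]/(1 + k)%N; exists (row_mx y Z); split.
  by rewrite adjoint_row_mx mul_col_row yy ZZ yZ Zy0 -scalar_mx_block.
by rewrite mul_mx_row by0 bZ row_mx0.
Qed.

(** The n columns of b and of an orthonormal extension Z form a square matrix with
    orthonormal columns, which has orthonormal rows as well; this is the last
    identity. *)
Lemma orthonormal_completion n m (b : 'M[F]_(n, m)) : (m <= n)%N ->
  adjoint b *m b = 1%:M -> exists Z : 'M[F]_(n, n - m),
  [/\ adjoint Z *m Z = 1%:M, adjoint b *m Z = 0, adjoint Z *m b = 0 &
      b *m adjoint b + Z *m adjoint Z = 1%:M].
Proof.
move=> mn bb; have [|Z [ZZ bZ]] := @orthonormal_extension n m (n - m) b bb.
  by rewrite subnKC.
have Zb : adjoint Z *m b = 0.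
  by apply: adjoint_eq0; rewrite (adjointM T) (adjointK T).
exists Z; split => //; have e : (m + (n - m))%N = n by rewrite subnKC.
move: (n - m)%N e b Z bb ZZ bZ Zb {mn} => k e.
case: n / e => b Z bb ZZ bZ Zb.
have uu : adjoint (row_mx b Z) *m row_mx b Z = 1%:M.
  by rewrite adjoint_row_mx mul_col_row bb ZZ bZ Zb -scalar_mx_block.
have [v [vu uv]] := mx_inj_invertible (scal_unit T) (orthonormal_inj uu).
have : row_mx b Z *m adjoint (row_mx b Z) = 1%:M.
  have -> : adjoint (row_mx b Z) = v.
    by rewrite -[LHS]mulmx1 -uv mulmxA uu mul1mx.
  exact: uv.
by rewrite adjoint_row_mx mul_row_col.
Qed.

Lemma isometry_inj n (u : 'M[F]_n) : isometry_group u -> mx_inj u.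
Proof. by move=> [uu _]; exact: orthonormal_inj. Qed.

Lemma isometry_adjoint n (u : 'M[F]_n) : isometry_group u -> isometry_group (adjoint u).
Proof. by move=> [uu uu']; rewrite /isometry_group /= (adjointK T). Qed.

(** Complete both frames by Z and Z', and map b to b' and Z to Z'. *)
Lemma isometry_transitive n m (b b' : 'M[F]_(n, m)) : (m <= n)%N ->
  adjoint b *m b = 1%:M -> adjoint b' *m b' = 1%:M ->
  exists2 w : 'M[F]_n, isometry_group w & b' = w *m b.
Proof.
move=> mn bb bb'; have [Z [ZZ bZ Zb bZ1]] := orthonormal_completion mn bb.
have [Z' [ZZ' bZ' Zb' bZ1']] := orthonormal_completion mn bb'.
have mul4 (p q r s : nat) (A : 'M[F]_(p, q)) (B : 'M[F]_(q, r)) (C : 'M[F]_(r, s))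
    (D : 'M[F]_(s, p)) :
  (A *m B) *m (C *m D) = A *m (B *m C) *m D by rewrite !mulmxA.
exists (b' *m adjoint b + Z' *m adjoint Z).
  rewrite /isometry_group /= (adjointD T) !(adjointM T) !(adjointK T).
  rewrite !mulmxDl !mulmxDr !mul4 bb bb' ZZ ZZ' Zb Zb' bZ bZ'.
  by rewrite !mulmx0 !mul0mx !mulmx1 !addr0 !add0r.
by rewrite mulmxDl -!mulmxA bb Zb mulmx0 addr0 mulmx1.
Qed.

End Transitivity.

Lemma tonelli_set d1 d2 (T1 : measurableType d1) (T2 : measurableType d2)
    (R : realType) (m1 : {sigma_finite_measure set T1 -> \bar R})
    (m2 : {sigma_finite_measure set T2 -> \bar R}) (A : set (T1 * T2)) :
  measurable A ->
  (\int[m1]_x m2 [set y | A (x, y)] = \int[m2]_y m1 [set x | A (x, y)])%E.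
Proof.
move=> mA; have := @indic_fubini_tonelli _ _ _ _ _ m1 m2 A mA.
rewrite /fubini_F /fubini_G => H.
transitivity (\int[m1]_x \int[m2]_y (\1_A (x, y))%:E)%E.
  apply: eq_integral => x _.
  rewrite (_ : (fun y => _) = (fun y => (\1_[set y | A (x, y)] y)%:E)).
    rewrite integral_indic ?setIT//; exact: measurable_preimage (pair1_measurable x) mA.
  by apply/funext => y; rewrite !indicE; congr ((_ : bool)%:R%:E);
    apply/idP/idP; rewrite !inE.
rewrite H; apply: eq_integral => y _.
rewrite (_ : (fun x => _) = (fun x => (\1_[set x | A (x, y)] x)%:E)).
  rewrite integral_indic ?setIT//; exact: measurable_preimage (pair2_measurable y) mA.
by apply/funext => x; rewrite !indicE; congr ((_ : bool)%:R%:E);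
  apply/idP/idP; rewrite !inE.
Qed.

Section Uniqueness.
Variables (R : realType) (F : scalars R) (T : scalars_theory F).
Local Notation d := (rdim F).
Local Notation RT := (measurableTypeR R).
Variables (n m : nat) (mn : (m <= n)%N).
Local Notation G := (borelGr F mn).
Local Notation lamn := (@lebesgue_tuple R (n * n * d)).

Local Notation ball_GL := (@inj_ball R F T n n).

(** A random isometry, as t ranges over [inj_ball]. *)
Definition orth (t : (n * n * d).-tuple RT) : 'M[F]_n :=
  gram_schmidt T (mx_of T t : 'M[F]_n).

Lemma gram_schmidt_isometry (Y : 'M[F]_n) : mx_inj Y -> isometry_group (gram_schmidt T Y).
Proof.
move=> Yi; have [uu _] := gram_schmidtP T Yi; split => //.
have [v [vu uv]] := mx_inj_invertible (scal_unit T) (orthonormal_inj uu).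
suff -> : adjoint (gram_schmidt T Y) = v by [].
by rewrite -[LHS]mulmx1 -uv mulmxA uu mul1mx.
Qed.

Lemma mmeas_adjoint_orth : mmeas (fun t => adjoint (orth t)).
Proof.
apply: (mclass_adjoint T (measurable_class R _)).
by apply: measurable_gram_schmidt; exact: mmeas_mx_of.
Qed.

(** The probability, up to normalization, that the inverse of a random isometry
    moves E into S. *)
Definition haar_count (S : set G) (E : G) : \bar R :=
  lamn [set t | ball_GL t /\ S (act (adjoint (orth t)) E)].

Lemma measurable_orth_act d' (U : measurableType d') (f : U -> (n * n * d).-tuple RT)
    (g : U -> G) (S : set G) :
  measurable_fun setT f -> measurable_fun setT g -> measurable S ->
  measurable [set u | ball_GL (f u) /\ S (act (adjoint (orth (f u))) (g u))].
Proof.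
move=> mf mg mS; pose W := f @^-1` ball_GL.
have mW : measurable W by apply: measurable_preimage => //; exact: measurable_inj_ball.
suff mA : measurable_fun W (fun u => act (adjoint (orth (f u))) (g u) : G).
  exact: mA.
apply: (@measurability _ _ U G W _ (@Gr_open R F n m mn)) => //.
move=> _ [A /(Gr_openE T) Ao <-].
have mfo : mmeas (fun u => adjoint (orth (f u))).
  by move=> k; exact: (measurableT_comp (mmeas_adjoint_orth k) mf).
have := measurableI _ _ mW (measurable_act_joint mfo mg Ao).
congr measurable; apply/seteqP; split => u [Wu /=]; first by case.
move=> Au; split => //; split => //; apply: mx_injM; last exact: frame_inj.
by apply/isometry_inj/(isometry_adjoint T)/gram_schmidt_isometry; case: Wu.
Qed.

(** Isometries act transitively, say E' = w E. The substitution Y |-> w^* Y in the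
    random matrix Y replaces its orthonormalization u by w^* u, and the inverse of
    the latter applied to E is the inverse of u applied to E'. *)
Lemma haar_count_cst (S : set G) E E' : measurable S -> haar_count S E = haar_count S E'.
Proof.
move=> mS; have [ff _] := frameP T E; have [ff' _] := frameP T E'.
have [w wI E'wE] := isometry_transitive T mn ff ff'.
have wi := isometry_inj wI; have [ww _] := wI.
have aE : act w E = E' by rewrite /act -E'wE span_frame.
pose A (Y : 'M[F]_n) := (mx_inj Y /\ dot Y Y < 1) /\
  S (act (adjoint (gram_schmidt T Y)) E).
have ww' : adjoint (adjoint w) *m adjoint w = 1%:M by rewrite (adjointK T) wI.2.
have wi' := orthonormal_inj ww'.
transitivity (lamn [set t | A (adjoint w *m mx_of T t)]); last first.
  rewrite /haar_count; congr (lebesgue_tuple _); apply/seteqP.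
  have gsE (Y : 'M[F]_n) : mx_inj Y ->
      act (adjoint (gram_schmidt T (adjoint w *m Y))) E =
      act (adjoint (gram_schmidt T Y)) E'.
    move=> Yi; rewrite gram_schmidt_unitary// (adjointM T) (adjointK T) -aE actM//.
    exact/isometry_inj/(isometry_adjoint T)/gram_schmidt_isometry.
  have injE (Y : 'M[F]_n) : mx_inj (adjoint w *m Y) -> mx_inj Y.
    by move=> wYi x Yx; apply: wYi; rewrite -mulmxA Yx mulmx0.
  split => t; rewrite /A /inj_ball /orth /= dot_unitary// => -[[Yi Y1]].
    by rewrite gsE//; last exact: injE; move=> SE; split => //; split => //; exact: injE.
  by move=> SE; rewrite gsE//; split => //; split => //; exact: mx_injM.
rewrite (lebesgue_mull wi').
  rewrite /cmod lmod_adjoint (lmod_unitary T _ ww) expr1n invr1 mul1e.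
  by [].
exact: (@measurable_orth_act _ _ id (fun=> E)).
Qed.

(** Uniqueness of the invariant measure: any invariant law, here that of s on B,
    equals its average over random isometries, and by haar_count_cst that average
    does not see the law. The law is given by a map s in order to apply this both
    to the invariant measure of the Grassmannian and to spans of random frames. *)
Lemma haar_unique d' (U : measurableType d') (mu : {sigma_finite_measure set U -> \bar R})
    (s : U -> G) (B : set U) (S : set G) (E0 : G) :
  measurable_fun setT s -> measurable B ->
  (forall (u : 'M[F]_n) S', isometry_group u -> measurable S' ->
     mu [set x | B x /\ S' (act u (s x) : G)] = mu [set x | B x /\ S' (s x)]) ->
  measurable S ->
  (lamn ball_GL * mu [set x | B x /\ S (s x)] = haar_count S E0 * mu B)%E.
Proof.
move=> ms mB inv mS.
pose A := [set p : U * (n * n * d).-tuple RT | B p.1 /\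
  (ball_GL p.2 /\ S (act (adjoint (orth p.2)) (s p.1)))].
have mA : measurable A.
  apply: (@measurableI _ _ (fst @^-1` B)); first exact: measurable_preimage.
  apply: measurable_orth_act => //; exact: measurableT_comp.
have := tonelli_set mu lamn mA.
have -> : (\int[mu]_x lamn [set t | A (x, t)] = haar_count S E0 * mu B)%E.
  rewrite -[in RHS](setIT B) -integral_indic// -ge0_integralZl//; last first.
    by apply/measurable_EFinP; exact: measurable_indic.
  apply: eq_integral => x _; have [Bx|Bx] := pselect (B x).
    rewrite indicE mem_set// mule1 (haar_count_cst _ (s x) mS).
    by congr (lebesgue_tuple _); apply/seteqP; split => t; [case|].
  rewrite indicE memNset// mule0 -(measure0 lamn); congr (lebesgue_tuple _).
  by apply/seteqP; split => // t [].
move=> ->; have mW := @measurable_inj_ball R F T n n.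
have -> : lamn ball_GL = (\int[lamn]_t (\1_ball_GL t)%:E)%E.
  by rewrite integral_indic// setIT.
rewrite muleC.
rewrite -ge0_integralZl//; last first.
  by apply/measurable_EFinP; exact: measurable_indic.
apply: eq_integral => t _; have [Wt|Wt] := pselect (ball_GL t).
  rewrite indicE mem_set// mule1 -(inv (adjoint (orth t)))//.
    by congr (mu _); apply/seteqP; split => x /=; rewrite /A /=; tauto.
  by apply/(isometry_adjoint T)/gram_schmidt_isometry; case: Wt.
rewrite indicE memNset// mule0 -(measure0 mu); congr (mu _).
by apply/seteqP; split => // x [_ []].
Qed.

End Uniqueness.

(** * Auxiliary measurable functions *)
Import HBNNSimple.

Lemma ge0_integral_mrestr d (U : measurableType d) (R : realType)
    (mu : {measure set U -> \bar R}) (D : set U) (mD : measurable D)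
    (f : U -> \bar R) :
  measurable_fun [set: U] f -> (forall x, 0 <= f x)%E ->
  (\int[mrestr mu mD]_x f x = \int[mu]_(x in D) f x)%E.
Proof.
move=> mf f0; pose f_ := nnsfun_approx measurableT mf.
have fl x : limn (fun n => (f_ n x)%:E) = f x.
  by apply/cvg_lim => //; apply: cvg_nnsfun_approx.
transitivity (limn (fun n => \int[mrestr mu mD]_x (f_ n x)%:E))%E.
  rewrite -monotone_convergence//.
  - by apply: eq_integral => x _; rewrite fl.
  - by move=> n; exact/measurable_EFinP/measurable_funP.
  - by move=> n x _; rewrite lee_fin.
  - by move=> x _ a b ab; rewrite lee_fin; exact/lefP/nd_nnsfun_approx.
transitivity (limn (fun n => \int[mu]_(x in D) (f_ n x)%:E))%E.
  congr (limn _); apply/funext => n.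
  rewrite integralT_nnsfun integral_nnsfun//; apply: eq_fsbigr => r _.
  have [->|r0] := eqVneq r 0; first by rewrite !mul0e.
  congr (_ * mu _)%E; apply/seteqP; split => x; rewrite /= /patch.
    by move=> [hx Dx]; rewrite mem_set.
  by case: ifPn => [/set_mem//|_ /esym/eqP]; rewrite (negPf r0).
rewrite -monotone_convergence//.
- by apply: eq_integral => x _; rewrite fl.
- by move=> n; apply/measurable_EFinP/measurable_funTS/measurable_funP.
- by move=> n x _; rewrite lee_fin.
- by move=> x _ a b ab; rewrite lee_fin; exact/lefP/nd_nnsfun_approx.
Qed.

Section RealFunctions.
Variables (R : realType) (d : measure_display) (U : measurableType d).
Implicit Types f : U -> R.

Lemma measurable_inv f : measurable_fun setT f -> (forall x, 0 <= f x) ->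
  measurable_fun setT (fun x => (f x)^-1).
Proof.
move=> mf f0; rewrite (_ : (fun _ => _) = (fun y : R => y `^ (-1)) \o f).
  by apply: measurableT_comp => //; exact: measurable_powR.
by apply/funext => x /=; rewrite powR_inv1.
Qed.

Lemma measurable_inv_real f : measurable_fun setT f ->
  measurable_fun setT (fun x => (f x)^-1).
Proof.
move=> mf; rewrite (_ : (fun _ => _) = (fun x => f x * (f x ^+ 2)^-1)).
  apply: measurable_funM => //; apply: measurable_inv.
    exact: measurable_funX.
  by move=> x; exact: sqr_ge0.
apply/funext => x; have [->|fx0] := eqVneq (f x) 0; first by rewrite invr0 mul0r.
by rewrite expr2 invfM mulrA mulfV// mul1r.
Qed.

Definition below1 (x : R) : R := ((x < 1)%R : bool)%:R.

Lemma below1_ge0 x : 0 <= below1 x.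
Proof. exact: ler0n. Qed.

Lemma measurable_below1 f : measurable_fun setT f ->
  measurable_fun setT (fun x => below1 (f x)).
Proof.
move=> mf; rewrite (_ : (fun _ => _) = (\1_(`]-oo, 1[%classic : set R) : R -> R) \o f).
  by apply: measurableT_comp => //; exact: measurable_indic.
apply/funext => x /=; rewrite indicE /below1; congr ((_ : bool)%:R).
by apply/idP/idP; rewrite inE /= in_itv.
Qed.

End RealFunctions.

(** ** The inverse matrix as a measurable function *)
Section MatrixInverse.
Variables (R : realType) (F : scalars R) (T : scalars_theory F) (m : nat).

(** The inverse of r, read off from the real matrix of the multiplication by r.
    Cramer's rule for that matrix shows that it depends measurably on r. *)
Definition minv (r : 'M[F]_m) : 'M[F]_m :=
  let L := rmat T (mulmx r : 'M[F]_(m, m) -> 'M[F]_(m, m)) in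
  unrealify T (realify (1%:M : 'M[F]_m) *m ((\det L)^-1 *: \adj L)).

Lemma minvP (r : 'M[F]_m) : mx_inj r -> r *m minv r = 1%:M /\ minv r *m r = 1%:M.
Proof.
move=> ri; have [s [sr rs]] := mx_inj_invertible (scal_unit T) ri.
suff -> : minv r = s by [].
apply: (realify_inj T); rewrite /minv (unrealifyK T).
set L := rmat T _.
have L0 : \det L != 0.
  rewrite -normr_eq0 -/(lmod T m r) gt_eqF// lmod_cmod// exprn_gt0//.
  exact: cmod_gt0.
have -> : realify (1%:M : 'M[F]_m) = realify s *m L.
  by rewrite -(rmatE (rlinear_mull T _ _)) rs.
by rewrite -mulmxA -scalemxAr mul_mx_adj scale_scalar_mx mulVf// mulmx1.
Qed.

Lemma mmeas_minv d' (U : measurableType d') (f : U -> 'M[F]_m) :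
  mmeas f -> mmeas (fun u => minv (f u)).
Proof.
move=> mf k; have HC := measurable_class R U.
pose L u := rmat T (mulmx (f u) : 'M[F]_(m, m) -> 'M[F]_(m, m)).
have mL i j : measurable_fun setT (fun u => L u i j).
  under [fun _ => _]funext do rewrite mxE.
  by apply: (mclassM T HC) => //; exact: mclass_cst.
rewrite (_ : (fun _ => _) = (fun u => \sum_l realify (1%:M : 'M[F]_m) 0 l *
    ((\det (L u))^-1 * cofactor (L u) k l))); last first.
  by apply/funext => u; rewrite (unrealifyK T) mxE; apply: eq_bigr => l _; rewrite !mxE.
apply: (class_sum HC) => l; apply: (classM HC); first exact: measurable_cst.
apply: (classM HC).
  by apply: measurable_inv_real; exact: (class_det HC).
apply: (classM HC); first exact: measurable_cst.
apply: (class_det HC) => i j; under [fun _ => _]funext do rewrite !mxE.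
by rewrite (_ : (fun _ => _) = (fun u => L u (lift k i) (lift l j)));
  [exact: mL|apply/funext => u; rewrite mxE].
Qed.

End MatrixInverse.

(** * Weights on frames *)
Section Measurability.
Variables (R : realType) (F : scalars R) (T : scalars_theory F).
Variables (d' : measure_display) (U : measurableType d').

Lemma mmeas_cst p q (A : 'M[F]_(p, q)) : mmeas (fun _ : U => A).
Proof. by apply: mclass_cst; exact: measurable_class. Qed.

Lemma mmeasM p q r (f : U -> 'M[F]_(p, q)) (g : U -> 'M[F]_(q, r)) :
  mmeas f -> mmeas g -> mmeas (fun u => f u *m g u).
Proof. exact: (mclassM T (measurable_class R U)). Qed.

Lemma mmeas_cmod p (f : U -> 'M[F]_p) :
  mmeas f -> measurable_fun setT (fun u => cmod T (f u)).
Proof. exact: (class_lmod T (measurable_class R U)). Qed.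

End Measurability.

Ltac mmeas_auto T :=
  lazymatch goal with
  | |- mmeas (fun u => @?f u *m @?g u) =>
      apply: (mmeasM T); mmeas_auto T
  | |- mmeas (fun u => minv T (@?f u)) => apply: mmeas_minv; mmeas_auto T
  | |- mmeas (fun u => mx_of T u) => exact: mmeas_mx_of
  | |- mmeas (@mx_of _ _ T _ _) => exact: mmeas_mx_of
  | |- mmeas (fun u => ?A) => exact: mmeas_cst
  | |- _ => assumption
  end.

Ltac mreal_auto T :=
  lazymatch goal with
  | |- measurable_fun _ (fun u => (@?f u * @?g u)%R) =>
      apply: measurable_funM; mreal_auto T
  | |- measurable_fun _ (fun u => (@?f u ^+ _)%R) =>
      apply: measurable_funX; mreal_auto T
  | |- measurable_fun _ (fun u => (@?f u)^-1%R) =>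
      apply: measurable_inv_real; mreal_auto T
  | |- measurable_fun _ (fun u => below1 (@?f u)) =>
      apply: measurable_below1; mreal_auto T
  | |- measurable_fun _ (fun u => vol T (@?f u)) =>
      apply: mmeas_vol; mmeas_auto T
  | |- measurable_fun _ (fun u => cmod T (@?f u)) =>
      apply: mmeas_cmod; mmeas_auto T
  | |- measurable_fun _ (fun u => dot (@?f u) _) =>
      apply: mmeas_dot; mmeas_auto T
  end.

Section Density.
Variables (R : realType) (F : scalars R) (T : scalars_theory F).
Local Notation d := (rdim F).
Local Notation RT := (measurableTypeR R).
Variables (n m : nat) (m_gt0 : (0 < m)%N) (mn : (m <= n)%N).
Local Notation G := (borelGr F mn).
Local Notation lamX := (@lebesgue_tuple R (n * m * d)).
Local Notation lamr := (@lebesgue_tuple R (m * m * d)).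
Local Notation mxX := (@mx_of R F T n m).
Local Notation mxr := (@mx_of R F T m m).
Local Notation span := (@colspan R F n m mn).
Local Notation vol := (vol T).
Local Notation cmod := (cmod T).
Local Notation ball p q := (@inj_ball R F T p q).

Let n_gt0 : (0 < n)%N := leq_trans m_gt0 mn.

Lemma vol_eq0 p q (X : 'M[F]_(p, q)) : ~ mx_inj X -> vol X = 0.
Proof.
by move=> Xi; apply/eqP; rewrite eq_le vol_ge0 andbT leNgt; apply/negP => /(vol_gt0 T)/Xi.
Qed.

Lemma cmod_eq0 p (r : 'M[F]_p) : ~ mx_inj r -> cmod r = 0.
Proof.
by move=> ri; apply/eqP/negP => /negP /cmod_neq0_inj/ri.
Qed.

(** The quotient equals 1 on frames, and is 0 by convention on other matrices. *)
Lemma indic_ball p q t : (0 < p)%N -> (0 < q)%N ->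
  \1_(ball p q) t = below1 (dot (mx_of T t : 'M[F]_(p, q)) (mx_of T t)) *
    (vol (mx_of T t : 'M[F]_(p, q)) ^+ p * (vol (mx_of T t : 'M[F]_(p, q)) ^+ p)^-1).
Proof.
move=> p0 q0; rewrite indicE; set X := mx_of T t.
have [Xi|Xi] := pselect (mx_inj X); last first.
  rewrite (vol_eq0 Xi) expr0n gtn_eqF//= mul0r mulr0 memNset//.
  by rewrite /inj_ball /= => -[].
rewrite mulfV ?mulr1; last by rewrite expf_neq0// gt_eqF//; apply/vol_gt0.
rewrite /below1; congr ((_ : bool)%:R); apply/idP/idP; rewrite inE /inj_ball /=.
  by case.
by [].
Qed.

Section Weights.
Variables (g : G -> \bar R).
Hypotheses (mg : measurable_fun setT g) (g0 : forall E, (0 <= g E)%E).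

(** The density of phi(hX) vol(X)^-n dX, where phi(Y) is vol(Y)^n on the unit ball
    and 0 outside, and the measure vol(X)^-n dX is invariant under X |-> X r for r in
    GL_m. For h = 1 the average below is an integral over the unit ball. *)
Definition wt (h : 'M[F]_n) (X : 'M[F]_(n, m)) : R :=
  below1 (dot (h *m X) (h *m X)) * (vol (h *m X) ^+ n * (vol X ^+ n)^-1).

Definition frame_avg (h : 'M[F]_n) : \bar R :=
  (\int[lamX]_t (g (span (mxX t)) * (wt h (mxX t))%:E))%E.

(** The density |r|^-m of the invariant measure of GL_m times a function of the
    frame X r. Its integral over r does not depend on X. *)
Definition wt1 (X : 'M[F]_(n, m)) (r : 'M[F]_m) : R :=
  below1 (dot (X *m r) (X *m r)) * (vol (X *m r) ^+ m * (cmod r ^+ m)^-1).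

(** phi(Y r^-1) times the density of the invariant measure of GL_m. *)
Definition wt2 (Y : 'M[F]_(n, m)) (r : 'M[F]_m) : R :=
  below1 (dot (Y *m minv T r) (Y *m minv T r)) *
    (vol (Y *m minv T r) ^+ n * (cmod r ^+ m)^-1).

(** What remains of [wt h] and [wt1], apart from [wt2], when X r^-1 is substituted
    for X. *)
Definition wt3 (X : 'M[F]_(n, m)) : R :=
  below1 (dot X X) * (vol X ^+ m * (vol X ^+ n)^-1).

Lemma wt_ge0 h X : 0 <= wt h X.
Proof. by rewrite /wt !mulr_ge0 ?below1_ge0 ?invr_ge0 ?exprn_ge0 ?vol_ge0. Qed.

Lemma wt1_ge0 X r : 0 <= wt1 X r.
Proof. by rewrite /wt1 !mulr_ge0 ?below1_ge0 ?invr_ge0 ?exprn_ge0 ?vol_ge0 ?lmod_ge0. Qed.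

Lemma wt2_ge0 X r : 0 <= wt2 X r.
Proof. by rewrite /wt2 !mulr_ge0 ?below1_ge0 ?invr_ge0 ?exprn_ge0 ?vol_ge0 ?lmod_ge0. Qed.

Lemma wt3_ge0 X : 0 <= wt3 X.
Proof. by rewrite /wt3 !mulr_ge0 ?below1_ge0 ?invr_ge0 ?exprn_ge0 ?vol_ge0. Qed.

Section WeightMeasurability.
Variables (d' : measure_display) (U : measurableType d').
Variables (h : 'M[F]_n) (X : U -> 'M[F]_(n, m)) (r : U -> 'M[F]_m).
Hypotheses (mX : mmeas X) (mr : mmeas r).

Lemma measurable_g_span : measurable_fun setT (fun u => g (span (X u))).
Proof. exact: (measurableT_comp mg (measurable_span T (mn := mn) mX)). Qed.

Lemma measurable_wt : measurable_fun setT (fun u => wt h (X u)).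
Proof. rewrite /wt; mreal_auto T. Qed.

Lemma measurable_wt1 : measurable_fun setT (fun u => wt1 (X u) (r u)).
Proof. rewrite /wt1; mreal_auto T. Qed.

Lemma measurable_wt2 : measurable_fun setT (fun u => wt2 (h *m X u) (r u)).
Proof. rewrite /wt2; mreal_auto T. Qed.

Lemma measurable_wt3 : measurable_fun setT (fun u => wt3 (X u)).
Proof. rewrite /wt3; mreal_auto T. Qed.

End WeightMeasurability.

(** If X = q p with q orthonormal, then the integrand is |r|^-m times a function of
    p r, and the measure |r|^-m dr is invariant under left multiplications. *)
Lemma integral_wt1 X : mx_inj X ->
  (\int[lamr]_t (wt1 X (mxr t))%:E = lamr (ball m m))%E.
Proof.
move=> Xi; have [q [qq [S [p [_ XE _ _]]]]] := orthonormal_basis T Xi.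
have pi : mx_inj p by move=> x px; apply: Xi; rewrite XE -mulmxA px mulmx0.
have volX : vol X = cmod p by rewrite XE volM vol_orthonormal// mul1r.
have p0 : cmod p ^+ m != 0 by rewrite expf_neq0// gt_eqF// cmod_gt0.
have mB := @measurable_inj_ball R F T m m.
transitivity (\int[lamr]_t ((cmod p ^+ m)%:E *
    (\1_[set r : 'M[F]_m | mx_inj r /\ dot r r < 1] (p *m mxr t))%:E))%E.
  apply: eq_integral => t _; rewrite -EFinM; congr EFin.
  rewrite /wt1 volM volX exprMn {1 2}XE -(mulmxA q) dot_unitary//.
  set r := mxr t; rewrite indicE.
  have [ri|ri] := pselect (mx_inj r); last first.
    rewrite memNset ?mulr0//=.
      by rewrite (cmod_eq0 ri) expr0n gtn_eqF//= mulr0 mul0r mulr0.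
    by move=> [pri _]; apply: ri => x rx; apply: pri; rewrite -mulmxA rx mulmx0.
  rewrite -mulrA mulfV ?mulr1; last by rewrite expf_neq0// gt_eqF// cmod_gt0.
  rewrite mulrC /below1; congr (_ * (_ : bool)%:R); apply/idP/idP; rewrite inE /=.
    by move=> pr; split => //; exact: mx_injM.
  by case.
have ballE t : \1_[set r : 'M[F]_m | mx_inj r /\ dot r r < 1] (mxr t) =
    \1_(ball m m) t :> R.
  by rewrite !indicE; congr ((_ : bool)%:R); apply/idP/idP; rewrite !inE.
have m1 : measurable_fun setT ((EFin \o
    (\1_[set r : 'M[F]_m | mx_inj r /\ dot r r < 1] : _ -> R)) \o mxr).
  under [_ \o _]funext do rewrite /= ballE.
  by apply/measurable_EFinP; exact: measurable_indic.
have m2 : measurable_fun setT (fun t => (\1_[set r : 'M[F]_m | mx_inj r /\ dot r r < 1]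
    (p *m mxr t) : R)%:E).
  have mm : mmeas (fun t => p *m mxr t) by mmeas_auto T.
  have := measurableT_comp m1 (mmeas_tuple mm).
  by congr measurable_fun; apply/funext => t /=; rewrite tuple_of_mxK.
rewrite ge0_integralZl//; last by rewrite lee_fin exprn_ge0// lmod_ge0.
rewrite (integral_mull pi m1); last by move=> A; rewrite lee_fin.
rewrite muleA -EFinM mulfV// mul1e.
transitivity (\int[lamr]_t (\1_(ball m m) t)%:E)%E; last first.
  by rewrite integral_indic// setIT.
by apply: eq_integral => t _ /=; rewrite ballE.
Qed.

(** If Y = q p with q orthonormal, then the integrand is |r|^-m times a function of
    p r^-1 = (r p^-1)^-1, and the measure |r|^-m dr is invariant under right
    multiplications. *)
Lemma integral_wt2 Y Y' : mx_inj Y -> mx_inj Y' ->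
  (\int[lamr]_t (wt2 Y (mxr t))%:E = \int[lamr]_t (wt2 Y' (mxr t))%:E)%E.
Proof.
pose chi (r : 'M[F]_m) : R := below1 (dot (minv T r) (minv T r)) *
  (cmod (minv T r) ^+ n * (cmod r ^+ m)^-1).
suff H Z : mx_inj Z -> (\int[lamr]_t (wt2 Z (mxr t))%:E = \int[lamr]_t (chi (mxr t))%:E)%E.
  by move=> Yi Y'i; apply: (etrans (H _ Yi)); apply/esym; exact: H.
move=> Zi; have [q [qq [S [p [_ ZE _ _]]]]] := orthonormal_basis T Zi.
have pi : mx_inj p by move=> x px; apply: Zi; rewrite ZE -mulmxA px mulmx0.
have [s [sp ps]] := mx_inj_invertible (scal_unit T) pi.
have si : mx_inj s.
  by move=> x sx; rewrite -[x]mul1mx -ps -mulmxA sx mulmx0.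
have s0 : cmod s ^+ m != 0 by rewrite expf_neq0// gt_eqF// cmod_gt0.
transitivity (\int[lamr]_t ((cmod s ^+ m)%:E * (chi (mxr t *m s))%:E))%E.
  apply: eq_integral => t _; rewrite -EFinM; congr EFin; set r := mxr t.
  have [ri|ri] := pselect (mx_inj r); last first.
    have rsi : ~ mx_inj (r *m s).
      move=> rsi; apply: ri => x rx; suff : p *m x = 0 by exact: pi.
      by apply: rsi; rewrite -mulmxA (mulmxA s) sp mul1mx.
    rewrite /wt2 /chi (cmod_eq0 ri) (cmod_eq0 rsi).
    by rewrite expr0n gtn_eqF//= invr0 !mulr0.
  rewrite /wt2 /chi; have -> : minv T (r *m s) = p *m minv T r.
    have [_ h2] := minvP T (mx_injM ri si); have [k1 _] := minvP T ri.
    have e : (r *m s) *m (p *m minv T r) = 1%:M.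
      by rewrite mulmxA -(mulmxA r) sp mulmx1.
    by rewrite -[LHS]mulmx1 -e mulmxA h2 mul1mx.
  rewrite ZE -(mulmxA q) dot_unitary// volM vol_orthonormal// mul1r.
  have -> : cmod (r *m s) = cmod r * cmod s by exact: lmodM.
  rewrite exprMn invfM; move: s0; set a := cmod s ^+ m => a0.
  set b := below1 _; set v := _ ^+ n; set c := (cmod r ^+ m)^-1.
  by transitivity (a * a^-1 * (b * (v * c))); [rewrite mulfV// mul1r|ring].
have mchi : measurable_fun setT (EFin \o chi \o mxr).
  apply/measurable_EFinP; rewrite /chi /comp.
  by mreal_auto T.
have chi0 r : 0 <= chi r.
  by rewrite /chi !mulr_ge0 ?below1_ge0 ?invr_ge0 ?exprn_ge0 ?lmod_ge0.
rewrite ge0_integralZl//; first last.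
- by rewrite lee_fin exprn_ge0// lmod_ge0.
- by move=> t _; rewrite lee_fin.
- apply/measurable_EFinP; rewrite /chi; mreal_auto T.
rewrite (integral_mulr (b := s) (f := EFin \o chi) si mchi).
  by rewrite muleA -EFinM mulfV// mul1e.
by move=> A; rewrite lee_fin.
Qed.

End Weights.
End Density.

(** * Averages over frames *)
Lemma mule_cancel (R : realType) (c a b : \bar R) :
  (0 < c)%E -> (c < +oo)%E -> (c * a = c * b)%E -> a = b.
Proof.
case: c => // c; rewrite lte_fin => c0 _ /(congr1 (mule (c^-1)%:E)).
by rewrite !muleA -!EFinM mulVf ?gt_eqF// !mul1e.
Qed.

Section FrameAverage.
Variables (R : realType) (F : scalars R) (T : scalars_theory F).
Local Notation d := (rdim F).
Local Notation RT := (measurableTypeR R).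
Variables (n m : nat) (m_gt0 : (0 < m)%N) (mn : (m <= n)%N).
Local Notation G := (borelGr F mn).
Local Notation lamX := (@lebesgue_tuple R (n * m * d)).
Local Notation lamr := (@lebesgue_tuple R (m * m * d)).
Local Notation mxX := (@mx_of R F T n m).
Local Notation mxr := (@mx_of R F T m m).
Local Notation span := (@colspan R F n m mn).
Local Notation ball p q := (@inj_ball R F T p q).
Variables (g : G -> \bar R).
Hypotheses (mg : measurable_fun setT g) (g0 : forall E, (0 <= g E)%E).

Let n_gt0 : (0 < n)%N := leq_trans m_gt0 mn.

Lemma wt_eq0 h (X : 'M[F]_(n, m)) : ~ mx_inj X -> wt T h X = 0.
Proof.
by move=> Xi; rewrite /wt [X in (X ^+ _)^-1](vol_eq0 T Xi) expr0n gtn_eqF//= invr0 !mulr0.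
Qed.

Lemma wt3_eq0 (X : 'M[F]_(n, m)) : ~ mx_inj X -> wt3 T X = 0.
Proof.
by move=> Xi; rewrite /wt3 [X in (X ^+ n)^-1](vol_eq0 T Xi) expr0n gtn_eqF//= invr0 !mulr0.
Qed.

Lemma frame_avg_wt1 (h : 'M[F]_n) :
  (\int[lamX]_t \int[lamr]_s
     (g (span (mxX t)) * (wt T h (mxX t) * wt1 T (mxX t) (mxr s))%:E) =
   lamr (ball m m) * frame_avg T g h)%E.
Proof.
rewrite /frame_avg -ge0_integralZl//; first last.
- by move=> t _; rewrite mule_ge0// lee_fin wt_ge0.
- apply: emeasurable_funM; first by apply: (measurable_g_span T mg); exact: mmeas_mx_of.
  by apply/measurable_EFinP; apply: measurable_wt; exact: mmeas_mx_of.
apply: eq_integral => t _; set X := mxX t.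
have [Xi|Xi] := pselect (mx_inj X); last first.
  rewrite (wt_eq0 _ Xi) mule0 mule0; apply: integral0_eq => s _.
  by rewrite mul0r mule0.
rewrite muleC -(integral_wt1 T m_gt0 Xi) -ge0_integralZl//; first last.
- by rewrite mule_ge0// lee_fin wt_ge0.
- by move=> s _; rewrite lee_fin wt1_ge0.
- apply/measurable_EFinP; apply: (@measurable_wt1 _ _ T _ _ _ _ (fun=> X)).
    exact: mmeas_cst.
  exact: mmeas_mx_of.
by apply: eq_integral => s _; rewrite EFinM muleA.
Qed.

Lemma frame_avg_wt2 (h : 'M[F]_n) (Y : 'M[F]_(n, m)) : mx_inj h -> mx_inj Y ->
  (\int[lamX]_t \int[lamr]_s
     (g (span (mxX t)) * (wt3 T (mxX t) * wt2 T (h *m mxX t) (mxr s))%:E) =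
   \int[lamX]_t ((g (span (mxX t)) * (wt3 T (mxX t))%:E) *
     \int[lamr]_s (wt2 T Y (mxr s))%:E))%E.
Proof.
move=> hi Yi; apply: eq_integral => t _; set X := mxX t.
have [Xi|Xi] := pselect (mx_inj X); last first.
  rewrite (wt3_eq0 Xi) mule0 mul0e; apply: integral0_eq => s _.
  by rewrite mul0r mule0.
rewrite -(integral_wt2 T m_gt0 (mx_injM hi Xi) Yi) -ge0_integralZl//; first last.
- by rewrite mule_ge0// lee_fin wt3_ge0.
- by move=> s _; rewrite lee_fin wt2_ge0.
- apply/measurable_EFinP; apply: (@measurable_wt2 _ _ T _ _ _ _ h (fun=> X)).
    exact: mmeas_cst.
  exact: mmeas_mx_of.
by apply: eq_integral => s _; rewrite EFinM muleA.
Qed.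

(** The change of variables X |-> X r^-1 preserves the span of X and the measure
    vol(X)^-n dX; it moves r from the second factor of the weight to the first. *)
Lemma frame_avg_exchange (h : 'M[F]_n) (r : 'M[F]_m) :
  (\int[lamX]_t (g (span (mxX t)) * (wt T h (mxX t) * wt1 T (mxX t) r)%:E) =
   \int[lamX]_t (g (span (mxX t)) * (wt3 T (mxX t) * wt2 T (h *m mxX t) r)%:E))%E.
Proof.
have [ri|ri] := pselect (mx_inj r); last first.
  apply: eq_integral => t _.
  by rewrite /wt1 /wt2 (cmod_eq0 T ri) expr0n (gtn_eqF m_gt0)/= invr0 !mulr0.
have r0 : cmod T r != 0 by rewrite gt_eqF// cmod_gt0.
pose H (X : 'M[F]_(n, m)) : \bar R := (g (span X) *
  (cmod T r ^+ n * (wt3 T X * wt2 T (h *m X) r))%:E)%E.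
have mH : measurable_fun setT (H \o mxX).
  apply: emeasurable_funM; first by apply: (measurable_g_span T mg); exact: mmeas_mx_of.
  apply/measurable_EFinP; apply: measurable_funM; first exact: measurable_cst.
  apply: measurable_funM; first by apply: measurable_wt3; exact: mmeas_mx_of.
  apply: (@measurable_wt2 _ _ T _ _ _ _ h mxX (fun=> r)); first exact: mmeas_mx_of.
  exact: mmeas_cst.
have H0 X : (0 <= H X)%E.
  rewrite /H mule_ge0// lee_fin mulr_ge0//; first by rewrite exprn_ge0// lmod_ge0.
  by rewrite mulr_ge0// ?wt3_ge0 ?wt2_ge0.
transitivity (\int[lamX]_t H (mxX t *m r))%E.
  apply: eq_integral => t _; set X := mxX t.
  have [Xi|Xi] := pselect (mx_inj X); last first.
    have Xri : ~ mx_inj (X *m r).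
      have [s [sr rs]] := mx_inj_invertible (scal_unit T) ri.
      move=> Xri; apply: Xi => x Xx; have si : mx_inj s.
        by move=> y sy; rewrite -[y]mul1mx -rs -mulmxA sy mulmx0.
      by apply: si; apply: Xri; rewrite -mulmxA (mulmxA r) rs mul1mx.
    by rewrite (wt_eq0 _ Xi) /H (wt3_eq0 Xri) !mul0r mulr0 !mule0.
  rewrite /H (spanMr T mn Xi ri); congr (_ * _%:E)%E.
  have [rs sr] := minvP T ri.
  rewrite /wt /wt1 /wt3 /wt2 -!mulmxA rs mulmx1 !volM !exprMn !invfM.
  have cn0 : cmod T r ^+ n != 0 by rewrite expf_neq0.
  move: cn0; set b := below1 _; set b' := below1 _; set c := cmod T r ^+ n => cn0.
  set v := vol T (h *m X) ^+ n; set x := (vol T X ^+ n)^-1.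
  set y := vol T X ^+ m; set z := cmod T r ^+ m.
  transitivity (c * c^-1 * (b * (v * x) * (b' * (y * z * z^-1)))).
    by rewrite mulfV// mul1r.
  by ring.
rewrite (integral_mulr ri mH)// -ge0_integralZl//; last first.
  by rewrite lee_fin invr_ge0 exprn_ge0// lmod_ge0.
apply: eq_integral => t _; rewrite /H muleCA -EFinM; congr (_ * _%:E)%E.
by rewrite mulKf// expf_neq0.
Qed.

(** On the fibre of frames with a given span, which is an orbit of GL_m, the
    integral of phi(hX) is a mean of phi over an orbit of frames hX r. It is the
    same for all orbits, since isometries permute the orbits transitively and
    preserve phi. The auxiliary variable r of [wt1] and [wt2] makes this
    disintegration explicit as an application of Fubini. *)
Lemma frame_avg_indep (h : 'M[F]_n) : mx_inj h ->
  frame_avg T g h = frame_avg T g 1%:M.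
Proof.
have E0 : Gr F mn := point.
pose K := (\int[lamX]_t ((g (span (mxX t)) * (wt3 T (mxX t))%:E) *
     \int[lamr]_s (wt2 T (frame E0) (mxr s))%:E))%E.
suff H k : mx_inj k -> (lamr (ball m m) * frame_avg T g k = K)%E.
  move=> hi; apply: (@mule_cancel _ (lamr (ball m m))).
  - exact: lebesgue_inj_ball_gt0.
  - exact: lebesgue_inj_ball_lty.
  apply: (etrans (H _ hi)); apply/esym/H => x.
  by rewrite mul1mx.
move=> ki; rewrite -frame_avg_wt1 /K -(frame_avg_wt2 ki (@frame_inj R F T n m mn E0)).
have m1 : mmeas (fun u : (n * m * d).-tuple RT * (m * m * d).-tuple RT => mxX u.1).
  by move=> l; exact: (measurableT_comp (mmeas_mx_of T l) measurable_fst).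
have m2 : mmeas (fun u : (n * m * d).-tuple RT * (m * m * d).-tuple RT => mxr u.2).
  by move=> l; exact: (measurableT_comp (mmeas_mx_of T l) measurable_snd).
have mgs := measurable_g_span T mg m1.
have swap1 := @tonelli _ _ _ _ R lamX lamr (fun t s =>
  g (span (mxX t)) * (wt T k (mxX t) * wt1 T (mxX t) (mxr s))%:E)%E.
rewrite swap1; last 2 first.
- apply: emeasurable_funM => //; apply/measurable_EFinP.
  by apply: measurable_funM; [exact: measurable_wt|exact: measurable_wt1].
- move=> t s; apply: mule_ge0; first exact: g0.
  by rewrite lee_fin; apply: mulr_ge0; [exact: wt_ge0|exact: wt1_ge0].
have swap2 := @tonelli _ _ _ _ R lamX lamr (fun t s =>
  g (span (mxX t)) * (wt3 T (mxX t) * wt2 T (k *m mxX t) (mxr s))%:E)%E.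
rewrite swap2; last 2 first.
- apply: emeasurable_funM => //; apply/measurable_EFinP.
  by apply: measurable_funM; [exact: measurable_wt3|exact: measurable_wt2].
- move=> t s; apply: mule_ge0; first exact: g0.
  by rewrite lee_fin; apply: mulr_ge0; [exact: wt3_ge0|exact: wt2_ge0].
by apply: eq_integral => s _; exact: frame_avg_exchange.
Qed.

End FrameAverage.

(** * The invariant measure under a linear map *)
Section HaarDensity.
Variables (R : realType) (F : scalars R) (T : scalars_theory F).
Local Notation d := (rdim F).
Local Notation RT := (measurableTypeR R).
Variables (n m : nat) (m_gt0 : (0 < m)%N) (mn : (m <= n)%N).
Local Notation G := (borelGr F mn).
Local Notation lamX := (@lebesgue_tuple R (n * m * d)).
Local Notation mxX := (@mx_of R F T n m).
Local Notation span := (@colspan R F n m mn).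
Local Notation ball p q := (@inj_ball R F T p q).
Variable mu : probability G R.
Hypothesis mu_Haar : is_Haar mu.

Let n_gt0 : (0 < n)%N := leq_trans m_gt0 mn.

(** The image of S under the inverse isometry is its preimage under u. *)
Lemma haar_act (u : 'M[F]_n) (S : set G) : isometry_group u -> measurable S ->
  mu ((act u : G -> G) @^-1` S) = mu S.
Proof.
move=> uI mS; have vI := isometry_adjoint T uI.
rewrite -(mu_Haar vI mS); congr (mu _); apply/seteqP; split => E /=.
  move=> SE; exists (act u E) => //; rewrite (space_act T)//; last exact: isometry_inj.
  apply/seteqP; split => x.
    by move=> Ex; exists (u *m x); [exists x|rewrite mulmxA uI.1 mul1mx].
  by move=> [_ [y Ey <-] <-]; rewrite mulmxA uI.1 mul1mx.
move=> [E' SE' EE']; suff -> : act u E = E' by [].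
apply: Gr_eq; rewrite (space_act T); last exact: isometry_inj.
rewrite EE'; apply/seteqP; split => x.
  by move=> [_ [y Ey <-] <-]; rewrite mulmxA uI.2 mul1mx.
by move=> Ex; exists (adjoint u *m x); [exists x|rewrite mulmxA uI.2 mul1mx].
Qed.

(** Isometries preserve the unit ball and Lebesgue measure, so the law of the span
    of a random frame in the unit ball is invariant, and uniqueness applies. *)
Lemma haar_law (S : set G) : measurable S ->
  lamX [set t | ball n m t /\ S (span (mxX t))] = (lamX (ball n m) * mu S)%E.
Proof.
move=> mS; pose E0 : G := point.
have mid : measurable_fun [set: G] (@id G) by [].
have h1 := @haar_unique R F T n m mn _ G mu id setT S E0 mid measurableT.
have {}h1 : (lebesgue_tuple (ball n n) * mu S = haar_count T S E0)%E.
  have -> : haar_count T S E0 = (haar_count T S E0 * mu setT)%E.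
    by rewrite probability_setT mule1.
  rewrite -h1//.
    by congr (_ * mu _)%E; apply/seteqP; split => E //= [].
  move=> u S' uI mS'; rewrite [RHS](_ : _ = mu S').
    rewrite -(haar_act uI mS'); congr (mu _); apply/seteqP; split => E //=.
    by case.
  by congr (mu _); apply/seteqP; split => E //= [].
have ms : measurable_fun setT (fun t => span (mxX t) : G).
  by apply: (measurable_span T); exact: mmeas_mx_of.
have h2 := @haar_unique R F T n m mn _ _ lamX _ (ball n m) S E0 ms
  (@measurable_inj_ball R F T n m).
apply: (@mule_cancel _ (lebesgue_tuple (ball n n))).
- exact: lebesgue_inj_ball_gt0.
- exact: lebesgue_inj_ball_lty.
rewrite h2//; first by rewrite -h1 -muleA (muleC (mu S)).
move=> u S' uI mS'.
pose A (X : 'M[F]_(n, m)) := (mx_inj X /\ dot X X < 1) /\ S' (span X).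
have ui := isometry_inj uI; have [uu uu'] := uI.
have uXi (X : 'M[F]_(n, m)) : mx_inj (u *m X) -> mx_inj X.
  by move=> uXi x Xx; apply: uXi; rewrite -mulmxA Xx mulmx0.
transitivity (lamX [set t | A (u *m mxX t)]).
  congr (lebesgue_tuple _); apply/seteqP; rewrite /A /inj_ball /=.
  split => t /=; rewrite (dot_unitary T)// => -[[Xi X1]].
    by rewrite (act_spanT T)// => SX; split => //; split => //; exact: mx_injM.
  by move=> SX; rewrite (act_spanT T)//; [split => //; split => //|]; exact: uXi.
rewrite (lebesgue_mull (T := T) ui)//.
  rewrite /cmod (lmod_unitary T _ uu) expr1n invr1 mul1e.
  by [].
apply: measurableI; first exact: (@measurable_inj_ball R F T n m).
exact: measurable_preimage ms mS'.
Qed.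

Lemma haar_integral (g : G -> \bar R) :
  measurable_fun setT g -> (forall E, 0 <= g E)%E ->
  frame_avg T g 1%:M = (lamX (ball n m) * \int[mu]_E g E)%E.
Proof.
move=> mg g0; have mB := @measurable_inj_ball R F T n m.
have ms : measurable_fun setT (fun t => span (mxX t) : G).
  by apply: (measurable_span T); exact: mmeas_mx_of.
have Bfin : lamX (ball n m) \is a fin_num.
  by rewrite ge0_fin_numE//; exact: lebesgue_inj_ball_lty.
have := @integral_image _ _ _ G _ (mrestr lamX mB) mu _ (fine (lamX (ball n m))) ms.
move=> /(_ (fine_ge0 (measure_ge0 _ _))) H.
rewrite -[X in (X * _)%E](fineK Bfin) -H//; last first.
  move=> A mA; rewrite fineK// -haar_law//; congr (lebesgue_tuple _).
  by apply/seteqP; split => t [].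
rewrite ge0_integral_mrestr//; last exact: (measurableT_comp mg ms).
rewrite integral_mkcond; apply: eq_integral => t _.
rewrite epatch_indic /=; congr (_ * _%:E)%E.
by rewrite (indic_ball T _ n_gt0 m_gt0) /wt mul1mx.
Qed.

Lemma vol_frame_span (h : 'M[F]_n) (X : 'M[F]_(n, m)) : mx_inj X ->
  vol T (h *m X) = vol T (h *m frame (span X)) * vol T X.
Proof.
move=> Xi; have [r [XE ri]] := frame_span T mn Xi.
have -> : vol T X = cmod T r.
  by rewrite {1}XE volM vol_orthonormal ?mul1r//; exact: (frameP T _).1.
by rewrite {1}XE mulmxA volM.
Qed.

(** The chosen bases [frame E] need not depend continuously on E, but on the open
    set of frames X of E the function is the quotient vol(hX) / vol(X) of two
    continuous functions, so its superlevel sets are open. *)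
Lemma measurable_vol_frame (h : 'M[F]_n) :
  measurable_fun setT (fun E : G => vol T (h *m frame E)).
Proof.
move=> mT; apply: (measurability _ (RGenOInfty.measurableE R)) => //.
move=> _ [_ [a ->] <-]; rewrite setTI.
apply: (open_measurable_Gr (T := T)).
have HC := continuous_class R 'rV[R]_(n * m * d).
pose f (v : 'rV[R]_(n * m * d)) : R :=
  vol T (h *m (unrealify T v : 'M[F]_(n, m))) + - a * vol T (unrealify T v : 'M[F]_(n, m)).
rewrite (_ : frames_of _ _ = [set v | mx_inj (unrealify T v : 'M[F]_(n, m))] `&`
  f @^-1` `]0, +oo[%classic).
  apply: openI; first exact: mx_inj_open.
  have /continuousP : continuous f.
    have mu1 := @mcont_unrealify R F T n m.
    apply: (classD HC).
      apply: (class_vol T HC); apply: (mclassM T HC) => //.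
      exact: mclass_cst.
    apply: (classM HC); first exact: (class_cst HC).
    exact: (class_vol T HC).
  by apply; exact: interval_open.
apply/seteqP; split => v; rewrite /frames_of /f /= !in_itv/= !andbT => -[vi].
  have v0 : 0 < vol T (unrealify T v : 'M[F]_(n, m)) by apply/vol_gt0.
  move=> av; split; first by [].
  rewrite (vol_frame_span h vi) mulNr -mulrBl; apply: mulr_gt0; last by [].
  by rewrite subr_gt0.
have v0 : 0 < vol T (unrealify T v : 'M[F]_(n, m)) by apply/vol_gt0.
by rewrite (vol_frame_span h vi) mulNr -mulrBl (pmulr_lgt0 _ v0) subr_gt0.
Qed.

(** In terms of a random frame X, the substitution X |-> h^-1 X preserves Lebesgue
    measure and turns the left-hand side into an average of g over frames weighted
    by [wt h^-1], because vol(hX) / vol(X) is the volume of h on the span of X. *)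
Lemma haar_density (h : 'M[F]_n) (g : G -> \bar R) : mx_inj h -> cmod T h = 1 ->
  measurable_fun setT g -> (forall E, 0 <= g E)%E ->
  (\int[mu]_E (g (act h E) * (vol T (h *m frame E) ^- n)%:E) = \int[mu]_E g E)%E.
Proof.
move=> hi h1 mg g0.
have [k [kh hk]] := mx_inj_invertible (scal_unit T) hi.
have ki : mx_inj k by move=> x kx; rewrite -[x]mul1mx -hk -mulmxA kx mulmx0.
apply: (@mule_cancel _ (lamX (ball n m))).
- exact: lebesgue_inj_ball_gt0.
- exact: lebesgue_inj_ball_lty.
have mact : measurable_fun setT (act h : G -> G) by exact: (measurable_act T).
rewrite -!haar_integral//; first last.
- by move=> E; rewrite mule_ge0// lee_fin invr_ge0 exprn_ge0// vol_ge0.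
- apply: emeasurable_funM; first exact: (measurableT_comp mg mact).
  apply/measurable_EFinP; apply: measurable_inv_real; apply: measurable_funX.
  exact: measurable_vol_frame.
rewrite -(frame_avg_indep T m_gt0 mg g0 ki).
pose psi (Z : 'M[F]_(n, m)) : \bar R := (g (span Z) * (wt T k Z)%:E)%E.
have mpsi : measurable_fun setT (psi \o mxX).
  apply: emeasurable_funM; first by apply: (measurable_g_span T mg); exact: mmeas_mx_of.
  by apply/measurable_EFinP; apply: measurable_wt; exact: mmeas_mx_of.
have psi0 Z : (0 <= psi Z)%E by rewrite mule_ge0// lee_fin wt_ge0.
transitivity (\int[lamX]_t psi (h *m mxX t))%E; last first.
  by rewrite (integral_mull hi mpsi)// h1 expr1n invr1 mul1e.
apply: eq_integral => t _; set X := mxX t; rewrite /psi.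
have [Xi|Xi] := pselect (mx_inj X); last first.
  have hXi : ~ mx_inj (h *m X).
    by move=> hXi; apply: Xi => x Xx; apply: hXi; rewrite -mulmxA Xx mulmx0.
  by rewrite !(wt_eq0 T m_gt0 mn _)// !mule0.
have -> : act h (span X) = span (h *m X) by exact: (act_spanT T mn hi Xi).
have v0 : vol T X ^+ n != 0 by rewrite expf_neq0// gt_eqF//; exact/vol_gt0.
have -> : wt T k (h *m X) = wt T 1%:M X * vol T (h *m frame (span X)) ^- n.
  rewrite /wt mul1mx (mulmxA k) kh mul1mx (vol_frame_span h Xi) exprMn invfM.
  move: (below1 (dot X X)) (vol T X ^+ n) v0 (vol T (h *m frame (span X)) ^- n) => b x x0 y.
  by rewrite -mulrA [x * x^-1 * y]mulrAC -mulrA.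
move: (g (span (h *m X))) (wt T 1%:M X) (vol T (h *m frame (span X)) ^- n) => a w y.
by rewrite -muleA -EFinM mulrC.
Qed.

End HaarDensity.

(** * Volumes of sections and projections *)
Lemma ge0_integral_mono d (U : measurableType d) (R : realType)
    (mu : {measure set U -> \bar R}) (f g : U -> \bar R) :
  (forall x, 0 <= f x)%E -> (forall x, f x <= g x)%E ->
  (\int[mu]_x f x <= \int[mu]_x g x)%E.
Proof.
move=> f0 fg; rewrite !ge0_integralTE//; last first.
  by move=> x; exact: le_trans (fg x).
apply: le_ereal_sup => _ [h hf <-]; exists h => //= x.
exact: le_trans (fg x).
Qed.

Lemma ge0_integral_le_nnsfun d (U : measurableType d) (R : realType)
    (mu : {measure set U -> \bar R}) (f : U -> \bar R) (a : \bar R) :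
  (forall x, 0 <= f x)%E ->
  (forall h : {nnsfun U >-> R}, (forall x, (h x)%:E <= f x)%E ->
     (\int[mu]_x (h x)%:E <= a)%E) ->
  (\int[mu]_x f x <= a)%E.
Proof.
move=> f0 H; rewrite ge0_integralTE//; apply: ge_ereal_sup => _ [h hf <-].
by rewrite -integralT_nnsfun; exact: H.
Qed.

Section Conclusion.
Variables (R : realType) (F : scalars R) (T : scalars_theory F).
Local Notation d := (rdim F).
Local Notation RT := (measurableTypeR R).
Variables (n m : nat) (m_gt0 : (0 < m)%N) (mn : (m <= n)%N).
Local Notation G := (borelGr F mn).
Variable mu : probability G R.
Hypothesis mu_Haar : is_Haar mu.

Lemma haar_density_le (h : 'M[F]_n) (g : G -> \bar R) : mx_inj h -> cmod T h = 1 ->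
  (forall E, 0 <= g E)%E ->
  (\int[mu]_E g E <=
   \int[mu]_E (g (act h E) * (vol T (h *m frame E) ^- n)%:E))%E.
Proof.
move=> hi h1 g0; apply: ge0_integral_le_nnsfun => // s sg.
have s0 E : (0 <= (s E)%:E)%E by rewrite lee_fin.
have ms : measurable_fun setT (EFin \o s).
  by apply/measurable_EFinP; exact: measurable_funP.
have := haar_density m_gt0 mu_Haar hi h1 ms s0; rewrite /comp => <-.
have w0 E : (0 <= (vol T (h *m frame (E : G)) ^- n)%:E)%E.
  by rewrite lee_fin invr_ge0 exprn_ge0// vol_ge0.
apply: ge0_integral_mono => E; first by rewrite mule_ge0.
by apply: lee_wpmul2r.
Qed.

(** The integral of an arbitrary nonnegative function is a supremum over the
    simple functions below it. Comparing suprema gives one inequality for h, and the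
    other one is the same inequality for h^-1. *)
Lemma haar_density_all (h : 'M[F]_n) (g : G -> \bar R) : mx_inj h -> cmod T h = 1 ->
  (forall E, 0 <= g E)%E ->
  (\int[mu]_E (g (act h E) * (vol T (h *m frame E) ^- n)%:E) = \int[mu]_E g E)%E.
Proof.
move=> hi h1 g0; apply/eqP; rewrite eq_le haar_density_le// andbT.
have [k [kh hk]] := mx_inj_invertible (scal_unit T) hi.
have ki : mx_inj k by move=> x kx; rewrite -[x]mul1mx -hk -mulmxA kx mulmx0.
have k1 : cmod T k = 1.
  by have := lmodM T 1 k h; rewrite kh lmod1 -/(cmod T h) h1 mulr1 => /esym.
pose g' (E : G) : \bar R := (g (act h E) * (vol T (h *m frame E) ^- n)%:E)%E.
have g'0 E : (0 <= g' E)%E.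
  by rewrite mule_ge0// lee_fin invr_ge0 exprn_ge0// vol_ge0.
apply: (le_trans (haar_density_le ki k1 g'0)).
apply: ge0_integral_mono => E.
  by rewrite mule_ge0// lee_fin invr_ge0 exprn_ge0// vol_ge0.
have fi := @frame_inj R F T n m mn E; have kfi := mx_injM ki fi.
(* The factors of h on kE and of k on E are inverse to each other. *)
have V : vol T (h *m frame (act k E)) * vol T (k *m frame E) = 1.
  rewrite /act -(vol_frame_span T mn h kfi) mulmxA hk mul1mx.
  by rewrite vol_orthonormal//; exact: (frameP T E).1.
rewrite /g' (actM T E hi ki) hk (act1 T) -muleA -EFinM -invfM -exprMn V.
by rewrite expr1n invr1 mule1.
Qed.

(** ** Volumes in subspaces *)

Lemma lebesgueFE p (A : set 'cV[F]_p) :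
  lebesgueF A = @lebesgue_tuple R (p * 1 * d) (@mx_of R F T p 1 @^-1` A).
Proof.
rewrite /lebesgueF /lebesgue_rV; congr (lebesgue_tuple _).
apply/seteqP; split => t /=.
  by move=> [x Ax xt]; rewrite /mx_of /rV_of_tuple -xt realifyK.
by move=> At; exists (mx_of T t) => //; rewrite realify_mx_of.
Qed.

Lemma volumeE (E : Gr F mn) A :
  volume E A = lebesgueF [set x : 'cV[F]_m | A (frame E *m x)].
Proof. by []. Qed.

Definition mclosed p (A : set 'cV[F]_p) := closed (@unrealify R F T p 1 @^-1` A).

Lemma realify_image p q (A : set 'M[F]_(p, q)) :
  @realify R F p q @` A = @unrealify R F T p q @^-1` A.
Proof.
apply/seteqP; split => v /=; first by move=> [x Ax <-]; rewrite realifyK.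
by move=> Av; exists (unrealify T v) => //; rewrite unrealifyK.
Qed.

Lemma lebesgueF_mull (s : 'M[F]_m) (A : set 'cV[F]_m) : mx_inj s -> mclosed A ->
  lebesgueF [set s *m x | x in A] = ((cmod T s)%:E * lebesgueF A)%E.
Proof.
move=> si Ac; have [k [ks sk]] := mx_inj_invertible (scal_unit T) si.
have ki : mx_inj k by move=> x kx; rewrite -[x]mul1mx -sk -mulmxA kx mulmx0.
have mA : measurable (@mx_of R F T m 1 @^-1` A) by exact: measurable_tuple_closed Ac.
rewrite !lebesgueFE; have := lebesgue_mull ki mA.
have ck : cmod T k * cmod T s = 1 by rewrite -lmodM ks lmod1.
have k0 : cmod T k != 0 by rewrite gt_eqF// cmod_gt0.
have -> : (cmod T k ^+ 1)^-1 = cmod T s.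
  by rewrite expr1 -[LHS]mulr1 -ck mulKf.
move=> <-; congr (lebesgue_tuple _); apply/seteqP; split => t /=.
  by move=> [x Ax <-]; rewrite mulmxA ks mul1mx.
by move=> At; exists (k *m mx_of T t) => //; rewrite mulmxA sk mul1mx.
Qed.

Lemma continuous_mull p q (a : 'M[F]_(p, q)) :
  continuous (fun v : 'rV[R]_(q * 1 * d) => realify (a *m (unrealify T v : 'cV[F]_q))).
Proof.
apply: (mcont_continuous (F := F)); apply: (mclassM T (continuous_class R _)).
  by apply: mclass_cst; exact: continuous_class.
exact: mcont_unrealify.
Qed.

Lemma mclosed_compact p (A : set 'cV[F]_p) : compact (@realify R F p 1 @` A) -> mclosed A.
Proof.
rewrite /mclosed -realify_image => /compact_closed; apply; exact: norm_hausdorff.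
Qed.

Lemma mclosed_preimage p q (a : 'M[F]_(p, q)) (A : set 'cV[F]_p) :
  mclosed A -> mclosed [set x | A (a *m x)].
Proof.
move=> Ac; have /continuous_closedP/(_ _ Ac) := @continuous_mull p q a.
by congr closed; apply/seteqP; split => v /=; rewrite realifyK.
Qed.

Lemma mclosed_image p q (a : 'M[F]_(p, q)) (A : set 'cV[F]_q) :
  compact (@realify R F q 1 @` A) -> mclosed [set a *m x | x in A].
Proof.
move=> Ac; apply: mclosed_compact.
have := continuous_compact (continuous_subspaceT (@continuous_mull p q a)) Ac.
congr compact; apply/seteqP; split => v /=.
  by move=> [_ [x Ax <-] <-]; exists (a *m x); [exists x|rewrite realifyK].
by move=> [_ [x Ax <-] <-]; exists (realify x); [exists x|rewrite realifyK].
Qed.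

Lemma innerE p (v w : 'cV[F]_p) : inner v w = dot v w.
Proof.
rewrite (dotE T) /inner /mxtrace big_ord1 mxE; congr re.
by apply: eq_bigr => i _; rewrite !mxE.
Qed.

Lemma dotBr p (u v w : 'cV[F]_p) : dot u (v - w) = dot u v - dot u w.
Proof.
have rB : realify (v - w) = realify v - realify w.
  by apply/eqP; rewrite eq_sym subr_eq -(realifyD T) subrK.
rewrite /dot /cdot rB -sumrB; apply: eq_bigr => i _.
by rewrite !mxE mulrBr.
Qed.

(** In the orthonormal basis f of E, the orthogonality condition forces the
    coordinates of the projection of x to be f^* x. *)
Lemma oprojE (E : Gr F mn) x :
  oproj (space E) x = frame E *m (adjoint (frame E) *m x).
Proof.
have [ff [fi fE]] := frameP T E.
have perp z : (forall e, space E e -> inner e (x - frame E *m z) = 0) ->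
    z = adjoint (frame E) *m x.
  move=> H; apply/eqP; rewrite -subr_eq0 -(dot_eq0 T); apply/eqP.
  set w := z - _; have Ew : space E (frame E *m w) by rewrite fE; exists w.
  have := H _ Ew; rewrite innerE (dot_adjoint T) mulmxBr mulmxA ff mul1mx.
  rewrite /w dotBr => h; rewrite dotBr -[RHS]oppr0 -[in RHS]h; ring.
rewrite /oproj; apply: xget_unique.
  split; first by rewrite fE; eexists.
  move=> e; rewrite fE => -[z _ <-].
  rewrite innerE (dot_adjoint T) mulmxBr !mulmxA ff mul1mx subrr.
  by rewrite /dot /cdot big1// => i _; rewrite (realify0 T) mxE mulr0.
by move=> y [+ H]; rewrite {1}fE => -[z _ zy]; rewrite -zy (perp z)// zy.
Qed.

Section Transformation.
Variables (h : 'M[F]_n) (hi : mx_inj h) (E : Gr F mn).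

(** The matrix s of h : E -> hE in the orthonormal bases of both subspaces; its
    modulus is the factor by which h expands volumes in E. *)
Lemma act_frame : exists2 s : 'M[F]_m, mx_inj s &
  h *m frame E = frame (act h E) *m s /\ cmod T s = vol T (h *m frame E).
Proof.
have hfi := mx_injM hi (@frame_inj R F T n m mn E).
have [s [hs si]] := frame_span T mn hfi.
exists s => //; split => //.
by rewrite hs volM vol_orthonormal ?mul1r//; exact: (frameP T _).1.
Qed.

(** The section of hK with hE is the image under h of the section of K with E. *)
Lemma volume_section (K : set 'cV[F]_n) : mclosed K ->
  volume (act h E) ([set h *m x | x in K] `&` space (act h E)) =
  ((vol T (h *m frame E))%:E * volume E (K `&` space E))%E.
Proof.
move=> Kc; have [s si [hs sv]] := act_frame.
have [f'i f'E] := (frameP T (act h E)).2; have [fi fE] := (frameP T E).2.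
rewrite -sv !volumeE.
have -> : [set x : 'cV[F]_m | (K `&` space E) (frame E *m x)] =
          [set x : 'cV[F]_m | K (frame E *m x)].
  by apply/seteqP; split => x /=; [case|move=> Kx; split => //; rewrite fE; exists x].
rewrite -lebesgueF_mull//; last exact: mclosed_preimage.
congr lebesgueF; apply/seteqP; split => x /=.
  move=> [[k Kk hk] _]; have [s' [ss' s's]] := mx_inj_invertible (scal_unit T) si.
  exists (s' *m x); last by rewrite mulmxA s's mul1mx.
  suff -> : frame E *m (s' *m x) = k by [].
  apply/eqP; rewrite -subr_eq0; apply/eqP; apply: hi.
  by rewrite mulmxBr !mulmxA hs -(mulmxA _ s) s's mulmx1 hk subrr.
move=> [y Ky <-]; split; last by rewrite f'E; exists (s *m y).
by exists (frame E *m y) => //; rewrite !mulmxA hs.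
Qed.

(** In coordinates, the projections of K to hE and of h^* K to E are f'^* K and
    (h f)^* K, where f and f' are the orthonormal bases of E and hE. As h f = f' s,
    they differ by s^*, whose modulus is that of s. *)
Lemma volume_projection (K : set 'cV[F]_n) : compact (@realify R F n 1 @` K) ->
  volume E (oproj (space E) @` [set adjoint h *m x | x in K]) =
  ((vol T (h *m frame E))%:E *
    volume (act h E) (oproj (space (act h E)) @` K))%E.
Proof.
move=> Kc; have [s si [hs sv]] := act_frame.
have coordE (E' : Gr F mn) A : [set x : 'cV[F]_m | (oproj (space E') @` A) (frame E' *m x)] =
    [set adjoint (frame E') *m x | x in A].
  apply/seteqP; split => x /= [k Ak].
    rewrite oprojE => fx; exists k => //.
    have := congr1 (mulmx (adjoint (frame E'))) fx.
    by rewrite !mulmxA (frameP T E').1 !mul1mx.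
  by move=> <-; exists k => //; rewrite oprojE.
have ai : mx_inj (adjoint s).
  apply: (@cmod_neq0_inj _ _ T); rewrite /cmod lmod_adjoint.
  by rewrite gt_eqF// cmod_gt0.
have cs : cmod T (adjoint s) = cmod T s by exact: lmod_adjoint.
rewrite -sv !volumeE !coordE -cs -lebesgueF_mull//; last first.
  exact: mclosed_image.
congr lebesgueF; apply/seteqP; split => x /=.
  move=> [_ [k Kk <-] <-]; exists (adjoint (frame (act h E)) *m k); first by exists k.
  by rewrite !mulmxA -!(adjointM T) hs.
move=> [_ [k Kk <-] <-]; exists (adjoint h *m k); first by exists k.
by rewrite !mulmxA -!(adjointM T) hs.
Qed.

End Transformation.

Lemma fine_mule (c : R) (x : \bar R) : 0 < c -> fine (c%:E * x)%E = c * fine x.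
Proof.
move=> c0; case: x => [x| |] //.
- by rewrite gt0_muley ?lte_fin//= mulr0.
- by rewrite gt0_muleNy ?lte_fin//= mulr0.
Qed.

Lemma volume_ge0 (E : Gr F mn) A : 0 <= fine (volume E A).
Proof. by apply: fine_ge0; rewrite volumeE lebesgueFE. Qed.

Lemma vol_act_gt0 (h : 'M[F]_n) (E : Gr F mn) : mx_inj h -> 0 < vol T (h *m frame E).
Proof. by move=> hi; apply/vol_gt0/mx_injM => //; exact: frame_inj. Qed.

(** The factor by which projections change is that of h = g^* on E, and its n-th
    power is the density of the change of variables E |-> hE. *)
Lemma Phi_invariant (g : 'M[F]_n) (K : set 'cV[F]_n) :
  compact (@realify R F n 1 @` K) -> cmod T g = 1 ->
  Phi mu [set g *m x | x in K] = Phi mu K.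
Proof.
move=> Kc g1; pose h := adjoint g.
have h1 : cmod T h = 1 by rewrite /cmod lmod_adjoint.
have hi : mx_inj h by apply: (@cmod_neq0_inj _ _ T); rewrite h1 oner_neq0.
rewrite /Phi -[RHS](haar_density_all hi h1); last first.
  by move=> E; rewrite lee_fin invr_ge0 exprn_ge0// volume_ge0.
apply: eq_integral => E _; rewrite -EFinM; congr EFin.
rewrite -[g](adjointK T) -/h (volume_projection hi)// fine_mule; last exact: vol_act_gt0.
by rewrite exprMn invfM mulrC.
Qed.

(** Here the n-th power of the factor cancels the density of E |-> gE. *)
Lemma Phi_tilde_invariant (g : 'M[F]_n) (K : set 'cV[F]_n) :
  compact (@realify R F n 1 @` K) -> cmod T g = 1 ->
  Phi_tilde mu [set g *m x | x in K] = Phi_tilde mu K.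
Proof.
move=> Kc g1.
have gi : mx_inj g by apply: (@cmod_neq0_inj _ _ T); rewrite g1 oner_neq0.
rewrite /Phi_tilde -[LHS](haar_density_all gi g1); last first.
  by move=> E; rewrite lee_fin exprn_ge0// volume_ge0.
apply: eq_integral => E _; rewrite -EFinM; congr EFin.
have v0 := vol_act_gt0 E gi.
rewrite (volume_section gi); last exact: mclosed_compact.
by rewrite fine_mule// exprMn mulrAC mulfV ?mul1r// expf_neq0// gt_eqF.
Qed.

End Conclusion.

Theorem theorem6p1 (R : realType) (k : field_kind) (n m : nat)
    (m_gt0 : (0 < m)%N) (mn : (m <= n)%N)
    (mu : probability (borelGr (scalars_of R k) mn) R) (mu_Haar : is_Haar mu)
    (K : set 'cV[scalars_of R k]_n)
    (K_body : convex_body K) (K_int : has_interior K)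
    (g : 'M[scalars_of R k]_n) (gSL : SL g) :
  Phi mu [set g *m x | x in K] = Phi mu K /\
  Phi_tilde mu [set g *m x | x in K] = Phi_tilde mu K.
Proof.
have [_ Kc _] := K_body.
have g1 : cmod (scalars_ofP R k) g = 1.
  move: (leq_trans m_gt0 mn) {mu mu_Haar K K_body K_int Kc}.
  by case: n mn g gSL => // p mn' g gSL _; exact: (SL_cmod gSL).2.
by split; [exact: Phi_invariant Kc g1|exact: Phi_tilde_invariant Kc g1].
Qed.
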